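(* Let $n\ge2$, $Q=2n+2$, and let $u$ be a smooth positive solution of $$-\Delta_{\mathbb{H}^n}u = 2n^2\,u^{\frac{Q+2}{Q-2}}\quad\text{in }\mathbb{H}^n$$ such that, for some $C>0$, $$u(\xi)\le\frac{C}{1+|\xi|^{\frac{Q-2}{2}}}\qquad\forall\,\xi\in\mathbb{H}^n.$$ Then $u\equiv\mathcal{U}_{\lambda,\mu}$ for some $\lambda\in\mathbb{C}$, $\mu\in\mathbb{C}^n$ with $\mathrm{Im}(\lambda)>\frac{|\mu|^2}{4}$, where $$\mathcal{U}_{\lambda,\mu}(z,t)=\frac{C'}{|t+i|z|^2+z\cdot\mu+\lambda|^n}$$ and $C'=C'(n,\lambda)>0$ is the explicit constant for which $\mathcal{U}_{\lambda,\mu}$ solves the equation (Jerison–Lee bubbles).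
   Context: The Heisenberg group $\mathbb{H}^n=\mathbb{C}^n\times\mathbb{R}$ has coordinates $\xi=(z,t)=(z_1,\dots,z_n,t)$ and group law $(z,t)\circ(w,s)=(z+w,t+s+2\,\mathrm{Im}(z^\alpha\bar w^\alpha))$ (summation over repeated Greek indices). The norm is $|\xi|=(|z|^4+t^2)^{1/4}$. Define $Z_\alpha=\frac{\partial}{\partial z^\alpha}+i\bar z_\alpha\frac{\partial}{\partial t}$, $Z_{\bar\alpha}=\frac{\partial}{\partial\bar z^\alpha}-iz_\alpha\frac{\partial}{\partial t}$, and the sub-Laplacian $\Delta_{\mathbb{H}^n}f=\sum_{\alpha}(Z_{\bar\alpha}Z_\alpha f+Z_\alpha Z_{\bar\alpha}f)$. *)

(* Defs.v *)
From mathcomp Require Import all_boot all_algebra all_classical all_reals all_analysis.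
Import GRing.Theory Num.Theory numFieldNormedType.Exports.
Set Implicit Arguments. Unset Strict Implicit. Unset Printing Implicit Defensive.
Local Open Scope ring_scope.

Definition cpx (R : realType) := (R * R)%type.
Definition cadd {R : realType} (a b : cpx R) : cpx R := (a.1 + b.1, a.2 + b.2).
Definition cneg {R : realType} (a : cpx R) : cpx R := (- a.1, - a.2).
Definition csub {R : realType} (a b : cpx R) : cpx R := cadd a (cneg b).
Definition cmul {R : realType} (a b : cpx R) : cpx R :=
  (a.1 * b.1 - a.2 * b.2, a.1 * b.2 + a.2 * b.1).
Definition cscale {R : realType} (r : R) (a : cpx R) : cpx R := (r * a.1, r * a.2).
Definition cI {R : realType} : cpx R := (0, 1).
Definition cconj {R : realType} (a : cpx R) : cpx R := (a.1, - a.2).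
Definition cabs {R : realType} (a : cpx R) : R := Num.sqrt (a.1 ^+ 2 + a.2 ^+ 2).
Definition creal {R : realType} (r : R) : cpx R := (r, 0).
Definition csum {R : realType} (n : nat) (F : 'I_n -> cpx R) : cpx R :=
  (\sum_(i < n) (F i).1, \sum_(i < n) (F i).2).

(* A point xi = (z, t) with z_a = x_a + i y_a is stored as (x, y, t). *)
Definition Hn (R : realType) (n : nat) := ('rV[R]_n * 'rV[R]_n * R)%type.
Definition hx {R : realType} {n : nat} (p : Hn R n) : 'rV[R]_n := p.1.1.
Definition hy {R : realType} {n : nat} (p : Hn R n) : 'rV[R]_n := p.1.2.
Definition ht {R : realType} {n : nat} (p : Hn R n) : R := p.2.
Definition hz {R : realType} {n : nat} (a : 'I_n) (p : Hn R n) : cpx R :=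
  (hx p 0 a, hy p 0 a).

Definition zsq {R : realType} {n : nat} (p : Hn R n) : R :=
  \sum_(a < n) (hx p 0 a ^+ 2 + hy p 0 a ^+ 2).
Definition hnorm {R : realType} {n : nat} (p : Hn R n) : R :=
  powR (zsq p ^+ 2 + ht p ^+ 2) (1 / 4).

Definition ex {R : realType} {n : nat} (a : 'I_n) : Hn R n :=
  (\row_(j < n) (j == a)%:R, 0, 0).
Definition ey {R : realType} {n : nat} (a : 'I_n) : Hn R n :=
  (0, \row_(j < n) (j == a)%:R, 0).
Definition et {R : realType} {n : nat} : Hn R n := (0, 0, 1).

Fixpoint Ck {R : realType} {n : nat} (k : nat) (f : Hn R n -> R) : Prop :=
  match k with
  | 0 => continuous f
  | k'.+1 => (forall p, differentiable f p) /\ (forall v : Hn R n, Ck k' ('D_v f))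
  end.
Definition smooth {R : realType} {n : nat} (f : Hn R n -> R) : Prop :=
  forall k, Ck k f.

Definition cD {R : realType} {n : nat} (v : Hn R n) (g : Hn R n -> cpx R)
  (p : Hn R n) : cpx R :=
  ('D_v (fun q => (g q).1) p, 'D_v (fun q => (g q).2) p).

Definition dz {R : realType} {n : nat} (a : 'I_n) (g : Hn R n -> cpx R) p : cpx R :=
  cscale (1 / 2) (csub (cD (ex a) g p) (cmul cI (cD (ey a) g p))).
Definition dzbar {R : realType} {n : nat} (a : 'I_n) (g : Hn R n -> cpx R) p : cpx R :=
  cscale (1 / 2) (cadd (cD (ex a) g p) (cmul cI (cD (ey a) g p))).

Definition Zf {R : realType} {n : nat} (a : 'I_n) (g : Hn R n -> cpx R) p : cpx R :=
  cadd (dz a g p) (cmul (cmul cI (cconj (hz a p))) (cD et g p)).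
Definition Zbarf {R : realType} {n : nat} (a : 'I_n) (g : Hn R n -> cpx R) p : cpx R :=
  csub (dzbar a g p) (cmul (cmul cI (hz a p)) (cD et g p)).

Definition subLap {R : realType} {n : nat} (f : Hn R n -> R) (p : Hn R n) : cpx R :=
  let g := fun q => creal (f q) in
  csum (fun a : 'I_n => cadd (Zbarf a (Zf a g) p) (Zf a (Zbarf a g) p)).

Definition Qdim {R : realType} (n : nat) : R := (2 * n + 2)%:R.

Definition zdot {R : realType} {n : nat} (p : Hn R n) (mu : 'I_n -> cpx R) : cpx R :=
  csum (fun a => cmul (hz a p) (mu a)).
Definition cnorm2 {R : realType} {n : nat} (mu : 'I_n -> cpx R) : R :=
  \sum_(a < n) ((mu a).1 ^+ 2 + (mu a).2 ^+ 2).
Definition JLbubble {R : realType} {n : nat} (C' : R) (lam : cpx R)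
  (mu : 'I_n -> cpx R) (p : Hn R n) : R :=
  C' / (cabs (cadd (cadd (cadd (creal (ht p)) (cmul cI (creal (zsq p)))) (zdot p mu)) lam)) ^+ n.

(* Main.v *)
From HB Require Import structures.
Require Import Defs.
From mathcomp Require Import all_boot all_order all_algebra all_classical all_reals all_analysis.
From mathcomp Require Import complex ring lra zify.
(* Required again because all_analysis has its own cadd. *)
Require Import Defs.
Import Order.TTheory GRing.Theory Num.Theory numFieldNormedType.Exports.
Set Implicit Arguments. Unset Strict Implicit. Unset Printing Implicit Defensive.
Local Open Scope classical_set_scope.
Local Open Scope ring_scope.

(** Put f = (ln u) / n and let D, E, G be the Jerison-Lee tensors: D_ab = f_ab - 2 f_a f_b,
    E_ab the trace-free part of Zb_b Z_a f, and G_a = i f_0a - i f_0 f_a + (|df|^2 + e^(2f)) f_a.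
    The Jerison-Lee identity writes a divergence as e^((2n-2)f) times a sum of squares of these
    tensors.  It is multiplied by a cutoff at scale r, and the error terms are absorbed with three
    more divergences, those of e^((2n-2)f) |df|^2 f_a, e^((2n-2)f) i f_0 f_a and f_a, each with its
    own cutoff.  The decay of u gives e^(2f) <= C / r^2 on the region where the cutoffs vary, so
    the total error is O(r^-2) and D = E = G = 0.  Integrals are replaced by Riemann sums: the
    mean-value theorem shows that the sum of a derivative tends to 0 with the mesh.

    With g = |df|^2 + e^(2f) - i f_0, the equations D = E = G = 0 give Zb_a g = 0 and
    Z_a g = 2 g f_a.  Then 1/g is annihilated by Zb_a and Z_b Z_a while Zb_b Z_a (1/g) is twice the
    identity matrix, so i/g = t + i|z|^2 + z.mu + lambda; moreover e^(2f) / |g|^2 is constant. *)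

(** * The Jerison-Lee identity in a CR calculus *)

(** The bound on u says nothing about its derivatives, while the Jerison-Lee field carries |df|^2
    and f_0. Tested against a cutoff phi, it leaves errors K psi (|df|^4 + f_0^2 + e^(4f)), with K
    of order r^-2 and w = e^((2n-2)f) as a common weight. K times the divergences of w |df|^2 f_a
    and w i f_0 f_a absorbs the first two at the price of K^2 chi |df|^2; the divergence of f_a,
    weighted by K^2 times the bound K^(n-1) of w, reduces this to K^3. The total K^(n+2), of order
    r^(-2n-4), meets the volume r^(2n+2) of the box: hence the r^-2. Each stage differentiates a
    cutoff, and the result must be controlled by the next one.

    The tensor identities are proved in an arbitrary commutative ring, where [ring] applies. The
    symmetry [swap] turns each identity into its conjugate, and inverses enter only as elements h
    with h g = 1. *)

Record derivation (A : comPzRingType) (d : A -> A) : Prop := Derivation {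
  derD : forall x y, d (x + y) = d x + d y;
  derM : forall x y, d (x * y) = d x * y + x * d y }.

Section Derivation.
Variables (A : comPzRingType) (d : A -> A) (dP : derivation d).

Lemma der0 : d 0 = 0.
Proof. by apply: (addrI (d 0)); rewrite -(derD dP) !addr0. Qed.

Lemma derN x : d (- x) = - d x.
Proof. by apply: (addrI (d x)); rewrite -(derD dP) !subrr der0. Qed.

Lemma derB x y : d (x - y) = d x - d y.
Proof. by rewrite (derD dP) derN. Qed.

Lemma der_sum (J : finType) (P : pred J) (F : J -> A) :
  d (\sum_(j | P j) F j) = \sum_(j | P j) d (F j).
Proof. exact: (big_morph d (derD dP) der0). Qed.

Lemma der_nat m : d m%:R = 0.
Proof.
have d1 : d 1 = 0.
  apply: (addrI (d 1)); rewrite addr0 -{3}[1]mulr1 (derM dP) mulr1 mul1r //.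
by elim: m => [|m IH]; rewrite ?mulr0n ?der0 // mulrS (derD dP) d1 IH addr0.
Qed.

Lemma derMn x m : d (m%:R * x) = m%:R * d x.
Proof. by rewrite (derM dP) der_nat mul0r add0r. Qed.

End Derivation.

(* A CR calculus: [Z a], [Zb a] play the vector fields of the statement and [T] is the t-derivative. *)
Record cr (A : comPzRingType) (n : nat) := CR {
  I : A; Z : 'I_n -> A -> A; Zb : 'I_n -> A -> A; T : A -> A }.

(** Formal complex conjugation: an identity proved for every calculus gives its conjugate when
    applied to [swap c], so each computation is done for one type only. *)
Definition swap A n (c : cr A n) : cr A n := CR (- I c) (Zb c) (Z c) (T c).

Record cr_axioms (A : comPzRingType) n (c : cr A n) : Prop := CRAxioms {
  cII : I c * I c = - 1;
  cZ : forall a, derivation (Z c a);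
  cZb : forall a, derivation (Zb c a);
  cT : derivation (T c);
  cZI : forall a, Z c a (I c) = 0;
  cZbI : forall a, Zb c a (I c) = 0;
  cTI : T c (I c) = 0;
  cZZ : forall a b x, Z c a (Z c b x) = Z c b (Z c a x);
  cZbZb : forall a b x, Zb c a (Zb c b x) = Zb c b (Zb c a x);
  cZT : forall a x, Z c a (T c x) = T c (Z c a x);
  cZbT : forall a x, Zb c a (T c x) = T c (Zb c a x);
  cZbZ : forall a b x,
    Zb c b (Z c a x) = Z c a (Zb c b x) + (a == b)%:R * (2%:R * I c * T c x) }.

Lemma cr_swap (A : comPzRingType) n (c : cr A n) : cr_axioms c -> cr_axioms (swap c).
Proof.
case=> h1 h2 h3 h4 h5 h6 h7 h8 h9 h10 h11 h12; split=> //=.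
- by rewrite mulrNN.
- by move=> a; rewrite derN // h6 oppr0.
- by move=> a; rewrite derN // h5 oppr0.
- by rewrite derN // h7 oppr0.
- by move=> a b x; rewrite h12 [b == a]eq_sym; ring.
Qed.

Lemma swapK (A : comPzRingType) n : involutive (@swap A n).
Proof. by case=> i z zb t; rewrite /swap /= opprK. Qed.

(** The half is an element [h] with [h + h = 1], so the vector fields make sense without division.
    The axioms reduce to commuting coordinate derivatives and their values on the coordinates. *)
Lemma cr_model (A : comPzRingType) n (X Y : 'I_n -> A -> A) (T : A -> A)
    (z zb : 'I_n -> A) (i h : A) :
  i * i = - 1 -> h + h = 1 ->
  (forall a, derivation (X a)) -> (forall a, derivation (Y a)) -> derivation T ->
  (forall a, X a i = 0) -> (forall a, Y a i = 0) -> T i = 0 ->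
  (forall a, X a h = 0) -> (forall a, Y a h = 0) -> T h = 0 ->
  (forall a b, X b (z a) = (a == b)%:R) -> (forall a b, Y b (z a) = i * (a == b)%:R) ->
  (forall a b, X b (zb a) = (a == b)%:R) -> (forall a b, Y b (zb a) = - (i * (a == b)%:R)) ->
  (forall a, T (z a) = 0) -> (forall a, T (zb a) = 0) ->
  (forall a b x, X a (X b x) = X b (X a x)) -> (forall a b x, X a (Y b x) = Y b (X a x)) ->
  (forall a b x, Y a (Y b x) = Y b (Y a x)) ->
  (forall a x, X a (T x) = T (X a x)) -> (forall a x, Y a (T x) = T (Y a x)) ->
  cr_axioms (CR i (fun a F => h * (X a F - i * Y a F) + i * zb a * T F)
                  (fun a F => h * (X a F + i * Y a F) - i * z a * T F) T).
Proof.
move=> ii hh dX dY dT Xi Yi Ti Xh Yh Th Xz Yz Xzb Yzb Tz Tzb XX XY YY XT YT.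
have dXE a := (derD (dX a), derB (dX a), derN (dX a), derM (dX a)).
have dYE a := (derD (dY a), derB (dY a), derN (dY a), derM (dY a)).
have dTE := (derD dT, derB dT, derN dT, derM dT, Ti, Th, Tz, Tzb).
split=> //=.
- move=> a; split=> F G; rewrite ?(derD (dX a), derD (dY a), derD dT);
  by rewrite ?(derM (dX a), derM (dY a), derM dT); ring.
- move=> a; split=> F G; rewrite ?(derD (dX a), derD (dY a), derD dT);
  by rewrite ?(derM (dX a), derM (dY a), derM dT); ring.
- by move=> a; rewrite Xi Yi Ti; ring.
- by move=> a; rewrite Xi Yi Ti; ring.
- move=> a b x; rewrite !(dXE, Xi, Xh, Xz, Xzb) !(dYE, Yi, Yh, Yz, Yzb) !dTE !(XT, YT).
  rewrite (XX a b) (XY a b) (XY b a) (YY a b) [b == a]eq_sym; ring.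
- move=> a b x; rewrite !(dXE, Xi, Xh, Xz, Xzb) !(dYE, Yi, Yh, Yz, Yzb) !dTE !(XT, YT).
  rewrite (XX a b) (XY a b) (XY b a) (YY a b) [b == a]eq_sym; ring.
- by move=> a x; rewrite !dTE !(XT, YT); ring.
- by move=> a x; rewrite !dTE !(XT, YT); ring.
- move=> a b x; rewrite !(dXE, Xi, Xh, Xz, Xzb) !(dYE, Yi, Yh, Yz, Yzb) !dTE !(XT, YT).
  rewrite (XX a b) (XY a b) (XY b a) (YY a b) [b == a]eq_sym.
  (* The commutator comes out with a factor [h]; writing the target with [h + h] lets [ring]
     conclude from [i * i = -1]. *)
  have -> : 2%:R * i * T x = (h + h) * (2%:R * i * T x) by rewrite hh mul1r.
  by ring: ii.
Qed.

(** * The Jerison-Lee tensors and their dot products *)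

Section Tensors.
Variables (A : comPzRingType) (n : nat) (c : cr A n) (f E2 : A).

Definition dot (x y : 'I_n -> A) : A := \sum_a x a * y a.
Definition nrm2 := dot (Z c ^~ f) (Zb c ^~ f).
Definition ss := nrm2 + E2.
Definition gg := ss - I c * T c f.
Definition Dt a b := Z c b (Z c a f) - 2%:R * Z c a f * Z c b f.
Definition Et a b := Zb c b (Z c a f) + (a == b)%:R * gg.
Definition Gv a := I c * Z c a (T c f) - I c * T c f * Z c a f + ss * Z c a f.
Definition Dv a := \sum_b Dt a b * Zb c b f.
Definition Ev a := \sum_b Et a b * Z c b f.

End Tensors.

Lemma dotC (A : comPzRingType) n (x y : 'I_n -> A) : dot x y = dot y x.
Proof. by apply: eq_bigr => a _; rewrite mulrC. Qed.

Section Dot.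
Variables (A : comPzRingType) (n : nat).
Implicit Types x y z : 'I_n -> A.

Lemma dotDl x y z : dot (fun a => x a + y a) z = dot x z + dot y z.
Proof. by rewrite /dot -big_split; apply: eq_bigr => a _; rewrite mulrDl. Qed.

Lemma dotZl k x z : dot (fun a => k * x a) z = k * dot x z.
Proof. by rewrite /dot mulr_sumr; apply: eq_bigr => a _; rewrite mulrA. Qed.

Lemma dotNl x z : dot (fun a => - x a) z = - dot x z.
Proof. by rewrite /dot -sumrN; apply: eq_bigr => a _; rewrite mulNr. Qed.

Lemma dotBl x y z : dot (fun a => x a - y a) z = dot x z - dot y z.
Proof. by rewrite dotDl dotNl. Qed.

Lemma dotDr x y z : dot z (fun a => x a + y a) = dot z x + dot z y.
Proof. by rewrite dotC dotDl !(dotC z). Qed.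

Lemma dotNr x z : dot z (fun a => - x a) = - dot z x.
Proof. by rewrite dotC dotNl (dotC z). Qed.

Lemma dotBr x y z : dot z (fun a => x a - y a) = dot z x - dot z y.
Proof. by rewrite dotC dotBl !(dotC z). Qed.

End Dot.

(* [E2] stands for e^{2f}; [jl_eq] is the equation in the form f_{a abar} = - n g. *)
Record jl_sol (A : comPzRingType) n (c : cr A n) (f E2 : A) : Prop := JLSol {
  jl_cr : cr_axioms c;
  jl_Z : forall a, Z c a E2 = 2%:R * E2 * Z c a f;
  jl_Zb : forall a, Zb c a E2 = 2%:R * E2 * Zb c a f;
  jl_T : T c E2 = 2%:R * E2 * T c f;
  jl_eq : \sum_a Zb c a (Z c a f) = - n%:R * gg c f E2 }.

(* [U] stands for u = e^{nf}; the hypothesis is the Yamabe equation for u. *)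
Lemma yamabe_log (A : comPzRingType) n (c : cr A n) (f E2 U : A) : cr_axioms c ->
  (forall a, Z c a U = n%:R * U * Z c a f) ->
  (forall a, Zb c a U = n%:R * U * Zb c a f) ->
  \sum_a (Zb c a (Z c a U) + Z c a (Zb c a U)) = - (2%:R * n%:R * n%:R) * (U * E2) ->
  2%:R * (n%:R * (U * (\sum_a Zb c a (Z c a f)))) =
  2%:R * (n%:R * (U * (- n%:R * gg c f E2))).
Proof.
move=> hc ZU ZbU.
have ZbZU a : Zb c a (Z c a U) + Z c a (Zb c a U) =
   n%:R * U * (2%:R * Zb c a (Z c a f) - 2%:R * I c * T c f
      + 2%:R * n%:R * (Z c a f * Zb c a f)).
  rewrite ZU ZbU !(derM (cZb hc a)) !(derM (cZ hc a)).
  rewrite !(der_nat (cZb hc a), der_nat (cZ hc a)) ZU ZbU.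
  have -> : Z c a (Zb c a f) = Zb c a (Z c a f) - 2%:R * I c * T c f.
    by rewrite (cZbZ hc) eqxx mul1r addrK.
  ring.
under eq_bigr do rewrite ZbZU.
rewrite -mulr_sumr big_split /= sumrB sumr_const card_ord -!mulr_sumr.
rewrite -/(dot (Z c ^~ f) (Zb c ^~ f)) -/(nrm2 c f) -[X in _ - X]mulr_natr => e.
transitivity (n%:R * U * (2 * (\sum_i Zb c i (Z c i f)) -
      2 * I c * T c f * n%:R + 2 * n%:R * nrm2 c f)
    + n%:R * U * (2 * I c * T c f * n%:R - 2 * n%:R * nrm2 c f)); first by ring.
by rewrite e /gg /ss; ring.
Qed.

Lemma ss_swap (A : comPzRingType) n (c : cr A n) (f E2 : A) :
  ss (swap c) f E2 = ss c f E2.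
Proof. by rewrite /ss /nrm2 dotC. Qed.

Lemma jl_swap (A : comPzRingType) n (c : cr A n) (f E2 : A) :
  jl_sol c f E2 -> jl_sol (swap c) f E2.
Proof.
case=> hc h1 h2 h3 h4; split=> //; first exact: cr_swap.
rewrite /gg ss_swap /=.
have -> : \sum_a Z c a (Zb c a f) =
    \sum_a Zb c a (Z c a f) - n%:R * (2%:R * I c * T c f).
  rewrite mulr_natl -[n in _ *+ n]card_ord -sumr_const -sumrB.
  by apply: eq_bigr => a _; rewrite (cZbZ hc) eqxx mul1r addrK.
by rewrite h4 /gg; ring.
Qed.

Section Identities.
Variables (A : comPzRingType) (n : nat) (c : cr A n) (f E2 : A).
Hypothesis sol : jl_sol c f E2.

Let hc := jl_cr sol.
Notation i := (I c).
Notation f0 := (T c f).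
Notation s := (ss c f E2).
Notation g := (gg c f E2).
Notation gb := (gg (swap c) f E2).
Notation p a := (Z c a f).
Notation pb a := (Zb c a f).
Notation N := (nrm2 c f).
Notation D := (Dv c f).
Notation E := (Ev c f E2).
Notation G := (Gv c f E2).
Notation Db := (Dv (swap c) f).
Notation Eb := (Ev (swap c) f E2).
Notation Gb := (Gv (swap c) f E2).

Lemma gbE : gb = s + i * f0.
Proof. by rewrite /gg ss_swap /=; ring. Qed.

(** The commutator term 2 i f_0 is exactly the difference between g and its conjugate, so E is
    Hermitian. *)
Lemma Et_herm a b : Et (swap c) f E2 b a = Et c f E2 a b.
Proof.
rewrite /Et /= (cZbZ hc) gbE /gg eq_sym; case: (_ == _); ring.
Qed.

Lemma ZbZ_E a b : Zb c b (p a) = Et c f E2 a b - (a == b)%:R * g.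
Proof. by rewrite /Et addrK. Qed.

Lemma ZZ_D a b : Z c b (p a) = Dt c f a b + 2%:R * p a * p b.
Proof. by rewrite /Dt subrK. Qed.

Lemma sum_delta (F : 'I_n -> A) a : \sum_b (a == b)%:R * F b = F a.
Proof.
rewrite (bigD1 a) //= eqxx mul1r big1 ?addr0 // => b ba.
by rewrite eq_sym (negbTE ba) mul0r.
Qed.

(** In the derivative of f_b f_bbar, Z Z f is D up to a product of first derivatives and Z Zb f is E
    minus a multiple of the identity. The contractions [Dv] and [Ev] arise here. *)
Lemma ZN a : Z c a N = D a + E a + 2%:R * N * p a - gb * p a.
Proof.
rewrite /nrm2 /dot (der_sum (cZ hc a)).
rewrite -(sum_delta (fun b => gb * p b) a) mulr_sumr mulr_suml -!big_split -sumrB.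
apply: eq_bigr => b _; rewrite (derM (cZ hc a)) (cZZ hc a b) ZZ_D.
have -> : Z c a (pb b) = Et c f E2 a b - (a == b)%:R * gb.
  by rewrite -Et_herm /Et /= eq_sym addrK.
by rewrite /=; ring.
Qed.

Lemma Zf0 a : i * Z c a f0 = G a + i * f0 * p a - s * p a.
Proof. rewrite /Gv; ring. Qed.

Lemma Zs a : Z c a s = D a + E a + g * p a.
Proof.
rewrite [s in LHS]/ss (derD (cZ hc a)) ZN (jl_Z sol) gbE /gg /ss; ring.
Qed.

Lemma Zg a : Z c a g = D a + E a - G a + 2%:R * g * p a.
Proof.
rewrite {1}/gg (derB (cZ hc a)) (derM (cZ hc a)) (cZI hc) mul0r add0r Zf0 Zs.
rewrite /gg; ring.
Qed.

Lemma Zgb a : Z c a gb = D a + E a + G a.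
Proof.
rewrite gbE (derD (cZ hc a)) (derM (cZ hc a)) (cZI hc) mul0r add0r Zf0 Zs.
rewrite /gg; ring.
Qed.


End Identities.

(** * Divergences of the tensors *)

Section Divergence.
Variables (A : comPzRingType) (n : nat) (c : cr A n) (f E2 : A).
Hypothesis sol : jl_sol c f E2.

Let hc := jl_cr sol.
Let hs := jl_swap sol.
Notation i := (I c).
Notation f0 := (T c f).
Notation s := (ss c f E2).
Notation g := (gg c f E2).
Notation gb := (gg (swap c) f E2).
Notation p a := (Z c a f).
Notation pb a := (Zb c a f).
Notation N := (nrm2 c f).
Notation D := (Dv c f).
Notation E := (Ev c f E2).
Notation G := (Gv c f E2).
Notation Db := (Dv (swap c) f).
Notation Eb := (Ev (swap c) f E2).
Notation Gb := (Gv (swap c) f E2).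

Lemma Zbg a : Zb c a g = Db a + Eb a + Gb a.
Proof. by have := Zgb hs a; rewrite swapK. Qed.

Lemma Zbf0 a : i * Zb c a f0 = - Gb a + gb * pb a.
Proof.
have := Zf0 (swap c) f E2 a; rewrite /= ss_swap => e.
by rewrite -[LHS]opprK -mulNr e /gg /= ss_swap; ring.
Qed.

Lemma Zbs a : Zb c a s = Db a + Eb a + gb * pb a.
Proof. by have := Zs hs a; rewrite ss_swap. Qed.

Lemma ZbZb_D a b : Zb c a (pb b) = Dt (swap c) f a b + 2%:R * pb a * pb b.
Proof. by rewrite /Dt /= (cZbZb hc) subrK. Qed.

(** Commuting Zb_a past Z_b leaves Z_b of the trace of Zb Z f, which the equation makes -n g, and 2
    i Z_b f_0, which is G up to lower order. So no third derivative survives. *)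
Lemma div_Dt b :
  \sum_a Zb c a (Dt c f a b) = - n%:R * D b - (n%:R + 2%:R) * (E b - G b).
Proof.
have -> : \sum_a Zb c a (Dt c f a b) = Z c b (\sum_a Zb c a (p a))
    + \sum_a (b == a)%:R * (2%:R * i * Z c a f0)
    - 2%:R * (\sum_a Zb c a (p a)) * p b
    - 2%:R * (E b - \sum_a (b == a)%:R * (g * p a)).
  rewrite (der_sum (cZ hc b)) mulr_sumr mulr_suml -!sumrB -big_split mulr_sumr.
  rewrite -!sumrB; apply: eq_bigr => a _.
  rewrite /Dt (derB (cZb hc a)) !(derM (cZb hc a)) (der_nat (cZb hc a)).
  by rewrite (cZbZ hc b a (p a)) -(cZT hc) (ZbZ_E c f E2 b a) /=; ring.
rewrite (jl_eq sol) !sum_delta -(opprK n%:R) (derM (cZ hc b)).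
rewrite !(derN (cZ hc b)) (der_nat (cZ hc b)) (Zg sol).
have := Zf0 c f E2 b; rewrite /gg => e; ring: e.
Qed.

Lemma div_D : \sum_a Zb c a (D a) =
  \sum_a \sum_b Dt c f a b * Dt (swap c) f a b
  + (2%:R - n%:R) * dot D (Zb c ^~ f)
  - (n%:R + 2%:R) * (dot E (Zb c ^~ f) - dot G (Zb c ^~ f)).
Proof.
have -> : \sum_a Zb c a (D a) =
    \sum_a \sum_b Dt c f a b * Dt (swap c) f a b
    + 2%:R * dot D (Zb c ^~ f) + \sum_b (\sum_a Zb c a (Dt c f a b)) * pb b.
  under [X in _ = _ + X]eq_bigr do rewrite mulr_suml.
  rewrite [X in _ = _ + X]exchange_big /dot mulr_sumr -!big_split; apply: eq_bigr => a _ /=.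
  rewrite /Dv (der_sum (cZb hc a)) mulr_suml mulr_sumr -!big_split.
  by apply: eq_bigr => b _ /=; rewrite (derM (cZb hc a)) ZbZb_D; ring.
under [X in _ + X = _]eq_bigr do rewrite div_Dt.
have -> : \sum_b (- n%:R * D b - (n%:R + 2%:R) * (E b - G b)) * pb b =
    - n%:R * dot D (Zb c ^~ f)
    - (n%:R + 2%:R) * (dot E (Zb c ^~ f) - dot G (Zb c ^~ f)).
  by rewrite /dot -sumrB !mulr_sumr -sumrB; apply: eq_bigr => b _; ring.
ring.
Qed.

Lemma trE : \sum_a Et c f E2 a a = 0.
Proof.
rewrite big_split (jl_eq sol) /=.
under eq_bigr do rewrite eqxx mul1r.
by rewrite sumr_const card_ord -mulr_natl; ring.
Qed.

Lemma div_E : \sum_a Zb c a (E a) =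
  \sum_a \sum_b Et c f E2 a b * Et c f E2 b a
  - (n%:R - 1) * dot (fun a => Db a + Eb a + Gb a) (Z c ^~ f).
Proof.
(* The fields Zb commute with each other, so this contraction is again a derivative of the trace,
   hence proportional to Zb_b g. *)
have divEt b : \sum_a Zb c a (Et c f E2 a b) = (1 - n%:R) * Zb c b g.
  have -> : \sum_a Zb c a (Et c f E2 a b) =
      Zb c b (\sum_a Zb c a (p a)) + \sum_a (b == a)%:R * Zb c a g.
    rewrite (der_sum (cZb hc b)) -big_split; apply: eq_bigr => a _ /=.
    rewrite /Et (derD (cZb hc a)) (cZbZb hc) (derMn (cZb hc a)).
    by rewrite [a == b]eq_sym.
  rewrite (jl_eq sol) sum_delta (derM (cZb hc b)) (derN (cZb hc b)).
  by rewrite (der_nat (cZb hc b)); ring.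
have -> : \sum_a Zb c a (E a) =
    \sum_a \sum_b Et c f E2 a b * Et c f E2 b a - g * (\sum_a Et c f E2 a a)
    + \sum_b (\sum_a Zb c a (Et c f E2 a b)) * p b.
  under [X in _ = _ + X]eq_bigr do rewrite mulr_suml.
  rewrite [X in _ = _ + X]exchange_big mulr_sumr -sumrB -!big_split; apply: eq_bigr => a _ /=.
  rewrite -(sum_delta (fun b => g * Et c f E2 a b) a) -sumrB -big_split.
  rewrite /Ev (der_sum (cZb hc a)).
  apply: eq_bigr => b _ /=; rewrite (derM (cZb hc a)) (ZbZ_E c f E2) eq_sym; ring.
rewrite trE; under [X in _ + X = _]eq_bigr do rewrite divEt Zbg.
rewrite mulr0 subr0; congr (_ + _); rewrite /dot -mulNr mulr_sumr.
by apply: eq_bigr => a _; ring.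
Qed.

(** The second derivative [T c f0] is not expressed by the tensors. [JLfield] multiplies it by i
    f_0, which makes it imaginary, and it cancels against its conjugate in [jerison_lee]. *)
Lemma div_G : \sum_a Zb c a (G a) =
  dot (fun a => Db a + Eb a + Gb a) (Z c ^~ f)
  + n%:R * (dot Gb (Z c ^~ f) - dot G (Zb c ^~ f))
  - n%:R * (s * s - f0 * f0 + T c f0).
Proof.
(* Since i Z_a f_0 is G_a up to lower order, the t-derivative of s is also a contraction of
   tensors. *)
have iTs : i * T c s = dot G (Zb c ^~ f) - dot Gb (Z c ^~ f) + 2%:R * i * f0 * s.
  rewrite [s in LHS]/ss (derD (cT hc)) (jl_T sol) /nrm2 /dot (der_sum (cT hc)).
  rewrite [s in RHS]/ss /nrm2 /dot mulrDr mulr_sumr.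
  rewrite mulrDr.
  rewrite mulr_sumr addrA -sumrB -big_split /=.
  congr (_ + _); last by ring.
  apply: eq_bigr => a _; rewrite (derM (cT hc)) -(cZT hc) -(cZbT hc).
  have -> : i * (Z c a f0 * pb a + p a * Zb c a f0) =
     (i * Z c a f0) * pb a + p a * (i * Zb c a f0) by ring.
  by rewrite (Zf0 c f E2) Zbf0 (gbE c f E2); ring.
have -> : \sum_a Zb c a (G a) =
    i * T c (\sum_a Zb c a (p a)) + (s - i * f0) * (\sum_a Zb c a (p a))
    + dot (fun a => Db a + Eb a + Gb a) (Z c ^~ f).
  rewrite (der_sum (cT hc)) /dot !mulr_sumr -!big_split; apply: eq_bigr => a _ /=.
  rewrite [in LHS]/Gv !(derD (cZb hc a)) (derN (cZb hc a)) !(derM (cZb hc a)) (cZbI hc).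
  rewrite Zbs (cZT hc a f) (cZbT hc a (p a)).
  by have e := Zbf0 a; ring: e.
rewrite (jl_eq sol) (derM (cT hc)) (derN (cT hc)) (der_nat (cT hc)) /gg.
rewrite (derB (cT hc)) (derM (cT hc)) (cTI hc).
have e := cII hc; ring: iTs e.
Qed.

Variable w : A.
Hypothesis wZb : forall a, Zb c a w = (2%:R * n%:R - 2%:R) * w * pb a.

(** In terms of g the coefficients of E and D are g + 3 i f_0 and g - i f_0, their form in the
    identity of Jerison and Lee. *)
Definition JLfield (c : cr A n) (a : 'I_n) : A :=
  w * ((ss c f E2 + 2%:R * I c * T c f) * Ev c f E2 a
     + (ss c f E2 - 2%:R * I c * T c f) * Dv c f a
     - 3%:R * I c * T c f * Gv c f E2 a).

Lemma div_JLfield : \sum_a Zb c a (JLfield c a) = w * (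
  (2%:R * n%:R - 2%:R) * ((s + 2%:R * i * f0) * dot E (Zb c ^~ f)
     + (s - 2%:R * i * f0) * dot D (Zb c ^~ f)
     - 3%:R * i * f0 * dot G (Zb c ^~ f))
  + dot (fun a => Db a + Eb a - 2%:R * Gb a + 3%:R * gb * pb a) E
  + dot (fun a => Db a + Eb a + 2%:R * Gb a - gb * pb a) D
  + 3%:R * dot (fun a => Gb a - gb * pb a) G
  + (s + 2%:R * i * f0) * \sum_a Zb c a (E a)
  + (s - 2%:R * i * f0) * \sum_a Zb c a (D a)
  - 3%:R * i * f0 * \sum_a Zb c a (G a)).
Proof.
rewrite /dot !mulr_sumr -?sumrB -?big_split /= -?sumrB !mulr_sumr.
rewrite -!big_split /= -sumrB mulr_sumr.
apply: eq_bigr => a _.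
rewrite /JLfield; move: (Ev c f E2 a) (Dv c f a) (Gv c f E2 a) => x y z.
rewrite (derM (cZb hc a)) wZb.
rewrite (derB (cZb hc a)) !(derD (cZb hc a)) !(derM (cZb hc a)).
rewrite (derB (cZb hc a)) (derD (cZb hc a)) !(derM (cZb hc a)) (cZbI hc).
rewrite !(der_nat (cZb hc a)) Zbs.
by have e := Zbf0 a; ring: e.
Qed.

(** The cross terms of D and E have no sign by themselves; [JLsquares_tensor] completes the square
    that contains them. *)
Definition JLsquares (c : cr A n) : A :=
  ss c f E2 * (\sum_a \sum_b Dt c f a b * Dt (swap c) f a b
             + \sum_a \sum_b Et c f E2 a b * Et (swap c) f E2 a b)
  + dot (Dv c f) (Ev (swap c) f E2) + dot (Dv (swap c) f) (Ev c f E2)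
  + dot (Gv c f E2) (Gv (swap c) f E2)
  + dot (fun a => Gv c f E2 a + Dv c f a)
        (fun a => Gv (swap c) f E2 a + Dv (swap c) f a)
  + dot (fun a => Gv c f E2 a - Ev c f E2 a)
        (fun a => Gv (swap c) f E2 a - Ev (swap c) f E2 a).

End Divergence.

Section JerisonLee.
Variables (A : comPzRingType) (n : nat) (c : cr A n) (f E2 w : A).
Hypothesis sol : jl_sol c f E2.
Hypothesis wZ : forall a, Z c a w = (2%:R * n%:R - 2%:R) * w * Z c a f.
Hypothesis wZb : forall a, Zb c a w = (2%:R * n%:R - 2%:R) * w * Zb c a f.

Lemma dotE_herm : dot (Ev (swap c) f E2) (Z c ^~ f) = dot (Ev c f E2) (Zb c ^~ f).
Proof.
rewrite /dot /Ev; under eq_bigr do rewrite mulr_suml.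
rewrite exchange_big; apply: eq_bigr => a _; rewrite mulr_suml.
by apply: eq_bigr => b _; rewrite (Et_herm sol) /=; ring.
Qed.

Theorem jerison_lee :
  \sum_a Zb c a (JLfield f E2 w c a) + \sum_a Z c a (JLfield f E2 w (swap c) a)
  = 2%:R * w * JLsquares f E2 c.
Proof.
rewrite (div_JLfield sol wZb) (@div_JLfield _ _ (swap c) _ _ (jl_swap sol) w wZ).
rewrite (div_D sol) (div_E sol) (div_G sol).
rewrite (div_D (jl_swap sol)) (div_E (jl_swap sol)) (div_G (jl_swap sol)).
rewrite swapK ss_swap /=.
have hE : \sum_a \sum_b Et c f E2 a b * Et (swap c) f E2 a b =
          \sum_a \sum_b Et c f E2 a b * Et c f E2 b a.
  by do 2!apply: eq_bigr => ? _; rewrite (Et_herm sol).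
have hE' : \sum_a \sum_b Et (swap c) f E2 a b * Et (swap c) f E2 b a =
          \sum_a \sum_b Et c f E2 a b * Et c f E2 b a.
  by do 2!apply: eq_bigr => ? _; rewrite !(Et_herm sol) mulrC.
have hD : \sum_a \sum_b Dt (swap c) f a b * Dt c f a b =
          \sum_a \sum_b Dt c f a b * Dt (swap c) f a b.
  by do 2!apply: eq_bigr => ? _; rewrite mulrC.
rewrite /JLsquares hE hE' hD; have := dotE_herm.
(* From here the tensors are arbitrary vectors related only by [hdot]: the identity is polynomial in
   their dot products, modulo i^2 = -1. *)
move: (Gv c f E2) (Gv (swap c) f E2) (Dv c f) (Dv (swap c) f) (Ev c f E2)
  (Ev (swap c) f E2) => G Gb D Db E Eb hdot.
rewrite !(dotDl, dotBl, dotNl, dotZl, dotDr, dotBr, dotNr).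
rewrite !(dotC (Zb c ^~ f)) !(dotC (Z c ^~ f)) hdot.
rewrite (dotC Gb G) (dotC Gb D) (dotC Gb E) (dotC Db D) (dotC Eb D) (dotC Eb E) (dotC Db E).
rewrite (gbE c f E2) /gg.
have e := cII (jl_cr sol); ring: e.
Qed.

End JerisonLee.

(** * Auxiliary divergences and the sign of the right-hand side *)

Section Auxiliary.
Variables (A : comPzRingType) (n : nat) (c : cr A n) (f E2 w : A).
Hypothesis sol : jl_sol c f E2.
Hypothesis wZb : forall a, Zb c a w = (2%:R * n%:R - 2%:R) * w * Zb c a f.

Let hc := jl_cr sol.

(** Its real part contains w (n - 1) |df|^4, which absorbs the fourth powers of the gradient left by
    the cutoff. *)
Lemma div_grad4 : \sum_a Zb c a (w * nrm2 c f * Z c a f) =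
  w * ((2%:R * n%:R - 2%:R) * (nrm2 c f * nrm2 c f)
    + dot (Dv (swap c) f) (Z c ^~ f) + dot (Ev (swap c) f E2) (Z c ^~ f)
    + gg (swap c) f E2 * nrm2 c f - 2%:R * E2 * nrm2 c f
    - n%:R * gg c f E2 * nrm2 c f).
Proof.
have ZbN a : Zb c a (nrm2 c f) = Dv (swap c) f a + Ev (swap c) f E2 a
    + gg (swap c) f E2 * Zb c a f - 2%:R * E2 * Zb c a f.
  have -> : nrm2 c f = ss c f E2 - E2 by rewrite /ss addrK.
  by rewrite (derB (cZb hc a)) (Zbs sol) (jl_Zb sol).
have -> : \sum_a Zb c a (w * nrm2 c f * Z c a f) =
  w * ((2%:R * n%:R - 2%:R) * (nrm2 c f * dot (Z c ^~ f) (Zb c ^~ f))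
    + dot (Dv (swap c) f) (Z c ^~ f) + dot (Ev (swap c) f E2) (Z c ^~ f)
    + gg (swap c) f E2 * dot (Z c ^~ f) (Zb c ^~ f)
    - 2%:R * E2 * dot (Z c ^~ f) (Zb c ^~ f)
    + nrm2 c f * (\sum_a Zb c a (Z c a f))).
  move: (nrm2 c f) ZbN => M ZbN.
  rewrite /dot !mulr_sumr -!big_split /= -?sumrB -!big_split /= mulr_sumr.
  apply: eq_bigr => a _; rewrite !(derM (cZb hc a)) ZbN wZb; ring.
by rewrite (jl_eq sol) /nrm2; ring.
Qed.

(** Its real part contains - n w f_0^2, the source of control on f_0. *)
Lemma div_gradT : \sum_a Zb c a (w * (I c * T c f) * Z c a f) =
  w * ((2%:R * n%:R - 2%:R) * (I c * (T c f * nrm2 c f))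
    - dot (Gv (swap c) f E2) (Z c ^~ f) + gg (swap c) f E2 * nrm2 c f
    - n%:R * (I c * (T c f * gg c f E2))).
Proof.
have -> : \sum_a Zb c a (w * (I c * T c f) * Z c a f) =
  w * ((2%:R * n%:R - 2%:R) * (I c * (T c f * dot (Z c ^~ f) (Zb c ^~ f)))
    - dot (Gv (swap c) f E2) (Z c ^~ f)
    + gg (swap c) f E2 * dot (Z c ^~ f) (Zb c ^~ f)
    + (I c * T c f) * (\sum_a Zb c a (Z c a f))).
  rewrite /dot !mulr_sumr -sumrB -!big_split /= mulr_sumr.
  apply: eq_bigr => a _; rewrite !(derM (cZb hc a)) (cZbI hc) wZb.
  by have e := Zbf0 c f E2 a; ring: e.
by rewrite (jl_eq sol) /nrm2; ring.
Qed.

(** The norm of the 3-tensor D_ab f_dbar + E_ad f_b: its diagonal terms are |df|^2 (|D|^2 + |E|^2)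
    and its mixed terms contract to the products of [Dv] and [Ev]. *)
Lemma tensor_square :
  \sum_a \sum_b \sum_d (Dt c f a b * Zb c d f + Et c f E2 a d * Z c b f)
    * (Dt (swap c) f a b * Z c d f + Et (swap c) f E2 a d * Zb c b f) =
  nrm2 c f * (\sum_a \sum_b Dt c f a b * Dt (swap c) f a b
             + \sum_a \sum_b Et c f E2 a b * Et (swap c) f E2 a b)
  + dot (Dv c f) (Ev (swap c) f E2) + dot (Dv (swap c) f) (Ev c f E2).
Proof.
rewrite /dot mulrDr !mulr_sumr -!big_split; apply: eq_bigr => a _ /=.
have sum2 (x y : 'I_n -> A) : (\sum_b x b) * (\sum_d y d) = \sum_b \sum_d x b * y d.
  by rewrite mulr_suml; apply: eq_bigr => b _; rewrite mulr_sumr.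
rewrite /nrm2 /dot /Dv /Ev !sum2.
have sw (x : 'I_n -> 'I_n -> A) : \sum_b \sum_d x b d = \sum_b \sum_d x d b.
  exact: exchange_big.
rewrite [X in X + _ + _ + _]sw -!big_split; apply: eq_bigr => b _ /=.
rewrite -!big_split; apply: eq_bigr => d _ /=; ring.
Qed.

(** The square uses the part |df|^2 of s. The part e^(2f) remains in front of |D|^2 + |E|^2, so the
    full tensors will vanish and not only their contractions with df. *)
Lemma JLsquares_tensor : JLsquares f E2 c =
  E2 * (\sum_a \sum_b Dt c f a b * Dt (swap c) f a b
             + \sum_a \sum_b Et c f E2 a b * Et (swap c) f E2 a b)
  + \sum_a \sum_b \sum_d (Dt c f a b * Zb c d f + Et c f E2 a d * Z c b f)
    * (Dt (swap c) f a b * Z c d f + Et (swap c) f E2 a d * Zb c b f)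
  + 3%:R * dot (Gv c f E2) (Gv (swap c) f E2)
  + (dot (Gv c f E2) (Dv (swap c) f) + dot (Dv c f) (Gv (swap c) f E2))
  + dot (Dv c f) (Dv (swap c) f)
  - (dot (Gv c f E2) (Ev (swap c) f E2) + dot (Ev c f E2) (Gv (swap c) f E2))
  + dot (Ev c f E2) (Ev (swap c) f E2).
Proof.
rewrite tensor_square /JLsquares /ss.
move: (Gv c f E2) (Gv (swap c) f E2) (Dv c f) (Dv (swap c) f) (Ev c f E2)
  (Ev (swap c) f E2) => G Gb D Db E Eb.
by rewrite !(dotDl, dotBl, dotNl, dotDr, dotBr, dotNr); ring.
Qed.

End Auxiliary.

(** * Conjugation exchanges the tensors of [c] and [swap c] *)

Section Conjugation.
Variables (A : comPzRingType) (n : nat) (c : cr A n) (cj : A -> A) (f E2 w : A).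
Hypotheses (cjD : forall x y, cj (x + y) = cj x + cj y)
  (cjM : forall x y, cj (x * y) = cj x * cj y) (cj1 : cj 1 = 1)
  (cjI : cj (I c) = - I c) (cjZ : forall a x, cj (Z c a x) = Zb c a (cj x))
  (cjZb : forall a x, cj (Zb c a x) = Z c a (cj x)) (cjT : forall x, cj (T c x) = T c (cj x))
  (cjf : cj f = f) (cjE2 : cj E2 = E2) (cjw : cj w = w).

Lemma cj0 : cj 0 = 0.
Proof. by apply: (addrI (cj 0)); rewrite -cjD !addr0. Qed.

Lemma cjN x : cj (- x) = - cj x.
Proof. by apply: (addrI (cj x)); rewrite -cjD !subrr cj0. Qed.

Lemma cj_nat (m : nat) : cj m%:R = m%:R.
Proof. by elim: m => [|m IH]; rewrite ?cj0 // !mulrS cjD cj1 IH. Qed.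

Lemma cj_sum (J : finType) (F : J -> A) : cj (\sum_j F j) = \sum_j cj (F j).
Proof. exact: (big_morph cj cjD cj0). Qed.

Lemma cj_nrm2 : cj (nrm2 c f) = nrm2 c f.
Proof. by rewrite /nrm2 /dot cj_sum; apply: eq_bigr => a _; rewrite cjM cjZ cjZb cjf mulrC. Qed.

Lemma cj_ss : cj (ss c f E2) = ss c f E2.
Proof. by rewrite /ss cjD cj_nrm2 cjE2. Qed.

Lemma cj_gg : cj (gg c f E2) = gg (swap c) f E2.
Proof. by rewrite /gg cjD cjN cjM cjI cj_ss ss_swap cjT cjf. Qed.

Lemma cj_Dt a b : cj (Dt c f a b) = Dt (swap c) f a b.
Proof. by rewrite /Dt !(cj_nat, cjD, cjN, cjM, cjZ, cjf). Qed.

Lemma cj_Et a b : cj (Et c f E2 a b) = Et (swap c) f E2 a b.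
Proof. by rewrite /Et cjD cjM cj_gg cj_nat cjZb cjZ cjf. Qed.

Lemma cj_Gv a : cj (Gv c f E2 a) = Gv (swap c) f E2 a.
Proof. by rewrite /Gv !(cj_ss, cjD, cjN, cjM) ss_swap cjI !cjZ !cjT cjf. Qed.

Lemma cj_Dv a : cj (Dv c f a) = Dv (swap c) f a.
Proof. by rewrite /Dv cj_sum; apply: eq_bigr => b _; rewrite cjM cj_Dt cjZb cjf. Qed.

Lemma cj_Ev a : cj (Ev c f E2 a) = Ev (swap c) f E2 a.
Proof. by rewrite /Ev cj_sum; apply: eq_bigr => b _; rewrite cjM cj_Et cjZ cjf. Qed.

Lemma cj_JLfield a : cj (JLfield f E2 w c a) = JLfield f E2 w (swap c) a.
Proof.
by rewrite /JLfield !(cj_ss, cj_Ev, cj_Dv, cj_Gv, cj_nat, cjI, cjT, cjf, cjw, cjD, cjN, cjM) ss_swap.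
Qed.

End Conjugation.

(** * Consequences of D = E = G = 0 for the inverse of g *)

Section Rigidity.
Variables (A : comPzRingType) (n : nat) (c : cr A n) (f E2 h hb : A).
Hypothesis sol : jl_sol c f E2.
Hypotheses (Dt0 : forall a b, Dt c f a b = 0) (Et0 : forall a b, Et c f E2 a b = 0).
Hypothesis Gv0 : forall a, Gv c f E2 a = 0.
Hypotheses (hg : h * gg c f E2 = 1) (hbg : hb * gg (swap c) f E2 = 1).

Let hc := jl_cr sol.
Notation p a := (Z c a f).
Notation g := (gg c f E2).
Notation gb := (gg (swap c) f E2).

Let Dv0 a : Dv c f a = 0.
Proof. by rewrite /Dv big1 // => b _; rewrite Dt0 mul0r. Qed.

Let Ev0 a : Ev c f E2 a = 0.
Proof. by rewrite /Ev big1 // => b _; rewrite Et0 mul0r. Qed.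

Lemma Z_inv_gg a : Z c a h = - (2%:R * h * p a).
Proof.
have dh : Z c a h * g + h * (2%:R * g * p a) = 0.
  rewrite -(der_nat (cZ hc a) 1) -[1%:R]hg (derM (cZ hc a)) (Zg sol).
  by rewrite Dv0 Ev0 Gv0 addr0 subr0 add0r.
(* Multiplication by [h], with h g = 1, takes the place of a division by g. *)
transitivity ((Z c a h * g + h * (2%:R * g * p a)) * h + Z c a h * (1 - h * g)
   - 2%:R * p a * h * (h * g)); first by ring.
by rewrite dh hg; ring.
Qed.

Lemma Z_inv_ggb a : Z c a hb = 0.
Proof.
have dh : Z c a hb * gb = 0.
  rewrite -[RHS](der_nat (cZ hc a) 1) -[1%:R]hbg (derM (cZ hc a)) (Zgb sol).
  by rewrite Dv0 Ev0 Gv0 !addr0 mulr0 addr0.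
by rewrite -[LHS]mulr1 -hbg mulrCA dh mulr0.
Qed.

Lemma ZZ_inv_gg a b : Z c b (Z c a h) = 0.
Proof.
rewrite Z_inv_gg (derN (cZ hc b)) (derM (cZ hc b)) (derMn (cZ hc b)) Z_inv_gg.
by rewrite ZZ_D Dt0; ring.
Qed.

Lemma Z_energy a : Z c a (E2 * (h * hb)) = 0.
Proof.
by rewrite !(derM (cZ hc a)) Z_inv_gg Z_inv_ggb (jl_Z sol); ring.
Qed.

Lemma ZbZ_inv_gg a b : Zb c b h = 0 -> Zb c b (Z c a h) = 2%:R * (a == b)%:R.
Proof.
move=> h0; rewrite Z_inv_gg (derN (cZb hc b)) (derM (cZb hc b)) (derMn (cZb hc b)) h0.
rewrite (ZbZ_E c f E2) Et0 sub0r -[RHS]mulr1 -hg; ring.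
Qed.

End Rigidity.

(** * Smooth functions *)

Section Directional.
Variables (R : realType) (V : normedModType R).
Implicit Types (f : V -> R) (v p : V).

Lemma differentiable_derive1 (h : R -> R) (x y : R) :
  is_derive x 1 h y -> differentiable h x.
Proof. by move=> /@ex_derive H; apply/derivable1_diffP. Qed.

Lemma differentiable_chain (h : R -> R) f p d :
  differentiable f p -> is_derive (f p) 1 h d -> differentiable (h \o f) p.
Proof. by move=> df dh; apply: differentiable_comp => //; exact: differentiable_derive1 dh. Qed.

Lemma derive_chain (h : R -> R) f p v d :
  differentiable f p -> is_derive (f p) 1 h d -> 'D_v (h \o f) p = d * 'D_v f p.
Proof.
move=> df dh; have dh' := differentiable_derive1 dh.
rewrite deriveE; last exact: differentiable_comp.
rewrite diff_comp //= -[X in 'd _ _ X = _]mulr1 [LHS]linearZ -!deriveE //.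
by case: dh => _ ->; rewrite mulrC.
Qed.

Lemma derive_line f (p v : V) (t : R) : differentiable f (p + t *: v) ->
  is_derive t 1 (fun s : R => f (p + s *: v)) ('D_v f (p + t *: v)).
Proof.
move=> df.
have dl : is_diff t (cst p + ( *:%R^~ v : R -> V)) (0 + ( *:%R^~ v : R -> V)).
  by apply: is_diffD; exact: is_diff_scalel.
have dlf : differentiable (fun s : R => p + s *: v) t by exact: (@ex_diff _ _ _ _ _ _ _ dl).
have dc : differentiable (f \o (fun s : R => p + s *: v)) t by exact: differentiable_comp.
apply: DeriveDef; first by apply/derivable1_diffP.
rewrite -[LHS]/('D_1 (f \o (fun s : R => p + s *: v)) t) deriveE // diff_comp //=.
have -> : 'd (fun s : R => p + s *: v) t 1 = v.
  have -> : 'd (fun s : R => p + s *: v) t 1 = (0 + ( *:%R^~ v : R -> V)) 1.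
    by rewrite -(@diff_val _ _ _ _ _ _ _ dl).
  by rewrite fctE add0r scale1r.
by rewrite deriveE.
Qed.

Lemma mvt_line f (p v : V) (h : R) : 0 < h -> (forall q, differentiable f q) ->
  exists2 t, 0 < t < h & f (p + h *: v) - f p = h * 'D_v f (p + t *: v).
Proof.
move=> h0 df.
have [] := @MVT R (fun s => f (p + s *: v)) (fun s => 'D_v f (p + s *: v)) 0 h h0.
- by move=> x _; exact: derive_line.
- apply: continuous_subspaceT => x; apply: differentiable_continuous.
  by apply: differentiable_derive1; exact: derive_line.
- move=> t; rewrite in_itv /= => t0; rewrite scale0r addr0 subr0 mulrC => E.
  by exists t.
Qed.

Lemma derive_translate f (c p v : V) : 'D_v (fun q => f (q + c)) p = 'D_v f (p + c).
Proof.
rewrite /derive; apply: (congr1 (fun g : R -> R => lim (g @ 0^'))).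
by apply/funext => h /=; rewrite addrA.
Qed.

Lemma differentiable_translate f (c p : V) :
  differentiable f (p + c) -> differentiable (fun q => f (q + c)) p.
Proof.
move=> df; have -> : (fun q => f (q + c)) = f \o (id + cst c) by [].
apply: (@differentiable_comp _ _ _ _ (fun q => q + c)) => //.
Qed.

(** The mean-value theorem along v for the increment of f in the direction w, then along w for the
    derivative of f along v. *)
Lemma second_difference f (p v w : V) (h : R) : 0 < h ->
  (forall q, differentiable f q) -> (forall q, differentiable ('D_v f) q) ->
  exists t s, [/\ 0 < t < h, 0 < s < h &
    f (p + h *: v + h *: w) - f (p + h *: v) - (f (p + h *: w) - f p) =
    h ^+ 2 * 'D_w ('D_v f) (p + t *: v + s *: w)].
Proof.
move=> h0 df dvf.
pose F := fun q => f (q + h *: w) - f q.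
have dF q : differentiable F q.
  by apply: differentiableB => //; exact: differentiable_translate.
have [t tP FE] := mvt_line p v h0 dF.
have DF q : 'D_v F q = 'D_v f (q + h *: w) - 'D_v f q.
  rewrite /F deriveB ?derive_translate //; apply: diff_derivable => //.
  exact: differentiable_translate.
have [s sP GE] := mvt_line (p + t *: v) w h0 dvf.
exists t, s; split=> //.
by rewrite -/(F (p + h *: v)) -/(F p) FE DF GE mulrA expr2.
Qed.

(** The second difference is symmetric in v and w, so the two mixed derivatives agree at some pair
    of points near p; continuity carries this to p. *)
Lemma derive_comm f (p v w : V) :
  (forall q, differentiable f q) ->
  (forall q, differentiable ('D_v f) q) -> (forall q, differentiable ('D_w f) q) ->
  {for p, continuous ('D_w ('D_v f))} -> {for p, continuous ('D_v ('D_w f))} ->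
  'D_w ('D_v f) p = 'D_v ('D_w f) p.
Proof.
move=> df dv dw cvw cwv; apply/eqP; rewrite -subr_eq0 -normr_le0.
apply/ler_addgt0Pl => e e0; rewrite addr0.
have e20 : 0 < e / 2 by rewrite divr_gt0.
have /cvgrPdist_lt/(_ _ e20)/nbhs_ballP[d1 /= d10 H1] := cvw.
have /cvgrPdist_lt/(_ _ e20)/nbhs_ballP[d2 /= d20 H2] := cwv.
pose d := Num.min d1 d2; have d0 : 0 < d by rewrite /d lt_min d10.
(* For t, s < h the point p + t v + s w lies within d of p; the added 1 keeps the denominator
   positive. *)
pose h := d / (`|v| + `|w| + 1).
have m0 : 0 < `|v| + `|w| + 1 by rewrite ltr_wpDl // addr_ge0.
have h0 : 0 < h by rewrite divr_gt0.
have inb t s : 0 < t < h -> 0 < s < h -> `|p - (p + t *: v + s *: w)| < d.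
  move=> /andP[t0 th] /andP[s0 sh].
  rewrite -addrA opprD addrA subrr add0r normrN.
  apply: (le_lt_trans (ler_normD _ _)); rewrite !normrZ !gtr0_norm //.
  apply: (@le_lt_trans _ _ (h * (`|v| + `|w|))).
    by rewrite mulrDr lerD // ler_wpM2r // ltW.
  by rewrite /h mulrAC ltr_pdivrMr // ltr_pM2l // ltrDl.
have [t [s [tP sP E1]]] := second_difference p w h0 df dv.
have [t' [s' [tP' sP' E2]]] := second_difference p v h0 df dw.
have EE : 'D_w ('D_v f) (p + t *: v + s *: w) = 'D_v ('D_w f) (p + s' *: v + t' *: w).
  apply: (@mulfI _ (h ^+ 2)); first by rewrite expf_neq0 // gt_eqF.
  rewrite [p + s' *: v + _]addrAC; apply: (etrans (esym E1)); apply: etrans E2.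
  rewrite [p + h *: w + _]addrAC.
  move: (f (p + h *: v + h *: w)) (f (p + h *: v)) (f (p + h *: w)) (f p) => a b x y.
  ring.
have B1 : `|'D_w ('D_v f) p - 'D_w ('D_v f) (p + t *: v + s *: w)| < e / 2.
  apply: H1; rewrite -ball_normE /=; apply: (lt_le_trans (inb _ _ tP sP)).
  by rewrite ge_min lexx.
have B2 : `|'D_v ('D_w f) p - 'D_v ('D_w f) (p + s' *: v + t' *: w)| < e / 2.
  apply: H2; rewrite -ball_normE /=; apply: (lt_le_trans (inb _ _ sP' tP')).
  by rewrite ge_min lexx orbT.
rewrite EE in B1; rewrite distrC in B2.
apply: (le_trans (ler_distD ('D_v ('D_w f) (p + s' *: v + t' *: w)) _ _)).
by rewrite [leRHS]splitr; apply: lerD; apply: ltW; [exact: B1|exact: B2].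
Qed.

End Directional.

Section Smooth.
Variables (R : realType) (n : nat).
Notation H := (Hn R n).
Implicit Types (f g : H -> R) (v p : H).

Lemma smooth_differentiable f p : smooth f -> differentiable f p.
Proof. by move=> /(_ 1)[]. Qed.

Lemma smooth_continuous f : smooth f -> continuous f.
Proof. by move=> /(_ 0%N). Qed.

Lemma smooth_derive f v : smooth f -> smooth ('D_v f).
Proof. by move=> sf k; have [_] := sf k.+1; apply. Qed.

Lemma smooth_derivable f p v : smooth f -> derivable f p v.
Proof. by move=> sf; exact/diff_derivable/smooth_differentiable. Qed.

Lemma smooth_derive_comm f v w : smooth f -> 'D_w ('D_v f) = 'D_v ('D_w f).
Proof.
move=> sf; apply/funext => p; apply: derive_comm => [q|q|q||].
- exact: smooth_differentiable.
- exact/smooth_differentiable/smooth_derive.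
- exact/smooth_differentiable/smooth_derive.
- by apply: smooth_continuous; do 2!apply: smooth_derive.
- by apply: smooth_continuous; do 2!apply: smooth_derive.
Qed.

Lemma CkW k f : Ck k.+1 f -> Ck k f.
Proof.
elim: k f => [|k IH] f; first by move=> [df _] p; exact: differentiable_continuous.
by move=> [df Df]; split=> // v; exact: IH.
Qed.

Lemma Ck_cst k (a : R) : Ck k (fun _ : H => a).
Proof.
elim: k a => [|k IH] a; first by move=> p; exact: cvg_cst.
split=> [p|v]; first exact: differentiable_cst.
by have -> : 'D_v (fun _ : H => a) = (fun _ => 0) by apply/funext => p; exact: derive_cst.
Qed.

Lemma CkD k f g : Ck k f -> Ck k g -> Ck k (fun p => f p + g p).
Proof.
elim: k f g => [|k IH] f g; first by move=> cf cg p; apply: cvgD; [exact: cf|exact: cg].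
move=> [df Df] [dg Dg]; split=> [p|v]; first exact: differentiableD.
have -> : 'D_v (fun p => f p + g p) = fun p => 'D_v f p + 'D_v g p; last exact: (IH _ _ (Df v) (Dg v)).
by apply/funext => p; rewrite deriveD //; exact: diff_derivable.
Qed.

Lemma CkM k f g : Ck k f -> Ck k g -> Ck k (fun p => f p * g p).
Proof.
elim: k f g => [|k IH] f g; first by move=> cf cg p; apply: cvgM; [exact: cf|exact: cg].
move=> cf cg; have [[df Df] [dg Dg]] := (cf, cg).
split=> [p|v]; first exact: differentiableM.
have -> : 'D_v (fun p => f p * g p) = fun p => f p * 'D_v g p + g p * 'D_v f p.
  by apply/funext => p; rewrite deriveM //; exact: diff_derivable.
exact: (CkD (IH _ _ (CkW cf) (Dg v)) (IH _ _ (CkW cg) (Df v))).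
Qed.

Lemma smooth_cst (a : R) : smooth (fun _ : H => a).
Proof. by move=> k; exact: Ck_cst. Qed.

Lemma smoothD f g : smooth f -> smooth g -> smooth (fun p => f p + g p).
Proof. by move=> sf sg k; exact: CkD. Qed.

Lemma smoothM f g : smooth f -> smooth g -> smooth (fun p => f p * g p).
Proof. by move=> sf sg k; exact: CkM. Qed.

Lemma smoothN f : smooth f -> smooth (fun p => - f p).
Proof.
move=> sf; have -> : (fun p => - f p) = fun p => -1 * f p by apply/funext => p; rewrite mulN1r.
exact/smoothM/sf/smooth_cst.
Qed.

(** The derivative of e^f is e^f times a derivative of f, so the case k + 1 follows from the case k
    and the smoothness of f. *)
Lemma smooth_expR f : smooth f -> smooth (fun p => expR (f p)).
Proof.
move=> sf; have df p := smooth_differentiable p sf.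
have dE p : differentiable (fun p => expR (f p)) p.
  exact: (differentiable_chain (df p) (is_derive_expR _)).
elim=> [|k IH]; first by move=> p; exact: differentiable_continuous.
split=> // v.
have -> : 'D_v (fun p => expR (f p)) = fun p => expR (f p) * 'D_v f p.
  by apply/funext => p; exact: (derive_chain _ (df p) (is_derive_expR _)).
exact: (CkM IH (smooth_derive v sf k)).
Qed.

Lemma derive_expR_comp f v p : smooth f ->
  'D_v (fun p => expR (f p)) p = expR (f p) * 'D_v f p.
Proof.
move=> sf; exact: (derive_chain _ (smooth_differentiable p sf) (is_derive_expR _)).
Qed.

Lemma derive_ln_comp f v p : smooth f -> (forall p, 0 < f p) ->
  'D_v (fun p => ln (f p)) p = (f p)^-1 * 'D_v f p.
Proof.
move=> sf f0; exact: (derive_chain _ (smooth_differentiable p sf) (is_derive1_ln (f0 p))).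
Qed.

Lemma smoothV f : smooth f -> (forall p, f p != 0) -> smooth (fun p => (f p)^-1).
Proof.
move=> sf f0; have df p := smooth_differentiable p sf.
have dV p : differentiable (fun p => (f p)^-1) p by exact: differentiableV.
elim=> [|k IH]; first by move=> p; exact: differentiable_continuous.
split=> // v.
have -> : 'D_v (fun p => (f p)^-1) = fun p => -1 * ((f p)^-1 * (f p)^-1) * 'D_v f p.
  apply/funext => p; rewrite deriveV //; last exact: diff_derivable.
  by rewrite /GRing.scale /= mulN1r -exprVn expr2.
exact: (CkM (CkM (Ck_cst _ _) (CkM IH IH)) (smooth_derive v sf k)).
Qed.

Lemma smooth_ln f : smooth f -> (forall p, 0 < f p) -> smooth (fun p => ln (f p)).
Proof.
move=> sf f0; have df p := smooth_differentiable p sf.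
have dL p : differentiable (fun p => ln (f p)) p.
  exact: (differentiable_chain (df p) (is_derive1_ln (f0 p))).
elim=> [|k IH]; first by move=> p; exact: differentiable_continuous.
split=> // v.
have -> : 'D_v (fun p => ln (f p)) = fun p => (f p)^-1 * 'D_v f p.
  by apply/funext => p; exact: derive_ln_comp.
apply: (CkM _ (smooth_derive v sf k)).
by apply: smoothV => // p; rewrite gt_eqF.
Qed.

End Smooth.

Section Coordinates.
Variables (R : realType) (n : nat).
Notation H := (Hn R n).

Lemma smooth_linear (l : H -> R) : linear l -> continuous l ->
  smooth l /\ forall v p, 'D_v l p = l v.
Proof.
move=> lin cl.
pose lM := GRing.isLinear.Build _ _ _ _ _ lin.
pose L : {linear H -> R} := HB.pack l lM.
have dl p : differentiable l p by exact: (@linear_differentiable _ _ _ L).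
have Dl v p : 'D_v l p = l v by rewrite deriveE // (@diff_lin _ _ _ L).
split=> //; case=> [//|k]; split=> // v.
by have -> : 'D_v l = (fun _ => l v); [apply/funext => p | exact: Ck_cst].
Qed.

Lemma smooth_hx (a : 'I_n) : smooth (fun p : H => hx p 0 a) /\
  forall v p, 'D_v (fun p : H => hx p 0 a) p = hx v 0 a.
Proof.
apply: smooth_linear; first by move=> k p q; rewrite /hx /= !mxE.
move=> p; apply: (@continuous_comp _ _ _ (fun p : H => p.1.1) (fun x : 'rV[R]_n => x 0 a)).
  by apply: (@continuous_comp _ _ _ (fun p : H => p.1) fst); exact: cvg_fst.
exact: coord_continuous.
Qed.

Lemma smooth_hy (a : 'I_n) : smooth (fun p : H => hy p 0 a) /\
  forall v p, 'D_v (fun p : H => hy p 0 a) p = hy v 0 a.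
Proof.
apply: smooth_linear; first by move=> k p q; rewrite /hy /= !mxE.
move=> p; apply: (@continuous_comp _ _ _ (fun p : H => p.1.2) (fun x : 'rV[R]_n => x 0 a)).
  by apply: (@continuous_comp _ _ _ (fun p : H => p.1) snd); [exact: cvg_fst|exact: cvg_snd].
exact: coord_continuous.
Qed.

Lemma smooth_ht : smooth (fun p : H => ht p) /\
  forall v p, 'D_v (fun p : H => ht p) p = ht v.
Proof. by apply: smooth_linear => // p; exact: cvg_snd. Qed.

End Coordinates.

(** * The ring of smooth complex functions *)

Section SmoothRing.
Variables (R : realType) (n : nat).
Notation H := (Hn R n).
Notation C := (complex R).

Definition csmooth (F : H -> C) : Prop :=
  smooth (fun p => complex.Re (F p)) /\ smooth (fun p => complex.Im (F p)).

Definition csm : {pred H -> C} := fun F => `[< csmooth F >].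

Lemma csm_subring : subring_closed csm.
Proof.
split=> [|F G /asboolP[F1 F2] /asboolP[G1 G2]|F G /asboolP[F1 F2] /asboolP[G1 G2]];
  apply/asboolP.
- by split; exact: smooth_cst.
- split.
    have -> : (fun p => complex.Re ((F - G) p)) = fun p => complex.Re (F p) + - complex.Re (G p).
      by apply/funext => p; rewrite raddfB.
    by apply: smoothD => //; exact: smoothN.
  have -> : (fun p => complex.Im ((F - G) p)) = fun p => complex.Im (F p) + - complex.Im (G p).
    by apply/funext => p; rewrite raddfB.
  by apply: smoothD => //; exact: smoothN.
- split.
    have -> : (fun p => complex.Re ((F * G) p)) =
        fun p => complex.Re (F p) * complex.Re (G p) + - (complex.Im (F p) * complex.Im (G p)).
      by apply/funext => p; rewrite fctE; case: (F p) (G p) => [? ?] [? ?].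
    by apply: smoothD; [|apply: smoothN]; exact: smoothM.
  have -> : (fun p => complex.Im ((F * G) p)) =
      fun p => complex.Re (F p) * complex.Im (G p) + complex.Im (F p) * complex.Re (G p).
    by apply/funext => p; rewrite fctE; case: (F p) (G p) => [? ?] [? ?].
  by apply: smoothD; exact: smoothM.
Qed.

HB.instance Definition _ := GRing.isSubringClosed.Build (H -> C) csm csm_subring.

(** A commutative ring closed under all directional derivatives, so that the abstract calculus
    applies with [A := sm R n]. *)
Record sm := Sm { smval : H -> C; smP : smval \in csm }.
HB.instance Definition _ := [isSub for smval].
HB.instance Definition _ := [Choice of sm by <:].
HB.instance Definition _ := GRing.SubChoice_isSubComPzRing.Build (H -> C) csm sm csm_subring.

Definition re_ (F : sm) (p : H) : R := complex.Re (smval F p).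
Definition im_ (F : sm) (p : H) : R := complex.Im (smval F p).

Lemma smooth_re F : smooth (re_ F).
Proof. by have /asboolP[] := smP F. Qed.

Lemma smooth_im F : smooth (im_ F).
Proof. by have /asboolP[] := smP F. Qed.

Lemma mk_subproof (a b : H -> R) : smooth a -> smooth b ->
  (fun p => Complex (a p) (b p)) \in csm.
Proof. by move=> sa sb; apply/asboolP. Qed.

Definition mk a b (sa : smooth a) (sb : smooth b) : sm := Sm (mk_subproof sa sb).

Definition real (a : H -> R) (sa : smooth a) : sm := mk sa (@smooth_cst R n 0).

Definition cst_ (z : C) : sm := mk (@smooth_cst R n (complex.Re z)) (@smooth_cst R n (complex.Im z)).

Lemma sm_ext (F G : sm) : re_ F =1 re_ G -> im_ F =1 im_ G -> F = G.
Proof.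
move=> e1 e2; apply: val_inj; apply/funext => p /=; move: (e1 p) (e2 p).
by rewrite /re_ /im_; case: (smval F p) (smval G p) => [? ?] [? ?] /= -> ->.
Qed.

Lemma smvalD (F G : sm) p : smval (F + G) p = smval F p + smval G p. Proof. by []. Qed.
Lemma smvalM (F G : sm) p : smval (F * G) p = smval F p * smval G p. Proof. by []. Qed.
Lemma smvalN (F : sm) p : smval (- F) p = - smval F p. Proof. by []. Qed.
Lemma smval0 p : smval (0 : sm) p = 0. Proof. by []. Qed.
Lemma smval1 p : smval (1 : sm) p = 1. Proof. by []. Qed.
Lemma smval_nat (m : nat) p : smval (m%:R : sm) p = m%:R.
Proof. by elim: m => [|m IH] //; rewrite !mulrS smvalD IH. Qed.
Lemma smval_sum (J : finType) (P : pred J) (F : J -> sm) p :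
  smval (\sum_(j | P j) F j) p = \sum_(j | P j) smval (F j) p.
Proof. by apply: (big_morph (fun G : sm => smval G p)). Qed.

Lemma reD F G p : re_ (F + G) p = re_ F p + re_ G p.
Proof. by rewrite /re_ smvalD raddfD. Qed.
Lemma imD F G p : im_ (F + G) p = im_ F p + im_ G p.
Proof. by rewrite /im_ smvalD raddfD. Qed.
Lemma reM F G p : re_ (F * G) p = re_ F p * re_ G p - im_ F p * im_ G p.
Proof. by rewrite /re_ /im_ smvalM; case: (smval F p) (smval G p) => [? ?] [? ?]. Qed.
Lemma imM F G p : im_ (F * G) p = re_ F p * im_ G p + im_ F p * re_ G p.
Proof. by rewrite /re_ /im_ smvalM; case: (smval F p) (smval G p) => [? ?] [? ?]. Qed.
Lemma reN F p : re_ (- F) p = - re_ F p.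
Proof. by rewrite /re_ smvalN raddfN. Qed.
Lemma imN F p : im_ (- F) p = - im_ F p.
Proof. by rewrite /im_ smvalN raddfN. Qed.

Definition cder v (F : sm) : sm :=
  mk (smooth_derive v (smooth_re F)) (smooth_derive v (smooth_im F)).

Lemma re_cder v F p : re_ (cder v F) p = 'D_v (re_ F) p. Proof. by []. Qed.
Lemma im_cder v F p : im_ (cder v F) p = 'D_v (im_ F) p. Proof. by []. Qed.

Lemma cder_derivation v : derivation (cder v).
Proof.
have dre F p : derivable (re_ F) p v by exact/smooth_derivable/smooth_re.
have dim F p : derivable (im_ F) p v by exact/smooth_derivable/smooth_im.
split=> F G; apply: sm_ext => p.
- rewrite reD !re_cder -deriveD //; congr ('D_v _ p).
  by apply/funext => q; rewrite reD.
- rewrite imD !im_cder -deriveD //; congr ('D_v _ p).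
  by apply/funext => q; rewrite imD.
- rewrite reD !reM !re_cder !im_cder.
  have -> : re_ (F * G) = re_ F * re_ G - im_ F * im_ G by apply/funext => q; rewrite reM.
  rewrite deriveB; [|exact: derivableM|exact: derivableM].
  rewrite (deriveM (dre F p) (dre G p)) (deriveM (dim F p) (dim G p)).
  rewrite /GRing.scale /=; move: (re_ F p) (im_ F p) (re_ G p) (im_ G p).
  move: ('D_v (re_ F) p) ('D_v (im_ F) p) ('D_v (re_ G) p) ('D_v (im_ G) p).
  move=> *; ring.
- rewrite imD !imM !re_cder !im_cder.
  have -> : im_ (F * G) = re_ F * im_ G + im_ F * re_ G by apply/funext => q; rewrite imM.
  rewrite deriveD; [|exact: derivableM|exact: derivableM].
  rewrite (deriveM (dre F p) (dim G p)) (deriveM (dim F p) (dre G p)).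
  rewrite /GRing.scale /=; move: (re_ F p) (im_ F p) (re_ G p) (im_ G p).
  move: ('D_v (re_ F) p) ('D_v (im_ F) p) ('D_v (re_ G) p) ('D_v (im_ G) p).
  move=> *; ring.
Qed.

Lemma cder_comm v w F : cder v (cder w F) = cder w (cder v F).
Proof.
apply: sm_ext => p.
  exact: (congr1 (fun g : H -> R => g p) (smooth_derive_comm w v (smooth_re F))).
exact: (congr1 (fun g : H -> R => g p) (smooth_derive_comm w v (smooth_im F))).
Qed.

Lemma cder_cst v z : cder v (cst_ z) = 0.
Proof.
by apply: sm_ext => p; rewrite ?re_cder ?im_cder; exact: derive_cst.
Qed.

Definition zz a : sm := mk (smooth_hx R a).1 (smooth_hy R a).1.
Definition zzb a : sm := mk (smooth_hx R a).1 (smoothN (smooth_hy R a).1).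

Lemma cder_zz v a : cder v (zz a) = cst_ (Complex (hx v 0 a) (hy v 0 a)).
Proof.
apply: sm_ext => p; rewrite ?re_cder ?im_cder; [exact: (smooth_hx R a).2|exact: (smooth_hy R a).2].
Qed.

Lemma cder_zzb v a : cder v (zzb a) = cst_ (Complex (hx v 0 a) (- hy v 0 a)).
Proof.
apply: sm_ext => p; rewrite ?re_cder ?im_cder; first exact: (smooth_hx R a).2.
by rewrite -[LHS]/('D_v (- (fun p => hy p 0 a)) p) deriveN ?(smooth_hy R a).2 //;
   exact/smooth_derivable/(smooth_hy R a).1.
Qed.

Lemma cst_D z w : cst_ (z + w) = cst_ z + cst_ w.
Proof. by apply: sm_ext => p; rewrite ?reD ?imD /re_ /im_ /= raddfD. Qed.
Lemma cst_M z w : cst_ (z * w) = cst_ z * cst_ w.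
Proof.
by apply: sm_ext => p; rewrite ?reM ?imM /re_ /im_ /=; case: z w => [? ?] [? ?].
Qed.
Lemma cst_1 : cst_ 1 = 1. Proof. by apply: sm_ext. Qed.
Lemma cst_0 : cst_ 0 = 0. Proof. by apply: sm_ext. Qed.
Lemma cst_N z : cst_ (- z) = - cst_ z.
Proof. by apply: sm_ext => p; rewrite ?reN ?imN /re_ /im_ /= raddfN. Qed.

Definition ii : sm := cst_ (Complex 0 1).
Definition hh : sm := cst_ (Complex (1 / 2) 0).

Definition tt : sm := real (smooth_ht R n).1.

Lemma cder_tt v : cder v tt = cst_ (Complex (ht v) 0).
Proof.
by apply: sm_ext => p; rewrite ?re_cder ?im_cder; [exact: (smooth_ht R n).2|exact: derive_cst].
Qed.

Lemma et_hx (a : 'I_n) : hx (et : H) 0 a = 0. Proof. by rewrite /hx /= mxE. Qed.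
Lemma ex_hx (a b : 'I_n) : hx (ex b : H) 0 a = (a == b)%:R. Proof. by rewrite /hx /= mxE. Qed.
Lemma ey_hx (a b : 'I_n) : hx (ey b : H) 0 a = 0. Proof. by rewrite /hx /= mxE. Qed.
Lemma ex_hy (a b : 'I_n) : hy (ex b : H) 0 a = 0. Proof. by rewrite /hy /= mxE. Qed.
Lemma ey_hy (a b : 'I_n) : hy (ey b : H) 0 a = (a == b)%:R. Proof. by rewrite /hy /= mxE. Qed.

Lemma cst_nat (b : bool) : cst_ (Complex b%:R 0) = b%:R.
Proof. by case: b; [exact: cst_1|exact: cst_0]. Qed.

Lemma cst_inat (b : bool) : cst_ (Complex 0 b%:R) = ii * b%:R.
Proof. by case: b; rewrite ?mulr1 ?mulr0 //; exact: cst_0. Qed.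

Lemma T_zz a : cder et (zz a) = 0. Proof. by rewrite cder_zz !et_hx cst_0. Qed.
Lemma T_zzb a : cder et (zzb a) = 0. Proof. by rewrite cder_zzb !et_hx oppr0 cst_0. Qed.
Lemma X_zz a b : cder (ex b) (zz a) = (a == b)%:R. Proof. by rewrite cder_zz ex_hx ex_hy cst_nat. Qed.
Lemma Y_zz a b : cder (ey b) (zz a) = ii * (a == b)%:R.
Proof. by rewrite cder_zz ey_hx ey_hy cst_inat. Qed.
Lemma X_zzb a b : cder (ex b) (zzb a) = (a == b)%:R.
Proof. by rewrite cder_zzb ex_hx ex_hy oppr0 cst_nat. Qed.
Lemma Y_zzb a b : cder (ey b) (zzb a) = - (ii * (a == b)%:R).
Proof.
rewrite cder_zzb ey_hx ey_hy -cst_inat -cst_N; congr cst_.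
by apply/eqP; rewrite eq_complex /= oppr0 !eqxx.
Qed.
Lemma X_tt b : cder (ex b) tt = 0. Proof. by rewrite cder_tt cst_0. Qed.
Lemma Y_tt b : cder (ey b) tt = 0. Proof. by rewrite cder_tt cst_0. Qed.
Lemma T_tt : cder et tt = 1. Proof. by rewrite cder_tt -cst_1. Qed.

Definition heis : cr sm n := CR ii
  (fun a F => hh * (cder (ex a) F - ii * cder (ey a) F) + ii * zzb a * cder et F)
  (fun a F => hh * (cder (ex a) F + ii * cder (ey a) F) - ii * zz a * cder et F)
  (cder et).

Lemma ii2 : ii * ii = -1.
Proof.
rewrite -cst_M -cst_1 -cst_N; congr cst_; apply/eqP; rewrite eq_complex /=.
by rewrite !(mul0r, mulr0, mul1r, mulr1, addr0, add0r, sub0r, oppr0) !eqxx.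
Qed.

Lemma hh2 : hh + hh = 1.
Proof.
rewrite -cst_D -cst_1; congr cst_; apply/eqP; rewrite eq_complex /=.
by rewrite -splitr addr0 !eqxx.
Qed.

Lemma heis_axioms : cr_axioms heis.
Proof.
have dX v := cder_derivation v.
have di v : cder v ii = 0 by exact: cder_cst.
have dh v : cder v hh = 0 by exact: cder_cst.
exact: (cr_model ii2 hh2 (fun a => dX (ex a)) (fun a => dX (ey a)) (dX et)
  (fun a => di (ex a)) (fun a => di (ey a)) (di et) (fun a => dh (ex a))
  (fun a => dh (ey a)) (dh et) X_zz Y_zz X_zzb Y_zzb T_zz T_zzb
  (fun a b => cder_comm (ex a) (ex b)) (fun a b => cder_comm (ex a) (ey b))
  (fun a b => cder_comm (ey a) (ey b)) (fun a => cder_comm (ex a) et)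
  (fun a => cder_comm (ey a) et)).
Qed.

End SmoothRing.

(** * Logarithm of the solution *)

Section Interface.
Variables (R : realType) (n : nat).
Notation H := (Hn R n).
Notation sm := (sm R n).
Notation heis := (heis R n).

Definition pr (F : sm) : H -> cpx R := fun p => (re_ F p, im_ F p).

Lemma re_hh (p : H) : re_ (hh R n) p = 1 / 2. Proof. by []. Qed.
Lemma im_hh (p : H) : im_ (hh R n) p = 0. Proof. by []. Qed.
Lemma re_ii (p : H) : re_ (ii R n) p = 0. Proof. by []. Qed.
Lemma im_ii (p : H) : im_ (ii R n) p = 1. Proof. by []. Qed.
Lemma re_zz (a : 'I_n) (p : H) : re_ (zz R a) p = hx p 0 a. Proof. by []. Qed.
Lemma im_zz (a : 'I_n) (p : H) : im_ (zz R a) p = hy p 0 a. Proof. by []. Qed.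
Lemma re_zzb (a : 'I_n) (p : H) : re_ (zzb R a) p = hx p 0 a. Proof. by []. Qed.
Lemma im_zzb (a : 'I_n) (p : H) : im_ (zzb R a) p = - hy p 0 a. Proof. by []. Qed.

Lemma cD_pr v F p : cD v (pr F) p = pr (cder v F) p. Proof. by []. Qed.

Lemma Zf_heis a F p : Zf a (pr F) p = pr (Z heis a F) p.
Proof.
rewrite /Zf /dz !cD_pr /pr.
rewrite [Z heis a F]/(hh R n * (cder (ex a) F - ii R n * cder (ey a) F)
  + ii R n * zzb R a * cder et F) !(reD, imD, reM, imM, reN, imN).
rewrite /cadd /csub /cscale /cmul /cneg /cI /cconj /hz /cadd /=.
rewrite (re_hh p) (im_hh p) (re_ii p) (im_ii p) (re_zzb a p) (im_zzb a p).
move: (re_ (cder (ex a) F) p) (im_ (cder (ex a) F) p) (re_ (cder (ey a) F) p).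
move: (im_ (cder (ey a) F) p) (re_ (cder et F) p) (im_ (cder et F) p).
move: (hx p 0 a) (hy p 0 a) => *.
by congr (_, _); rewrite /=; ring.
Qed.

Lemma Zbarf_heis a F p : Zbarf a (pr F) p = pr (Zb heis a F) p.
Proof.
rewrite /Zbarf /dzbar !cD_pr /pr.
rewrite [Zb heis a F]/(hh R n * (cder (ex a) F + ii R n * cder (ey a) F)
  - ii R n * zz R a * cder et F) !(reD, imD, reM, imM, reN, imN).
rewrite /cadd /csub /cscale /cmul /cneg /cI /cconj /hz /cadd /=.
rewrite (re_hh p) (im_hh p) (re_ii p) (im_ii p) (re_zz a p) (im_zz a p).
move: (re_ (cder (ex a) F) p) (im_ (cder (ex a) F) p) (re_ (cder (ey a) F) p).
move: (im_ (cder (ey a) F) p) (re_ (cder et F) p) (im_ (cder et F) p).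
move: (hx p 0 a) (hy p 0 a) => *.
by congr (_, _); rewrite /=; ring.
Qed.

End Interface.

(** * The equation for f = (ln u) / n *)

Section Equation.
Variables (R : realType) (n : nat) (u : Hn R n -> R).
Notation H := (Hn R n).
Notation heis := (heis R n).
Hypotheses (n0 : (0 < n)%N) (su : smooth u) (u0 : forall p, 0 < u p).

Definition logu (p : H) : R := (n%:R)^-1 * ln (u p).

Lemma smooth_logu : smooth logu.
Proof. by apply: smoothM; [exact: smooth_cst|exact: smooth_ln]. Qed.

Definition Fs : sm R n := real smooth_logu.

Lemma smooth_EX (k : nat) : smooth (fun p => expR (k%:R * logu p)).
Proof. by apply/smooth_expR/smoothM; [exact: smooth_cst|exact: smooth_logu]. Qed.

(** The powers e^(kf) in use: u for k = n, e^(2f) for k = 2, and the weight for k = 2n - 2. *)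
Definition EX k : sm R n := real (smooth_EX k).

Lemma cder_EX v k : cder v (EX k) = k%:R * EX k * cder v Fs.
Proof.
have kE : k%:R = cst_ n (Complex k%:R 0) :> sm R n.
  apply: val_inj; apply/funext => p /=; rewrite smval_nat /=.
  by apply/eqP; rewrite eq_complex; elim: k => [|k /andP[/eqP IH1 /eqP IH2]];
     rewrite ?eqxx // !mulrS raddfD raddfD /= IH1 IH2 addr0 !eqxx.
rewrite kE; apply: sm_ext => p.
  rewrite re_cder !(reM, imM) re_cder im_cder.
  rewrite [LHS]derive_expR_comp; last first.
    by apply: smoothM; [exact: smooth_cst|exact: smooth_logu].
  rewrite -[X in _ * X]/('D_v (cst k%:R * logu) p) deriveM; last 2 first.
  - exact: derivable_cst.
  - exact/smooth_derivable/smooth_logu.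
  rewrite derive_cst /GRing.scale /= mulr0 addr0 [im_ (cst_ _ _) p]/= /re_ /im_ /=.
  by rewrite !mul0r !subr0; ring.
rewrite im_cder !(reM, imM) re_cder im_cder.
rewrite [LHS]derive_cst [X in _ * X + _]derive_cst /re_ /im_ /=; ring.
Qed.

Lemma Z_EX a k : Z heis a (EX k) = k%:R * EX k * Z heis a Fs.
Proof. by rewrite /= !cder_EX; ring. Qed.

Lemma Zb_EX a k : Zb heis a (EX k) = k%:R * EX k * Zb heis a Fs.
Proof. by rewrite /= !cder_EX; ring. Qed.

Lemma T_EX k : T heis (EX k) = k%:R * EX k * T heis Fs.
Proof. exact: cder_EX. Qed.

Lemma EX_u p : expR (n%:R * logu p) = u p.
Proof. by rewrite /logu mulrA divff ?pnatr_eq0 -?lt0n // mul1r lnK // posrE. Qed.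

Lemma subLap_heis p : subLap u p =
  pr (\sum_a (Zb heis a (Z heis a (EX n)) + Z heis a (Zb heis a (EX n)))) p.
Proof.
have gE : (fun q => creal (u q)) = pr (EX n).
  by apply/funext => q; rewrite /creal /pr /re_ /im_ /= EX_u.
have re_sum (F : 'I_n -> sm R n) q : re_ (\sum_a F a) q = \sum_a re_ (F a) q.
  by rewrite /re_ smval_sum raddf_sum.
have im_sum (F : 'I_n -> sm R n) q : im_ (\sum_a F a) q = \sum_a im_ (F a) q.
  by rewrite /im_ smval_sum raddf_sum.
rewrite /subLap gE /csum /pr re_sum im_sum.
have ZE a : Zf a (pr (EX n)) = pr (Z heis a (EX n)) by apply/funext => q; exact: Zf_heis.
have ZbE a : Zbarf a (pr (EX n)) = pr (Zb heis a (EX n)) by apply/funext => q; exact: Zbarf_heis.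
apply: (f_equal2 pair); apply: eq_bigr => a _.
  by rewrite ZE ZbE Zf_heis Zbarf_heis /cadd reD.
by rewrite ZE ZbE Zf_heis Zbarf_heis /cadd imD.
Qed.

Hypothesis ueq : forall xi, cneg (subLap u xi) =
  creal (2 * (n%:R) ^+ 2 * powR (u xi) ((Qdim n + 2) / (Qdim n - 2))).

Lemma cancel_cst (k : nat) (F G : sm R n) : (0 < k)%N -> k%:R * F = k%:R * G -> F = G.
Proof.
move=> k0 e; apply: val_inj; apply/funext => p.
have := congr1 (fun X => smval X p) e; rewrite !smvalM smval_nat.
by apply: mulfI; rewrite pnatr_eq0 -lt0n.
Qed.

(** The ring [sm] has zero divisors, but an exponential vanishes nowhere, so cancellation holds
    pointwise. It removes the factor u left by [yamabe_log]. *)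
Lemma cancel_EX (k : nat) (F G : sm R n) : EX k * F = EX k * G -> F = G.
Proof.
move=> e; apply: val_inj; apply/funext => p.
have := congr1 (fun X => smval X p) e; rewrite !smvalM.
apply: mulfI; rewrite eq_complex /= negb_and; apply/orP; left.
by rewrite gt_eqF // expR_gt0.
Qed.

Lemma EX_eq : \sum_a (Zb heis a (Z heis a (EX n)) + Z heis a (Zb heis a (EX n))) =
  - (2%:R * n%:R * n%:R) * (EX n * EX 2).
Proof.
have nn0 : n%:R != 0 :> R by rewrite pnatr_eq0 -lt0n.
apply: sm_ext => p.
  have := congr1 fst (ueq p); rewrite subLap_heis /cneg /creal /pr /= => /eqP.
  rewrite eqr_oppLR => /eqP ->; rewrite mulNr reN -!natrM.
  have natE k G : re_ (k%:R * G) p = k%:R * re_ G p.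
    elim: k => [|k IH]; first by rewrite !mul0r.
    by rewrite !mulrS !mulrDl !mul1r reD IH.
  rewrite natE !natrM; congr (- _); rewrite expr2 -!mulrA; do 3!congr (_ * _).
  rewrite reM /re_ /im_ /= mulr0 subr0 EX_u /powR gt_eqF //.
  (* Q + 2 = 2n + 4 and Q - 2 = 2n, so the nonlinearity is u * u^(2/n) = u e^(2f). *)
  have -> : (Qdim n + 2) / (Qdim n - 2) = 1 + 2 / n%:R :> R.
    rewrite /Qdim natrD natrM addrK; field; rewrite ?nn0 //=.
  by rewrite mulrDl mul1r expRD lnK ?posrE // /logu mulrA.
have := congr1 snd (ueq p); rewrite subLap_heis /cneg /creal /pr /= => /eqP.
rewrite oppr_eq0 => /eqP ->; rewrite mulNr imN -!natrM.
have natE k G : im_ (k%:R * G) p = k%:R * im_ G p.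
  elim: k => [|k IH]; first by rewrite !mul0r.
  by rewrite !mulrS !mulrDl !mul1r imD IH.
by rewrite natE imM /re_ /im_ /= !(mulr0, mul0r) addr0 mulr0 oppr0.
Qed.

Lemma jl_sol_u : jl_sol heis Fs (EX 2).
Proof.
split.
- exact: heis_axioms.
- by move=> a; exact: Z_EX.
- by move=> a; exact: Zb_EX.
- exact: T_EX.
- have e := yamabe_log (heis_axioms R n) (Z_EX ^~ n) (Zb_EX ^~ n) EX_eq.
  exact: (cancel_EX (cancel_cst n0 (cancel_cst (isT : (0 < 2)%N) e))).
Qed.

End Equation.

(** * Riemann sums *)

Section UniformDerivative.
Variables (R : realType) (V : normedModType R).

(** Uniform continuity along v, by compactness with t near 0 as parameter. Only p stays in A; the
    shifted point may leave it. *)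
Lemma compact_uniform_shift (G : V -> R) (A : set V) (v : V) (e : R) :
  continuous G -> compact A -> 0 < e ->
  exists2 d : R, 0 < d & forall t p, 0 < t < d -> A p -> `|G (p + t *: v) - G p| < e.
Proof.
move=> cG /compact_near_coveringP cA e0.
have H : \forall t \near nbhs (0 : R), A `<=` (fun p => `|G (p + t *: v) - G p| < e).
  apply: cA => p _.
  have cF : continuous (fun z : V * R => G (z.1 + z.2 *: v) - G z.1).
    move=> z; apply: cvgB; last by apply: continuous_comp; [exact: cvg_fst|exact: cG].
    apply: (@continuous_comp _ _ _ (fun z : V * R => z.1 + z.2 *: v) G); last exact: cG.
    by apply: cvgD; [exact: cvg_fst|apply: cvgZr_tmp; exact: cvg_snd].
  have := cF (p, 0); rewrite /= => /cvgr_dist_lt/(_ _ e0).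
  rewrite scale0r addr0 subrr; apply: filterS => -[x t] /=.
  by rewrite sub0r normrN.
have /nbhs_ballP[d /= d0 Hd] := H.
exists d => // t p /andP[t0 td] Ap; apply: Hd => //.
by rewrite -ball_normE /= sub0r normrN gtr0_norm.
Qed.

End UniformDerivative.

Section Box.
Variables (R : realType) (n : nat).
Notation H := (Hn R n).

Definition box (L L' : R) : set H :=
  [set p | [/\ forall j, `|hx p 0 j| <= L, forall j, `|hy p 0 j| <= L & `|ht p| <= L']].

Lemma compact_box L L' : compact (box L L').
Proof.
have crV : compact [set x : 'rV[R]_n | forall j, `[- L, L]%classic (x 0 j)].
  by apply: (@rV_compact _ _ (fun=> `[- L, L]%classic)) => _; exact: segment_compact.
have -> : box L L' = [set x : 'rV[R]_n | forall j, `[- L, L]%classic (x 0 j)] `*`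
    [set x : 'rV[R]_n | forall j, `[- L, L]%classic (x 0 j)] `*` `[- L', L']%classic.
  apply/seteqP; split => -[[x y] t]; rewrite /box /= /hx /hy /ht /=.
    move=> [hx hy ht]; split; last by rewrite in_itv /= -ler_norml.
    by split=> j; rewrite in_itv /= -ler_norml.
  move=> [[hx hy]]; rewrite in_itv /= -ler_norml => ht; split=> // j.
    by move: (hx j); rewrite in_itv /= -ler_norml.
  by move: (hy j); rewrite in_itv /= -ler_norml.
by do 2?apply: compact_setX => //; exact: segment_compact.
Qed.

End Box.

(* Riemann sums over the grid of step 1/N in x, y and r/N in t inside the box
   |x_j|, |y_j| <= 2r, |t| <= 2r^2. The sum of a derivative of a function supported
   in the box vanishes in the limit, by translation invariance modulo the grid period. *)
Section Grid.
Variables (R : realType) (n : nat) (r : nat).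
Hypothesis r0 : (0 < r)%N.
Notation H := (Hn R n).

(** Indices run from 0 to 2 [cen N], so the nodes of [gco] fill [-2r, 2r] with both ends
    included. *)
Definition cen (N : nat) : nat := (2 * r * N)%N.
Definition grid (N : nat) : finType :=
  ({ffun 'I_n -> 'I_(cen N).*2.+1} * {ffun 'I_n -> 'I_(cen N).*2.+1} * 'I_(cen N).*2.+1)%type.

Definition gco (N : nat) (i : 'I_(cen N).*2.+1) : R := (i%:R - (cen N)%:R) / N%:R.

Definition gpt (N : nat) (k : grid N) : H :=
  (\row_j gco (k.1.1 j), \row_j gco (k.1.2 j), r%:R * gco k.2).

(** The weight r / N^(2n+1) is the volume of a cell, with 2n sides 1/N and one side r/N. *)
Definition gsum (N : nat) (F : H -> R) : R :=
  r%:R / N%:R ^+ n.*2.+1 * \sum_(k : grid N) F (gpt k).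

Lemma gsumD N F G : gsum N (fun p => F p + G p) = gsum N F + gsum N G.
Proof. by rewrite /gsum big_split mulrDr. Qed.

Lemma gsumZ N c F : gsum N (fun p => c * F p) = c * gsum N F.
Proof. by rewrite /gsum -mulr_sumr mulrCA. Qed.

Lemma gsum_weight_ge0 N : 0 <= r%:R / N%:R ^+ n.*2.+1 :> R.
Proof. by rewrite divr_ge0 // ?exprn_ge0. Qed.

Lemma gco_bound N (i : 'I_(cen N).*2.+1) : (0 < N)%N -> `|gco i| <= 2 * r%:R.
Proof.
move=> N0; rewrite /gco normrM normfV normr_nat ler_pdivrMr ?ltr0n //.
rewrite -!natrM -/(cen N) ler_norml; apply/andP; split.
  by rewrite lerBrDr addrC subrr.
by rewrite lerBlDr -natrD ler_nat addnn -ltnS ltn_ord.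
Qed.

Lemma gpt_box N (k : grid N) : (0 < N)%N -> box (2 * r%:R) (2 * r%:R ^+ 2) (gpt k).
Proof.
move=> N0; split=> [j|j|]; rewrite /gpt /hx /hy /ht /= ?mxE; try exact: gco_bound.
rewrite normrM normr_nat expr2 mulrCA ler_pM2l ?ltr0n //; exact: gco_bound.
Qed.

Lemma ler_gsum N F G : (0 < N)%N ->
  (forall p, box (2 * r%:R) (2 * r%:R ^+ 2) p -> F p <= G p) -> gsum N F <= gsum N G.
Proof.
move=> N0 FG; rewrite ler_wpM2l ?gsum_weight_ge0 // ler_sum // => k _.
exact/FG/gpt_box.
Qed.

(** There are 4rN + 1 <= 5rN nodes in each of the 2n + 1 directions. With the cell volume this gives
    r^(2n+2), the volume growth r^Q. *)
Lemma gsum_const N (c : R) : (0 < N)%N -> 0 <= c ->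
  gsum N (fun _ => c) <= c * (5 ^+ n.*2.+1 * r%:R ^+ n.*2.+2).
Proof.
move=> N0 c0; rewrite /gsum sumr_const card_prod card_prod card_ord !card_ffun !card_ord.
rewrite -expnD addnn -expnSr -[c *+ _]mulr_natr natrX.
have MN : ((cen N).*2.+1)%:R <= 5 * r%:R * N%:R :> R.
  rewrite -!natrM ler_nat /cen.
  by have := muln_gt0 r N; rewrite r0 N0 /= -!mulnA; move: (r * N)%N => m; lia.
have N0' : 0 < N%:R :> R by rewrite ltr0n.
have e1 : ((cen N).*2.+1)%:R ^+ n.*2.+1 <= (5 * r%:R * N%:R) ^+ n.*2.+1 :> R.
  by rewrite lerXn2r // ?nnegrE // !mulr_ge0.
have -> : r%:R / N%:R ^+ n.*2.+1 * (c * ((cen N).*2.+1)%:R ^+ n.*2.+1) =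
    c * (r%:R / N%:R ^+ n.*2.+1 * ((cen N).*2.+1)%:R ^+ n.*2.+1) :> R by rewrite mulrCA.
rewrite ler_wpM2l //.
apply: (le_trans (ler_wpM2l (gsum_weight_ge0 N) e1)).
rewrite !exprMn [r%:R ^+ n.*2.+2]exprS; have := expf_neq0 n.*2.+1 (lt0r_neq0 N0').
by move: (N%:R ^+ _) => y y0; rewrite le_eqVlt; apply/orP; left; apply/eqP; field.
Qed.

Definition supp_box (F : H -> R) := forall p,
  (exists j, 2 * r%:R <= `|hx p 0 j|) \/ (exists j, 2 * r%:R <= `|hy p 0 j|) \/
  2 * r%:R ^+ 2 <= `|ht p| -> F p = 0.

Lemma gco_ordS N (i : 'I_(cen N).*2.+1) : (0 < N)%N ->
  gco (ordS i) = gco i + N%:R^-1 \/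
  (gco (ordS i) = - (2 * r%:R) /\ gco i + N%:R^-1 = 2 * r%:R + N%:R^-1).
Proof.
move=> N0; have N0' : N%:R != 0 :> R by rewrite pnatr_eq0 -lt0n.
have [iM|] := ltnP i.+1 (cen N).*2.+1.
  by left; rewrite /gco /= modn_small // -addn1 natrD; field.
rewrite ltnS => iM; right; have iE : i = (cen N).*2 :> nat.
  by apply/eqP; rewrite eqn_leq iM -ltnS ltn_ord.
rewrite /gco /= iE modnn -addnn natrD sub0r /cen !natrM; split; first by field.
by congr (_ + _); field.
Qed.

Lemma gstep_x N a F : (0 < N)%N -> supp_box F ->
  \sum_(k : grid N) F (gpt k + N%:R^-1 *: ex a) = \sum_(k : grid N) F (gpt k).
Proof.
move=> N0 sF.
pose s (k : grid N) : grid N :=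
  ([ffun j => if j == a then ordS (k.1.1 j) else k.1.1 j], k.1.2, k.2).
pose s' (k : grid N) : grid N :=
  ([ffun j => if j == a then ord_pred (k.1.1 j) else k.1.1 j], k.1.2, k.2).
have sK : cancel s s'.
  move=> [[k1 k2] k3]; rewrite /s /s' /=; congr (_, _, _); apply/ffunP => j.
  by rewrite !ffunE; case: eqP => // _; rewrite ordSK.
have s'K : cancel s' s.
  move=> [[k1 k2] k3]; rewrite /s /s' /=; congr (_, _, _); apply/ffunP => j.
  by rewrite !ffunE; case: eqP => // _; rewrite ord_predK.
rewrite [RHS](reindex s) /=; last by exists s' => k _; rewrite ?sK ?s'K.
apply: eq_bigr => k _.
have [e|[e1 e2]] := gco_ordS (k.1.1 a) N0.
  congr F; congr (_, _, _) => /=; last by rewrite scaler0 addr0.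
    apply/rowP => j; rewrite !mxE ffunE; case: eqP => [->|_]; last by rewrite mulr0 addr0.
    by rewrite e mulr1.
  by rewrite scaler0 addr0.
rewrite [LHS]sF; last first.
  left; exists a; rewrite /hx /= !mxE eqxx mulr1 e2.
  by apply: (le_trans _ (ler_norm _)); rewrite lerDl invr_ge0.
by rewrite sF //; left; exists a; rewrite /hx /= !mxE ffunE eqxx e1 normrN ger0_norm ?mulr_ge0.
Qed.

Lemma gstep_y N a F : (0 < N)%N -> supp_box F ->
  \sum_(k : grid N) F (gpt k + N%:R^-1 *: ey a) = \sum_(k : grid N) F (gpt k).
Proof.
move=> N0 sF.
pose s (k : grid N) : grid N :=
  (k.1.1, [ffun j => if j == a then ordS (k.1.2 j) else k.1.2 j], k.2).
pose s' (k : grid N) : grid N :=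
  (k.1.1, [ffun j => if j == a then ord_pred (k.1.2 j) else k.1.2 j], k.2).
have sK : cancel s s'.
  move=> [[k1 k2] k3]; rewrite /s /s' /=; congr (_, _, _); apply/ffunP => j.
  by rewrite !ffunE; case: eqP => // _; rewrite ordSK.
have s'K : cancel s' s.
  move=> [[k1 k2] k3]; rewrite /s /s' /=; congr (_, _, _); apply/ffunP => j.
  by rewrite !ffunE; case: eqP => // _; rewrite ord_predK.
rewrite [RHS](reindex s) /=; last by exists s' => k _; rewrite ?sK ?s'K.
apply: eq_bigr => k _.
have [e|[e1 e2]] := gco_ordS (k.1.2 a) N0.
  congr F; congr (_, _, _) => /=; last by rewrite scaler0 addr0.
    by rewrite scaler0 addr0.
  apply/rowP => j; rewrite !mxE ffunE; case: eqP => [->|_]; last by rewrite mulr0 addr0.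
  by rewrite e mulr1.
rewrite [LHS]sF; last first.
  right; left; exists a; rewrite /hy /= !mxE eqxx mulr1 e2.
  by apply: (le_trans _ (ler_norm _)); rewrite lerDl invr_ge0.
by rewrite sF //; right; left; exists a; rewrite /hy /= !mxE ffunE eqxx e1 normrN ger0_norm ?mulr_ge0.
Qed.

Lemma gstep_t N F : (0 < N)%N -> supp_box F ->
  \sum_(k : grid N) F (gpt k + (r%:R / N%:R) *: et) = \sum_(k : grid N) F (gpt k).
Proof.
move=> N0 sF.
pose s (k : grid N) : grid N := (k.1, ordS k.2).
pose s' (k : grid N) : grid N := (k.1, ord_pred k.2).
have sK : cancel s s' by move=> [k1 k2]; rewrite /s /s' /= ordSK.
have s'K : cancel s' s by move=> [k1 k2]; rewrite /s /s' /= ord_predK.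
rewrite [RHS](reindex s) /=; last by exists s' => k _; rewrite ?sK ?s'K.
have r0' : 0 < r%:R :> R by rewrite ltr0n.
apply: eq_bigr => k _.
have [e|[e1 e2]] := gco_ordS k.2 N0.
  congr F; congr (_, _, _) => /=; rewrite ?scaler0 ?addr0 //.
  by rewrite e mulrDr /GRing.scale /= mulr1.
rewrite [LHS]sF; last first.
  right; right; rewrite /ht /= /GRing.scale /= mulr1 -mulrDr e2 expr2 mulrCA.
  rewrite normrM (gtr0_norm r0') ler_pM2l //.
  by apply: (le_trans _ (ler_norm _)); rewrite lerDl invr_ge0.
rewrite sF //; right; right; rewrite /ht /= e1 mulrN normrN expr2 mulrCA.
by rewrite normrM (gtr0_norm r0') ler_pM2l // ger0_norm ?mulr_ge0.
Qed.

(** The sum of the increments is zero. The mean-value theorem makes it a sum of derivatives at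
    intermediate points, and uniform continuity moves these to the nodes. *)
Lemma gsum_derive_step (v : H) (h0 : R) (F : H -> R) (e : R) :
  0 < h0 ->
  (forall p, differentiable F p) -> continuous ('D_v F) -> 0 < e ->
  (forall N, (0 < N)%N ->
     \sum_(k : grid N) F (gpt k + (h0 / N%:R) *: v) = \sum_(k : grid N) F (gpt k)) ->
  exists N0 : nat, forall N, (N0 < N)%N -> `|gsum N ('D_v F)| <= e.
Proof.
move=> h00 dF cD e0 st.
pose C : R := 5 ^+ n.*2.+1 * r%:R ^+ n.*2.+2.
have C0 : 0 < C by rewrite mulr_gt0 ?exprn_gt0 // ltr0n.
have eC0 : 0 < e / C by rewrite divr_gt0.
have [d d0 Hd] := compact_uniform_shift v cD (@compact_box R n (2 * r%:R) (2 * r%:R ^+ 2)) eC0.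
exists (Num.truncn (h0 / d)) => N NN.
have N0 : (0 < N)%N by exact: leq_ltn_trans NN.
have N0' : 0 < N%:R :> R by rewrite ltr0n.
have hd : h0 / N%:R < d.
  rewrite ltr_pdivrMr // mulrC -ltr_pdivrMr //.
  have /Num.Theory.truncn_itv/andP[_] : 0 <= h0 / d by rewrite divr_ge0 // ltW.
  by move=> /lt_le_trans; apply; rewrite ler_nat.
have hN0 : 0 < h0 / N%:R by rewrite divr_gt0.
have mv (k : grid N) := mvt_line (gpt k) v hN0 dF.
have /choice[t tP] : forall k : grid N, exists t, 0 < t < h0 / N%:R /\
    F (gpt k + (h0 / N%:R) *: v) - F (gpt k) = h0 / N%:R * 'D_v F (gpt k + t *: v).
  by move=> k; have [t ? ?] := mv k; exists t.
have s0 : \sum_(k : grid N) 'D_v F (gpt k + t k *: v) = 0.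
  apply: (@mulfI _ (h0 / N%:R)); first by rewrite gt_eqF.
  by rewrite mulr0 mulr_sumr -(eq_bigr _ (fun k _ => (tP k).2)) sumrB st // subrr.
have -> : gsum N ('D_v F) = - (r%:R / N%:R ^+ n.*2.+1 *
    \sum_(k : grid N) ('D_v F (gpt k + t k *: v) - 'D_v F (gpt k))).
  by rewrite sumrB s0 sub0r mulrN opprK.
rewrite normrN normrM (ger0_norm (gsum_weight_ge0 N)).
apply: (@le_trans _ _ (gsum N (fun _ => e / C))); last first.
  by apply: (le_trans (gsum_const N0 (ltW eC0))); rewrite -/C divfK // gt_eqF.
rewrite ler_wpM2l ?gsum_weight_ge0 //.
apply: (le_trans (ler_norm_sum _ _ _)); apply: ler_sum => k _.
apply/ltW/Hd; last exact: gpt_box.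
by have [/andP[-> th] _] := tP k; rewrite (lt_trans th).
Qed.

Definition gdir (v : H) := (exists a, v = ex a) \/ (exists a, v = ey a) \/ v = et.

Lemma gsum_derive (v : H) (F : H -> R) (e : R) : gdir v -> supp_box F ->
  (forall p, differentiable F p) -> continuous ('D_v F) -> 0 < e ->
  exists N0 : nat, forall N, (N0 < N)%N -> `|gsum N ('D_v F)| <= e.
Proof.
move=> dv sF dF cF e0; have r0' : 0 < r%:R :> R by rewrite ltr0n.
case: dv cF => [[a ->]|[[a ->]|->]] cF.
- by apply: (gsum_derive_step ltr01) => // N N0; rewrite div1r gstep_x.
- by apply: (gsum_derive_step ltr01) => // N N0; rewrite div1r gstep_y.
- by apply: (gsum_derive_step r0') => // N N0; rewrite gstep_t.
Qed.

(** Nodes from the last one not above x up to about x + d. This one-sided window already contains at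
    least d N nodes. *)
Definition window (N : nat) (d x : R) (i : 'I_(Num.truncn (d * N%:R)).+1) :
  'I_(cen N).*2.+1 := inord (Num.truncn ((x + 2 * r%:R) * N%:R) + i).

Lemma windowP (N : nat) (d x : R) : (0 < N)%N -> 0 < d -> N%:R^-1 <= d ->
  `|x| + d <= 2 * r%:R ->
  injective (@window N d x) /\ forall i, `|gco (@window N d x i) - x| <= d.
Proof.
move=> N0 d0 Nd xd; have N0' : 0 < N%:R :> R by rewrite ltr0n.
have [x1 x2] : - x + d <= 2 * r%:R /\ x + d <= 2 * r%:R.
  by split; apply: le_trans xd; rewrite lerD2r; [rewrite -normrN|]; exact: ler_norm.
have xr0 : 0 <= (x + 2 * r%:R) * N%:R by rewrite mulr_ge0 ?ler0n //; lra.
have /andP[m1 m2] := truncn_itv xr0.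
rewrite /window; set m := Num.truncn _ in m1 m2 *.
have dN0 : 0 <= d * N%:R by rewrite mulr_ge0 // ltW.
have /andP[q1 _] := truncn_itv dN0.
have iq (i : 'I_(Num.truncn (d * N%:R)).+1) : i%:R <= d * N%:R.
  by apply: le_trans q1; rewrite ler_nat -ltnS ltn_ord.
have mi (i : 'I_(Num.truncn (d * N%:R)).+1) : (m + i < (cen N).*2.+1)%N.
  rewrite ltnS -(ler_nat R) natrD -addnn natrD.
  apply: (le_trans (lerD m1 (iq i))); rewrite -mulrDl /cen !natrM -mulrDl ler_wpM2r //; lra.
split=> [i j /(congr1 val)|i]; rewrite /= ?inordK //.
  by move/addnI/val_inj.
rewrite /gco inordK // natrD /cen !natrM.
have -> : (m%:R + i%:R - 2 * r%:R * N%:R) / N%:R - x =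
    (m%:R - (x + 2 * r%:R) * N%:R) / N%:R + i%:R / N%:R :> R.
  by field; rewrite gt_eqF.
have i1 : i%:R / N%:R <= d by rewrite ler_pdivrMr.
have i0 : 0 <= i%:R / N%:R :> R by rewrite divr_ge0.
have l1 : (m%:R - (x + 2 * r%:R) * N%:R) / N%:R <= 0.
  by rewrite ler_pdivrMr // mul0r subr_le0.
have l2 : - N%:R^-1 <= (m%:R - (x + 2 * r%:R) * N%:R) / N%:R.
  by rewrite -mulN1r ler_wpM2r ?invr_ge0 //; move: m2; rewrite -addn1 natrD; lra.
by rewrite ler_norml; apply/andP; split; lra.
Qed.

(** There are at least d N nodes in each x and y direction and (d / r) N in t; with the cell volume,
    N and r cancel and leave d^(2n+1). *)
Lemma gsum_lower (p0 : H) (d g0 : R) (G : H -> R) : 0 < d -> 0 <= g0 ->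
  (forall p, 0 <= G p) ->
  (forall p, (forall j, `|hx p 0 j - hx p0 0 j| <= d) ->
     (forall j, `|hy p 0 j - hy p0 0 j| <= d) -> `|ht p - ht p0| <= d -> g0 <= G p) ->
  (forall j, `|hx p0 0 j| + d <= 2 * r%:R) ->
  (forall j, `|hy p0 0 j| + d <= 2 * r%:R) -> `|ht p0| + d <= 2 * r%:R ^+ 2 ->
  exists N0 : nat, forall N, (N0 < N)%N -> g0 * d ^+ n.*2.+1 <= gsum N G.
Proof.
move=> d0 g00 G0 Gg bx by_ bt; have r0' : 0 < r%:R :> R by rewrite ltr0n.
have dr0 : 0 < d / r%:R by rewrite divr_gt0.
exists (maxn (Num.truncn d^-1) (Num.truncn (d / r%:R)^-1)) => N; rewrite gtn_max => /andP[N1 N2].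
have N0 : (0 < N)%N by exact: leq_ltn_trans N1.
have N0' : 0 < N%:R :> R by rewrite ltr0n.
have inv (x : R) : 0 < x -> (Num.truncn x^-1 < N)%N -> N%:R^-1 <= x.
  move=> x0 xN; rewrite -[leRHS]invrK lef_pV2 ?posrE ?invr_gt0 //.
  have /truncn_itv/andP[_ /ltW/le_trans] : 0 <= x^-1 by rewrite invr_ge0 ltW.
  by apply; rewrite ler_nat.
have Nd := inv _ d0 N1; have Ndr := inv _ dr0 N2.
pose q := (Num.truncn (d * N%:R)).+1; pose q' := (Num.truncn (d / r%:R * N%:R)).+1.
have wx j := windowP N0 d0 Nd (bx j); have wy j := windowP N0 d0 Nd (by_ j).
have bt' : `|ht p0 / r%:R| + d / r%:R <= 2 * r%:R.
  rewrite normrM normfV (gtr0_norm r0') -mulrDl ler_pdivrMr //.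
  by rewrite -mulrA -expr2.
have [wt1 wt2] := windowP N0 dr0 Ndr bt'.
pose J := ({ffun 'I_n -> 'I_q} * {ffun 'I_n -> 'I_q} * 'I_q')%type.
pose e (f : J) : grid N := ([ffun j => window (hx p0 0 j) (f.1.1 j)],
  [ffun j => window (hy p0 0 j) (f.1.2 j)], window (ht p0 / r%:R) f.2).
have inj_e : injective e.
  move=> [[f1 f2] f3] [[f1' f2'] f3'] [] /ffunP e1 /ffunP e2 /wt1 ->.
  congr (_, _, _); apply/ffunP => j.
    by move: (e1 j); rewrite !ffunE => /(wx j).1.
  by move: (e2 j); rewrite !ffunE => /(wy j).1.
have Ge f : g0 <= G (gpt (e f)).
  apply: Gg => [j|j|]; rewrite /hx /hy /ht /= ?mxE ?ffunE.
  - exact: (wx j).2.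
  - exact: (wy j).2.
  have := wt2 f.2; move: (gco _) => y hy.
  have -> : r%:R * y - p0.2 = r%:R * (y - p0.2 / r%:R) by field; rewrite gt_eqF.
  by rewrite normrM (gtr0_norm r0') mulrC -ler_pdivlMr.
have S1 : g0 * (q%:R ^+ n.*2 * q'%:R) <= \sum_(k : grid N) G (gpt k).
  apply: (@le_trans _ _ (\sum_(f : J) G (gpt (e f)))).
    apply: (@le_trans _ _ (\sum_(f : J) g0)); last by apply: ler_sum.
    rewrite sumr_const card_prod card_prod !card_ffun !card_ord -expnD addnn.
    by rewrite -[leRHS]mulr_natr natrM natrX.
  have -> : \sum_(f : J) G (gpt (e f)) = \sum_(k in [set e f | f : J]) G (gpt k).
    by rewrite big_imset //= => f f' _ _; exact: inj_e.
  rewrite big_mkcond; apply: ler_sum => k _; case: ifP => // _; exact: G0.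
apply: (le_trans _ (ler_wpM2l (gsum_weight_ge0 N) S1)).
rewrite mulrCA ler_wpM2l // [d ^+ _]exprSr.
have -> : r%:R / N%:R ^+ n.*2.+1 * (q%:R ^+ n.*2 * q'%:R) =
   (q%:R / N%:R) ^+ n.*2 * (r%:R * (q'%:R / N%:R)) :> R.
  by rewrite expr_div_n exprS; field; rewrite !gt_eqF ?exprn_gt0.
apply: ler_pM; [by rewrite exprn_ge0 ?ltW| exact: ltW | |].
  rewrite lerXn2r ?nnegrE ?divr_ge0 ?(ltW d0) // ler_pdivlMr //.
  have /truncn_itv/andP[_ /ltW] : 0 <= d * N%:R by rewrite mulr_ge0 // ltW.
  by [].
rewrite -ler_pdivrMl // mulrC ler_pdivlMr //.
by have /truncn_itv/andP[_ /ltW] : 0 <= d / r%:R * N%:R by rewrite mulr_ge0 // ltW.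
Qed.

End Grid.

(** * Integration by parts against a cutoff *)

Section RealInner.
Variables (R : realType) (n : nat).
Implicit Types (x y g : 'I_n -> cpx R).

(* Re <x, y> for the Hermitian product of C^n *)
Definition ip x y : R := \sum_a ((x a).1 * (y a).1 + (x a).2 * (y a).2).

Lemma ip_ge0 x : 0 <= ip x x.
Proof. by apply: sumr_ge0 => a _; rewrite addr_ge0 // -expr2 sqr_ge0. Qed.

Lemma ipC x y : ip x y = ip y x.
Proof. by apply: eq_bigr => a _; ring. Qed.

Lemma ipDl x y g : ip (fun a => cadd (x a) (y a)) g = ip x g + ip y g.
Proof. by rewrite /ip -big_split; apply: eq_bigr => a _ /=; ring. Qed.

Lemma ipZl k x g : ip (fun a => cscale k (x a)) g = k * ip x g.
Proof. by rewrite /ip mulr_sumr; apply: eq_bigr => a _ /=; ring. Qed.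

Lemma ip_cmul c x g : ip (fun a => cmul c (x a)) g = ip x (fun a => cmul (cconj c) (g a)).
Proof. by apply: eq_bigr => a _ /=; ring. Qed.

Lemma nn_cmul c x : ip (fun a => cmul c (x a)) (fun a => cmul c (x a)) =
  (c.1 ^+ 2 + c.2 ^+ 2) * ip x x.
Proof. by rewrite /ip mulr_sumr; apply: eq_bigr => a _ /=; ring. Qed.

Lemma ip_expand k x y : ip (fun a => cadd (cscale k (x a)) (y a))
    (fun a => cadd (cscale k (x a)) (y a)) = k ^+ 2 * ip x x + 2 * k * ip x y + ip y y.
Proof.
by rewrite /ip !mulr_sumr -!big_split; apply: eq_bigr => a _ /=; ring.
Qed.

Lemma nn_eq0 x : ip x x <= 0 -> forall a, x a = (0, 0).
Proof.
move=> x0 a; have /eqP : ip x x = 0 by apply/eqP; rewrite eq_le x0 ip_ge0.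
rewrite psumr_eq0; last by move=> b _; rewrite addr_ge0 // -expr2 sqr_ge0.
move=> /allP/(_ a); rewrite mem_index_enum => /(_ isT); rewrite -!expr2.
by rewrite paddr_eq0 ?sqr_ge0 // !sqrf_eq0 => /andP[/eqP e1 /eqP e2];
   rewrite [x a]surjective_pairing e1 e2.
Qed.

(* AM-GM for a product controlled by the cutoff [phi], also where [phi] vanishes. *)
Lemma ip_bound (phi m e : R) x g : 0 <= phi -> 0 <= m -> 0 < e ->
  ip g g <= phi * m -> 2 * `|ip x g| <= e * phi * ip x x + m / e.
Proof.
move=> phi0 m0 e0 gm; have gg := ip_ge0 g; have xx := ip_ge0 x.
have [p0|p0] := eqVneq phi 0.
  rewrite p0 mul0r in gm; have g0 := nn_eq0 gm.
  have -> : ip x g = 0 by rewrite /ip big1 // => a _; rewrite g0 /= !mulr0 addr0.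
  by rewrite normr0 !mulr0 p0 mulr0 mul0r add0r divr_ge0 // ltW.
have ph0 : 0 < phi by rewrite lt_neqAle eq_sym p0.
(* k = 1 and k = -1 give the two signs: the squared norm of g - k e phi x is nonnegative, and its
   expansion is divided by e phi. *)
have key k : k ^+ 2 = 1 -> 2 * (k * ip x g) <= e * phi * ip x x + m / e.
  move=> k1; have := ip_ge0 (fun a => cadd (cscale (- k * (e * phi)) (x a)) (g a)).
  rewrite ip_expand exprMn sqrrN k1 mul1r => H.
  have ep0 : 0 < e * phi by rewrite mulr_gt0.
  rewrite -(ler_pM2l ep0).
  have -> : e * phi * (e * phi * ip x x + m / e) = (e * phi) ^+ 2 * ip x x + phi * m.
    by field; rewrite gt_eqF.
  apply: (@le_trans _ _ ((e * phi) ^+ 2 * ip x x + ip g g)); last by rewrite lerD2l.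
  rewrite -subr_ge0; move: H; congr (0 <= _); ring.
have [x0|x0] := ger0P (ip x g).
  by have := key 1 (expr1n _ _); rewrite mul1r.
by have := key (-1) (sqrr_sign _ 1 : (-1) ^+ 2 = 1 :> R); rewrite mulN1r.
Qed.

End RealInner.

Lemma amgm_cutoff (R : realType) (phi m e f y : R) : 0 <= phi -> 0 <= m -> 0 < e ->
  y ^+ 2 <= phi * m -> 2 * `|f * y| <= e * phi * f ^+ 2 + m / e.
Proof.
move=> phi0 m0 e0 ym.
have := @ip_bound R 1 phi m e (fun=> (f, 0)) (fun=> (y, 0)) phi0 m0 e0.
by rewrite /ip !big_ord1 /= !mulr0 !addr0 -!expr2; exact.
Qed.

Section CauchySchwarz.
Variables (R : realType) (n : nat).
Implicit Types (x y g : 'I_n -> cpx R).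

Lemma ip_CS x g : ip x g ^+ 2 <= ip x x * ip g g.
Proof.
have gg := ip_ge0 g; have xx := ip_ge0 x.
have [g0|g0] := eqVneq (ip g g) 0.
  have z : ip g g <= 0 by rewrite g0.
  have -> : ip x g = 0 by rewrite /ip big1 // => a _; rewrite (nn_eq0 z) /= !mulr0 addr0.
  by rewrite expr0n /= g0 mulr0.
have gp : 0 < ip g g by rewrite lt_neqAle eq_sym g0.
have := ip_ge0 (fun a => cadd (cscale (- (ip x g / ip g g)) (g a)) (x a)).
rewrite ip_expand (ipC g x) => H.
have {}H : 0 <= ip g g * ((- (ip x g / ip g g)) ^+ 2 * ip g g
    + 2 * - (ip x g / ip g g) * ip x g + ip x x) by rewrite mulr_ge0.
rewrite -subr_ge0; move: H; congr (0 <= _); field; exact: g0.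
Qed.

End CauchySchwarz.

(** * Real parts, conjugation, and integration by parts on the grid *)

Section Pair.
Variables (R : realType) (n : nat).
Notation H := (Hn R n).
Notation sm := (sm R n).
Notation heis := (heis R n).
Implicit Types (F G : sm) (p : H).

Lemma pr_D F G p : pr (F + G) p = cadd (pr F p) (pr G p).
Proof. by rewrite /pr reD imD. Qed.

Lemma pr_M F G p : pr (F * G) p = cmul (pr F p) (pr G p).
Proof. by rewrite /pr reM imM. Qed.

Definition cj F : sm := mk (smooth_re F) (smoothN (smooth_im F)).

Lemma re_cj F p : re_ (cj F) p = re_ F p. Proof. by []. Qed.
Lemma im_cj F p : im_ (cj F) p = - im_ F p. Proof. by []. Qed.

Lemma sm_cjD F G : cj (F + G) = cj F + cj G.
Proof. by apply: sm_ext => p; rewrite ?re_cj ?im_cj ?reD ?imD ?re_cj ?im_cj ?opprD. Qed.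

Lemma sm_cjM F G : cj (F * G) = cj F * cj G.
Proof.
apply: sm_ext => p; rewrite ?re_cj ?im_cj ?reM ?imM ?re_cj ?im_cj; first by rewrite mulrNN.
by rewrite opprD mulrN mulNr.
Qed.

Lemma sm_cj1 : cj 1 = 1.
Proof. by apply: sm_ext => p; rewrite ?re_cj ?im_cj // /im_ smval1 /= oppr0. Qed.

Lemma cj_cder v F : cj (cder v F) = cder v (cj F).
Proof.
apply: sm_ext => p; first by [].
rewrite im_cj !im_cder -[im_ (cj F)]/(- im_ F) deriveN //.
exact/smooth_derivable/smooth_im.
Qed.

Lemma sm_cjN F : cj (- F) = - cj F.
Proof. by apply: sm_ext => p; rewrite ?re_cj ?im_cj ?reN ?imN. Qed.

Lemma cj_ii : cj (ii R n) = - ii R n.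
Proof. by apply: sm_ext => p; rewrite ?re_cj ?im_cj ?reN ?imN // /re_ /= oppr0. Qed.

Lemma cj_hh : cj (hh R n) = hh R n.
Proof. by apply: sm_ext => p; rewrite ?re_cj ?im_cj // /im_ /= oppr0. Qed.

Lemma cj_zz a : cj (zz R a) = zzb R a.
Proof. by apply: sm_ext. Qed.

Lemma cj_zzb a : cj (zzb R a) = zz R a.
Proof. by apply: sm_ext => p; rewrite ?re_cj ?im_cj // /im_ /= opprK. Qed.

Lemma cj_real (a : H -> R) (sa : smooth a) : cj (real sa) = real sa.
Proof. by apply: sm_ext => p; rewrite ?re_cj ?im_cj // /im_ /= oppr0. Qed.

Lemma ZE a F : Z heis a F = hh R n * (cder (ex a) F - ii R n * cder (ey a) F)
  + ii R n * zzb R a * cder et F.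
Proof. by []. Qed.

Lemma ZbE a F : Zb heis a F = hh R n * (cder (ex a) F + ii R n * cder (ey a) F)
  - ii R n * zz R a * cder et F.
Proof. by []. Qed.

Lemma cj_Z a F : cj (Z heis a F) = Zb heis a (cj F).
Proof.
rewrite ZE ZbE !(sm_cjD, sm_cjM, sm_cjN) cj_hh cj_ii cj_zzb !cj_cder.
by move: (hh R n) (ii R n) => *; ring.
Qed.

Lemma cj_Zb a F : cj (Zb heis a F) = Z heis a (cj F).
Proof.
rewrite ZE ZbE !(sm_cjD, sm_cjM, sm_cjN) cj_hh cj_ii cj_zz !cj_cder.
by move: (hh R n) (ii R n) => *; ring.
Qed.

Lemma re_sum (J : finType) (F : J -> sm) p : re_ (\sum_a F a) p = \sum_a re_ (F a) p.
Proof. by rewrite /re_ smval_sum raddf_sum. Qed.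

Lemma im_sum (J : finType) (F : J -> sm) p : im_ (\sum_a F a) p = \sum_a im_ (F a) p.
Proof. by rewrite /im_ smval_sum raddf_sum. Qed.

Lemma re_dot_cj (x y : 'I_n -> sm) p :
  re_ (dot x (fun a => cj (y a))) p = ip (fun a => pr (x a) p) (fun a => pr (y a) p).
Proof.
by rewrite re_sum; apply: eq_bigr => a _; rewrite reM re_cj im_cj mulrN opprK.
Qed.

(* The conjugate of [Zb_a phi] for a real-valued [phi]. *)
Definition gr (phi : H -> R) p (a : 'I_n) : cpx R :=
  (1 / 2 * 'D_(ex a) phi p + hy p 0 a * 'D_et phi p,
   - (1 / 2 * 'D_(ey a) phi p) + hx p 0 a * 'D_et phi p).

Section Vanishing.
Variable r : nat.
Hypothesis r0 : (0 < r)%N.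

(** The substitute for a zero integral: r is fixed and the mesh goes to 0. *)
Definition gvan (F : H -> R) := forall e, 0 < e ->
  exists N0 : nat, forall N, (N0 < N)%N -> `|gsum r N F| <= e.

Lemma gvanD (F G : H -> R) : gvan F -> gvan G -> gvan (fun p => F p + G p).
Proof.
move=> vF vG e e0; have e20 : 0 < e / 2 by rewrite divr_gt0.
have [N1 H1] := vF _ e20; have [N2 H2] := vG _ e20.
exists (maxn N1 N2) => N; rewrite gtn_max => /andP[h1 h2].
by rewrite gsumD [leRHS]splitr (le_trans (ler_normD _ _)) // lerD ?H1 ?H2.
Qed.

Lemma gvanZ c (F : H -> R) : gvan F -> gvan (fun p => c * F p).
Proof.
move=> vF e e0; have [->|c0] := eqVneq c 0.
  by exists 0%N => N _; rewrite gsumZ mul0r normr0 ltW.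
have cp : 0 < `|c| by rewrite normr_gt0.
have [N0 H0] := vF _ (divr_gt0 e0 cp); exists N0 => N /H0.
by move=> NN; rewrite gsumZ [Num.norm (c * _)]normrM -ler_pdivlMl // mulrC.
Qed.

Lemma gvan_sum (J : finType) (F : J -> H -> R) :
  (forall j, gvan (F j)) -> gvan (fun p => \sum_j F j p).
Proof.
move=> vF.
suff H (s : seq J) : gvan (fun p => \sum_(j <- s) F j p) by exact: H.
elim: s => [|j s IH] e e0.
  exists 0%N => N _; rewrite (_ : gsum _ _ _ = 0) ?normr0 ?ltW //.
  by rewrite /gsum big1 ?mulr0 // => k _; rewrite big_nil.
have [N0 H0] := gvanD (vF j) IH e0; exists N0 => N /H0.
by rewrite /gsum; under [in X in _ -> X]eq_bigr do rewrite big_cons.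
Qed.

Definition cutoff (phi : H -> R) := Ck 1 phi /\ supp_box r phi.

Lemma gvan_derive v (f phi : H -> R) : gdir v -> smooth f -> cutoff phi ->
  gvan ('D_v (fun p => f p * phi p)).
Proof.
move=> dv sf [cphi sphi]; have [df Df] := CkM (sf 1%N) cphi.
move=> e e0; apply: (gsum_derive r0 dv _ df (Df v) e0).
by move=> p /sphi ->; rewrite mulr0.
Qed.

(** The coefficient -i z_a of T in Zb_a is independent of t, so it moves under the t-derivative, and
    the summand becomes a combination of coordinate derivatives of functions cut off by phi. *)
Lemma gvan_div (V : 'I_n -> sm) (phi : H -> R) : cutoff phi ->
  gvan (fun p => re_ (\sum_a Zb heis a (V a)) p * phi p
                 + ip (fun a => pr (V a) p) (gr phi p)).
Proof.
move=> cphi.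
pose F a p := 1 / 2 * 'D_(ex a) (fun q => re_ (V a) q * phi q) p
  + (- (1 / 2)) * 'D_(ey a) (fun q => im_ (V a) q * phi q) p
  + 'D_et (fun q => (hx q 0 a * im_ (V a) q + hy q 0 a * re_ (V a) q) * phi q) p.
have vF a : gvan (F a).
  apply: gvanD; first apply: gvanD.
  - by apply/gvanZ/gvan_derive => //; [left; exists a | exact: smooth_re].
  - by apply/gvanZ/gvan_derive => //; [right; left; exists a | exact: smooth_im].
  apply: gvan_derive => //; first by right; right.
  apply: smoothD; apply: smoothM.
  - exact: (smooth_hx R a).1.
  - exact: smooth_im.
  - exact: (smooth_hy R a).1.
  - exact: smooth_re.
have := gvan_sum vF; congr gvan; apply/funext => p.
rewrite re_sum mulr_suml /ip -big_split; apply: eq_bigr => a _ /=.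
have dphi v : derivable phi p v by apply: diff_derivable; case: cphi => -[].
have dre v : derivable (re_ (V a)) p v by exact/smooth_derivable/smooth_re.
have dim v : derivable (im_ (V a)) p v by exact/smooth_derivable/smooth_im.
have dx v : derivable (fun q : H => hx q 0 a) p v by exact/smooth_derivable/(smooth_hx R a).1.
have dy v : derivable (fun q : H => hy q 0 a) p v by exact/smooth_derivable/(smooth_hy R a).1.
rewrite /F.
have -> : 'D_(ex a) (fun q => re_ (V a) q * phi q) p =
  re_ (V a) p * 'D_(ex a) phi p + phi p * re_ (cder (ex a) (V a)) p.
  exact: (deriveM (dre (ex a)) (dphi (ex a))).
have -> : 'D_(ey a) (fun q => im_ (V a) q * phi q) p =
  im_ (V a) p * 'D_(ey a) phi p + phi p * im_ (cder (ey a) (V a)) p.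
  exact: (deriveM (dim (ey a)) (dphi (ey a))).
have -> : 'D_et (fun q => (hx q 0 a * im_ (V a) q + hy q 0 a * re_ (V a) q) * phi q) p =
  (hx p 0 a * im_ (V a) p + hy p 0 a * re_ (V a) p) * 'D_et phi p
  + phi p * (hx p 0 a * im_ (cder et (V a)) p + hy p 0 a * re_ (cder et (V a)) p).
  have d1 := derivableM (dx et) (dim et); have d2 := derivableM (dy et) (dre et).
  rewrite (deriveM (derivableD d1 d2) (dphi et)) (deriveD d1 d2).
  rewrite (deriveM (dx et) (dim et)) (deriveM (dy et) (dre et)).
  rewrite (smooth_hx R a).2 (smooth_hy R a).2.
  have -> : hx (et : H) 0 a = 0 by rewrite /hx /= mxE.
  by rewrite !scaler0 !addr0.
have -> : re_ (Zb heis a (V a)) p = 1 / 2 * (re_ (cder (ex a) (V a)) p - im_ (cder (ey a) (V a)) p)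
   + (hx p 0 a * im_ (cder et (V a)) p + hy p 0 a * re_ (cder et (V a)) p).
  rewrite [Zb heis a (V a)]/(hh R n * (cder (ex a) (V a) + ii R n * cder (ey a) (V a))
    - ii R n * zz R a * cder et (V a)) !(reD, imD, reM, imM, reN, imN).
  rewrite (re_hh p) (im_hh p) (re_ii p) (im_ii p) (re_zz a p) (im_zz a p).
  by move: (re_ _ p) (re_ _ p) (im_ _ p) (im_ _ p) (hx p 0 a) (hy p 0 a) => *; ring.
rewrite /gr /pr /=.
move: (re_ (V a) p) (im_ (V a) p) (re_ _ p) (re_ _ p) (im_ _ p) (im_ _ p) => *.
move: ('D_(ex a) phi p) ('D_(ey a) phi p) ('D_et phi p) (hx p 0 a) (hy p 0 a) (phi p) => *.
ring.
Qed.

End Vanishing.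
End Pair.

(** * Cutoff functions *)

Section PosPart.
Variable R : realType.

Definition pos (x : R) : R := Num.max x 0.
Definition pos2 (x : R) : R := pos x ^+ 2.

Lemma pos_ge0 x : 0 <= pos x. Proof. by rewrite le_max lexx orbT. Qed.

Lemma pos2_taylor (x h : R) : `|pos2 (x + h) - pos2 x - 2 * pos x * h| <= h ^+ 2.
Proof.
rewrite /pos2 /pos; case: (leP x 0) => x0; case: (leP (x + h) 0) => xh0;
  rewrite ?(max_l (ltW _)) // ler_norml; apply/andP; split; nra.
Qed.

Lemma is_derive_pos2 (x : R) : is_derive x 1 pos2 (2 * pos x).
Proof.
have H : h^-1 *: ((pos2 \o shift x) (h *: 1) - pos2 x) @[h --> 0^'] --> 2 * pos x.
  apply/cvgrPdist_le => e e0; near=> h.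
  have h0 : h != 0 by near: h; exact: nbhs_dnbhs_neq.
  have he : `|h| < e by near: h; exact: dnbhs0_lt.
  rewrite /= [h *: 1]mulr1 [h + x]addrC /GRing.scale /=.
  have -> : 2 * pos x - h^-1 * (pos2 (x + h) - pos2 x) =
     - h^-1 * (pos2 (x + h) - pos2 x - 2 * pos x * h) by field.
  rewrite normrM normrN normfV ler_pdivrMl ?normr_gt0 //.
  apply: (le_trans (pos2_taylor x h)); rewrite -real_normK ?num_real // expr2.
  by rewrite ler_wpM2l // ltW.
by apply: DeriveDef; [apply/cvg_ex; eexists; exact: H | apply/cvg_lim].
Unshelve. all: by end_near.
Qed.

Lemma continuous_pos : continuous pos.
Proof.
move=> x; apply: (@continuous_max _ _ id (cst 0) x); [exact: cvg_id|exact: cvg_cst].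
Qed.

End PosPart.

Section Cutoffs.
Variables (R : realType) (n : nat).
Notation H := (Hn R n).

Lemma smooth_zsq : smooth (@zsq R n).
Proof.
suff K (s : seq 'I_n) :
    smooth (fun p : H => \sum_(a <- s) (hx p 0 a ^+ 2 + hy p 0 a ^+ 2)) by exact: K.
elim: s => [|a s IH].
  have -> : (fun p : H => \sum_(a <- [::]) (hx p 0 a ^+ 2 + hy p 0 a ^+ 2)) = fun=> 0.
    by apply/funext => p; rewrite big_nil.
  exact: smooth_cst.
have -> : (fun p : H => \sum_(b <- a :: s) (hx p 0 b ^+ 2 + hy p 0 b ^+ 2)) =
  fun p => (hx p 0 a * hx p 0 a + hy p 0 a * hy p 0 a)
    + \sum_(b <- s) (hx p 0 b ^+ 2 + hy p 0 b ^+ 2).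
  by apply/funext => p; rewrite big_cons !expr2.
have sx := (smooth_hx R a).1; have sy := (smooth_hy R a).1.
by apply: smoothD => //; apply: smoothD; exact: smoothM.
Qed.

Definition Pn (p : H) : R := zsq p ^+ 2 + ht p ^+ 2.

Lemma smooth_Pn : smooth Pn.
Proof.
have -> : Pn = fun p => zsq p * zsq p + ht p * ht p by apply/funext => p; rewrite /Pn !expr2.
by have st := (smooth_ht R n).1; have sz := smooth_zsq;
   apply: smoothD; exact: smoothM.
Qed.

Lemma derive_zsq v p :
  'D_v (@zsq R n) p = \sum_a (2 * hx p 0 a * hx v 0 a + 2 * hy p 0 a * hy v 0 a).
Proof.
have dx a : is_derive p v (fun q : H => hx q 0 a) (hx v 0 a).
  by apply: DeriveDef; [exact/smooth_derivable/(smooth_hx R a).1|exact: (smooth_hx R a).2].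
have dy a : is_derive p v (fun q : H => hy q 0 a) (hy v 0 a).
  by apply: DeriveDef; [exact/smooth_derivable/(smooth_hy R a).1|exact: (smooth_hy R a).2].
have -> : @zsq R n = \sum_a ((fun q : H => hx q 0 a) ^+ 2 + (fun q : H => hy q 0 a) ^+ 2).
  by apply/funext => q; rewrite fct_sumE; apply: eq_bigr => a _; rewrite !fctE.
have ds := is_derive_sum (fun a => is_deriveD (is_deriveX 2 (dx a)) (is_deriveX 2 (dy a))).
by rewrite (derive_val (is_derive := ds)); apply: eq_bigr => a _; rewrite /GRing.scale /= !expr1.
Qed.

Lemma derive_Pn v p :
  'D_v Pn p = 2 * zsq p * 'D_v (@zsq R n) p + 2 * ht p * ht v.
Proof.
have dz : is_derive p v (@zsq R n) ('D_v (@zsq R n) p).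
  by apply: DeriveDef => //; exact/smooth_derivable/smooth_zsq.
have dt : is_derive p v (fun q : H => ht q) (ht v).
  by apply: DeriveDef; [exact/smooth_derivable/(smooth_ht R n).1|exact: (smooth_ht R n).2].
have ds := is_deriveD (is_deriveX 2 dz) (is_deriveX 2 dt).
have -> : Pn = (@zsq R n) ^+ 2 + (fun q : H => ht q) ^+ 2 by apply/funext => q.
by rewrite (derive_val (is_derive := ds)) /GRing.scale /= !expr1.
Qed.

(** The reason why a cutoff at scale r costs r^-2: where |xi| is of order r, the squared gradient of
    r^-4 |xi|^4 is of order r^-8 * r^2 * r^4. *)
Lemma nn_gr_Pn p : ip (gr Pn p) (gr Pn p) = 4 * zsq p * Pn p.
Proof.
have Dx a : 'D_(ex a) Pn p = 4 * zsq p * hx p 0 a.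
  rewrite derive_Pn derive_zsq (bigD1 a) //= big1 ?addr0 => [|b ba].
    by rewrite /hx /hy /ht /= !mxE eqxx mulr1n; ring.
  by rewrite /hx /hy /= !mxE (negbTE ba) !mulr0 addr0.
have Dy a : 'D_(ey a) Pn p = 4 * zsq p * hy p 0 a.
  rewrite derive_Pn derive_zsq (bigD1 a) //= big1 ?addr0 => [|b ba].
    by rewrite /hx /hy /ht /= !mxE eqxx mulr1n; ring.
  by rewrite /hx /hy /= !mxE (negbTE ba) !mulr0 addr0.
have Dt : 'D_et Pn p = 2 * ht p.
  rewrite derive_Pn derive_zsq big1 => [|b _]; first by rewrite /ht /=; ring.
  by rewrite /hx /hy /= !mxE !mulr0 addr0.
transitivity (4 * Pn p * zsq p); last by ring.
rewrite /ip {1}/zsq mulr_sumr; apply: eq_bigr => a _.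
rewrite /gr /= Dx Dy Dt /Pn; move: (zsq p) (ht p) (hx p 0 a) (hy p 0 a) => *; by field.
Qed.

Lemma zsq_ge0 p : 0 <= @zsq R n p.
Proof. by apply: sumr_ge0 => a _; rewrite addr_ge0 ?sqr_ge0. Qed.

Lemma Pn_ge0 p : 0 <= Pn p.
Proof. by rewrite /Pn addr_ge0 ?sqr_ge0. Qed.

Section Radius.
Variable r : nat.
Hypothesis r0 : (0 < r)%N.
Let rr : R := r%:R.
Let rr0 : 0 < rr. Proof. by rewrite ltr0n. Qed.

(* Positive parts are squared to be C^1. The cutoffs are B^4, A^4 B^3 and A^2 B^2, so that the
   gradient of each is controlled by itself and the next one. *)
Definition cA p : R := pos2 (rr ^- 4 * Pn p - 1).
Definition cb p : R := pos (1 - cA p ^+ 3).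
Definition cB p : R := pos2 (1 - cA p ^+ 3).

Definition dA p : R := 2 * pos (rr ^- 4 * Pn p - 1) * rr ^- 4.
Definition dB p : R := 2 * cb p * - (3 * cA p ^+ 2 * dA p).

(* [f] has gradient [k] times the gradient of [Pn], with [k] continuous. *)
Definition radial (f k : H -> R) :=
  continuous k /\ forall p, differentiable f p /\ forall v, 'D_v f p = k p * 'D_v Pn p.

Lemma radial_Ck1 f k : radial f k -> Ck 1 f.
Proof.
move=> [ck df]; split=> [p|v]; first by have [] := df p.
have -> : 'D_v f = fun p => k p * 'D_v Pn p by apply/funext => p; have [_ ->] := df p.
exact: (@CkM R n 0 k ('D_v Pn) ck (smooth_derive v smooth_Pn 0%N)).
Qed.

Lemma radial_continuous f k : radial f k -> continuous f.
Proof. by move=> [_ df] p; apply: differentiable_continuous; have [] := df p. Qed.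

Lemma radialM f g k l : radial f k -> radial g l ->
  radial (fun p => f p * g p) (fun p => k p * g p + f p * l p).
Proof.
move=> rf rg; have [[ck df] [cl dg]] := (rf, rg).
have cf := radial_continuous rf; have cg := radial_continuous rg.
split=> [|p]; first exact: (@CkD R n 0 _ _ (@CkM R n 0 k g ck cg) (@CkM R n 0 f l cf cl)).
have [[d1 e1] [d2 e2]] := (df p, dg p); split=> [|v]; first exact: differentiableM.
rewrite -[LHS]/('D_v (f * g) p) deriveM; [|exact: diff_derivable|exact: diff_derivable].
by rewrite e1 e2 /GRing.scale /=; ring.
Qed.

Lemma radialX f k m : radial f k -> radial (fun p => f p ^+ m.+1) (fun p => m.+1%:R * f p ^+ m * k p).
Proof.
move=> rf; elim: m => [|m IH].
  have -> : (fun p => f p ^+ 1) = f by [].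
  by have -> : (fun p => 1%:R * f p ^+ 0 * k p) = k by apply/funext => p; rewrite expr0 !mul1r.
have := radialM rf IH; congr radial; apply/funext => p.
by rewrite !exprS [in RHS]mulrSr; ring.
Qed.

Lemma radial_pos2 f k : radial f k -> radial (fun p => pos2 (f p)) (fun p => 2 * pos (f p) * k p).
Proof.
move=> rf; have [ck df] := rf; have cf := radial_continuous rf; split=> [|p].
  apply: (@CkM R n 0 (fun p => 2 * pos (f p)) k _ ck).
  apply: (@CkM R n 0 (fun=> 2) (fun p => pos (f p)) (@Ck_cst R n 0 2)) => p.
  by apply: (@continuous_comp _ _ _ f (@pos R)); [exact: cf|exact: continuous_pos].
have [d1 e1] := df p; split=> [|v].
  exact: (differentiable_chain d1 (is_derive_pos2 (f p))).
by rewrite (derive_chain v d1 (is_derive_pos2 (f p))) e1 mulrA.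
Qed.

Lemma radial_affine (c d : R) f k : radial f k ->
  radial (fun p => c * f p + d) (fun p => c * k p).
Proof.
move=> [ck df]; split=> [|p]; first exact: (@CkM R n 0 (fun=> c) k (@Ck_cst R n 0 c) ck).
have [d1 e1] := df p; split=> [|v].
  by apply: differentiableD => //; exact: differentiableZ.
rewrite -[LHS]/('D_v (c *: f + cst d) p) deriveD; last 2 first.
- by apply: derivableZ; exact: diff_derivable.
- exact: derivable_cst.
by rewrite derive_cst addr0 deriveZ ?e1 /GRing.scale /= ?mulrA //; exact: diff_derivable.
Qed.

Lemma radial_Pn : radial Pn (fun=> 1).
Proof.
split=> p; first exact: cvg_cst.
by split=> [|v]; [exact: (smooth_differentiable p smooth_Pn)|rewrite mul1r].
Qed.

Lemma radial_cA : radial cA dA.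
Proof.
have := radial_pos2 (radial_affine (rr ^- 4) (-1) radial_Pn).
by congr radial; apply/funext => p; rewrite /dA; ring.
Qed.

Lemma radial_cB : radial cB dB.
Proof.
have := radial_pos2 (radial_affine (-1) 1 (radialX 2 radial_cA)).
by congr radial; apply/funext => p; rewrite /cB /dB /cb ?[-1 * _ + 1]addrC ?mulN1r.
Qed.

Lemma radial_nn f k p : radial f k -> ip (gr f p) (gr f p) = k p ^+ 2 * (4 * zsq p * Pn p).
Proof.
move=> [_ df]; have [_ e] := df p; rewrite -nn_gr_Pn /ip mulr_sumr.
apply: eq_bigr => a _; rewrite /gr /= !e; move: ('D_(ex a) Pn p) ('D_(ey a) Pn p).
by move: ('D_et Pn p) (hx p 0 a) (hy p 0 a) (k p) => *; ring.
Qed.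

Lemma cA_ge0 p : 0 <= cA p. Proof. exact: sqr_ge0. Qed.
Lemma cB_ge0 p : 0 <= cB p. Proof. exact: sqr_ge0. Qed.

Lemma cB_le1 p : cB p <= 1.
Proof.
rewrite /cB /pos2 expr_le1 ?pos_ge0 // /pos ge_max ler01 andbT.
by rewrite lerBlDr lerDl exprn_ge0 // cA_ge0.
Qed.

Lemma cB_neq0 p : cB p != 0 -> cA p <= 1 /\ Pn p <= 2 * rr ^+ 4.
Proof.
rewrite /cB /pos2 expf_eq0 /= /pos; case: (leP (1 - cA p ^+ 3) 0); rewrite ?eqxx //.
rewrite subr_gt0 => A1 _.
have A1' : cA p < 1 by rewrite -(@ltr_pXn2r _ 3) ?nnegrE ?cA_ge0 // expr1n.
split; first exact: ltW.
rewrite leNgt; apply/negP => P2; move: A1'; rewrite ltNge => /negP; apply.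
have s1 : 1 <= rr ^- 4 * Pn p - 1.
  rewrite lerBrDr mulrC ler_pdivlMr ?exprn_gt0 // mulrC [leLHS]mulrC; apply: ltW.
  by apply: le_lt_trans P2; rewrite mulrC.
by rewrite /cA /pos2 /pos max_l ?exprn_ege1 // (le_trans ler01 s1).
Qed.

Lemma Pn_geo p : Pn p <= 2 * rr ^+ 4 -> (rr ^- 4) ^+ 2 * (4 * zsq p * Pn p) <= 16 / rr ^+ 2.
Proof.
move=> P2; have z0 := zsq_ge0 p; have P0 := Pn_ge0 p.
have z2 : zsq p <= 2 * rr ^+ 2.
  rewrite -(@ler_pXn2r _ 2) ?nnegrE // ?mulr_ge0 ?sqr_ge0 //.
  rewrite exprMn -exprM; apply: (@le_trans _ _ (Pn p)); first by rewrite /Pn lerDl sqr_ge0.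
  apply: (le_trans P2); rewrite ler_wpM2r ?exprn_ge0 ?ltW //; lra.
have H : 4 * zsq p * Pn p <= 4 * (2 * rr ^+ 2) * (2 * rr ^+ 4).
  by rewrite ler_pM ?mulr_ge0 // ler_wpM2l.
apply: (le_trans (ler_wpM2l (sqr_ge0 _) H)).
by rewrite le_eqVlt; apply/orP; left; apply/eqP; field; rewrite gt_eqF.
Qed.

(** One large coordinate forces |xi|^4 >= 4 r^4, beyond the bound 2 r^4 that holds where B is
    nonzero. *)
Lemma cB_supp p : (exists j, 2 * r%:R <= `|hx p 0 j|) \/
  (exists j, 2 * r%:R <= `|hy p 0 j|) \/ 2 * r%:R ^+ 2 <= `|ht p| -> cB p = 0.
Proof.
move=> H; apply/eqP; apply/negPn/negP => /cB_neq0[_]; apply/negP; rewrite -ltNge.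
have xz j : hx p 0 j ^+ 2 <= zsq p.
  rewrite /zsq (bigD1 j) //= -addrA lerDl addr_ge0 ?sqr_ge0 //.
  by apply: sumr_ge0 => a _; rewrite addr_ge0 ?sqr_ge0.
have yz j : hy p 0 j ^+ 2 <= zsq p.
  rewrite /zsq (bigD1 j) //= [_ ^+ 2 + _ ^+ 2]addrC -addrA lerDl addr_ge0 ?sqr_ge0 //.
  by apply: sumr_ge0 => a _; rewrite addr_ge0 ?sqr_ge0.
have sqb (x : R) : 2 * rr <= `|x| -> 4 * rr ^+ 2 <= x ^+ 2.
  move=> h; rewrite -(real_normK (num_real x)).
  have -> : 4 * rr ^+ 2 = (2 * rr) ^+ 2 by ring.
  by rewrite lerXn2r ?nnegrE ?mulr_ge0 // ltW.
have zP : 4 * rr ^+ 2 <= zsq p -> 2 * rr ^+ 4 < Pn p.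
  move=> h; have : (4 * rr ^+ 2) ^+ 2 <= zsq p ^+ 2.
    by rewrite lerXn2r ?nnegrE ?zsq_ge0 // mulr_ge0 ?sqr_ge0.
  rewrite exprMn -exprM => h2; apply: (@lt_le_trans _ _ (zsq p ^+ 2)).
    apply: lt_le_trans h2; rewrite ltr_pM2r ?exprn_gt0 //; lra.
  by rewrite /Pn lerDl sqr_ge0.
case: H => [[j /sqb h]|[[j /sqb h]|h]].
- by apply/zP/(le_trans h).
- by apply/zP/(le_trans h).
have : (2 * rr ^+ 2) ^+ 2 <= ht p ^+ 2.
  rewrite -[leRHS](real_normK (num_real _)) lerXn2r ?nnegrE ?mulr_ge0 ?sqr_ge0 //.
rewrite exprMn -exprM => h2; apply: (@lt_le_trans _ _ (ht p ^+ 2)).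
  apply: lt_le_trans h2; rewrite ltr_pM2r ?exprn_gt0 //; lra.
by rewrite /Pn lerDr sqr_ge0.
Qed.

Lemma cutoff_radial f k : radial f k -> (forall p, cB p = 0 -> f p = 0) -> cutoff r f.
Proof. by move=> rf f0; split; [exact: (radial_Ck1 rf)|move=> p /cB_supp; exact: f0]. Qed.

Lemma radial_bound f k p (m : R) : radial f k ->
  k p ^+ 2 <= m * (rr ^- 4) ^+ 2 -> 0 <= m -> Pn p <= 2 * rr ^+ 4 \/ k p = 0 ->
  ip (gr f p) (gr f p) <= m * (16 / rr ^+ 2).
Proof.
move=> rf km m0 H; rewrite (radial_nn _ rf).
have zP0 : 0 <= 4 * zsq p * Pn p by rewrite !mulr_ge0 ?zsq_ge0 ?Pn_ge0.
case: H => [/Pn_geo H|->]; last by rewrite expr0n mul0r mulr_ge0 // divr_ge0 ?sqr_ge0.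
apply: (le_trans (ler_wpM2r zP0 km)); rewrite -[m * _ * _]mulrA; exact: ler_wpM2l.
Qed.

(** Since [chi], and with it [psi], vanishes for |xi| <= r, the bound on e^(2f) is asked for only
    where the decay of u provides it. *)
Lemma cutoff_facts : exists phi psi chi : H -> R,
  let K := 15 ^+ 3 * (16 / rr ^+ 2) in
  [/\ [/\ cutoff r phi, cutoff r psi & cutoff r chi],
     (forall p, Pn p <= rr ^+ 4 -> phi p = 1),
     (forall p, [/\ 0 <= phi p, 0 <= psi p, psi p <= chi p, chi p <= 1 &
                 psi p ^+ 2 <= phi p * chi p]),
     (forall p, [/\ ip (gr phi p) (gr phi p) <= phi p * (K * psi p),
        ip (gr psi p) (gr psi p) <= psi p * (K * chi p) &
        ip (gr chi p) (gr chi p) <= chi p * K]) &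
     (forall p, Pn p <= rr ^+ 4 -> chi p = 0)].
Proof.
have rphi := radialX 3 radial_cB.
have rpsi := radialM (radialX 3 radial_cA) (radialX 2 radial_cB).
have rchi := radialM (radialX 1 radial_cA) (radialX 1 radial_cB).
exists (fun p => cB p ^+ 4), (fun p => cA p ^+ 4 * cB p ^+ 3), (fun p => cA p ^+ 2 * cB p ^+ 2).
have A0 := cA_ge0; have B0 := cB_ge0; have B1 := cB_le1.
have small p : Pn p <= rr ^+ 4 -> cA p = 0.
  move=> h; rewrite /cA /pos2 /pos max_r ?expr0n // subr_le0.
  by rewrite mulrC ler_pdivrMr ?exprn_gt0 // mul1r.
have pA p := pos_ge0 (rr ^- 4 * Pn p - 1).
have Bcase p : cB p = 0 \/ (cA p <= 1 /\ Pn p <= 2 * rr ^+ 4).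
  by have [->|/cB_neq0] := eqVneq (cB p) 0; [left|right].
have dA2 p : dA p ^+ 2 = 4 * cA p * (rr ^- 4) ^+ 2.
  by rewrite /dA !exprMn /cA /pos2; ring.
(* The cube in [cB] produces the power A^5 here, so the squared gradient of B^4 is of order A^5 B^7,
   below phi psi = A^4 B^7. *)
have dB2 p : dB p ^+ 2 = 36 * cB p * cA p ^+ 4 * (4 * cA p * (rr ^- 4) ^+ 2).
  by rewrite -dA2 /dB /cB /pos2 /cb; ring.
move=> K; have K0 : 0 <= K by rewrite /K mulr_ge0 ?divr_ge0 ?exprn_ge0 ?ler0n ?sqr_ge0.
(* Constants of the three gradient bounds: 48^2 = 16 * 36 * 4 for B^4; for the two products, twice
   the squares of the terms of the product rule. 15^3 dominates all three. *)
have [n1 n2 n3] : [/\ 48 ^+ 2 <= 15 ^+ 3 :> R, 128 + 2 * 36 ^+ 2 <= 15 ^+ 3 :> R &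
    32 + 2 * 24 ^+ 2 <= 15 ^+ 3 :> R].
  by split; rewrite -!natrX -?natrM -?natrD ler_nat.
split.
- split.
  + by apply: (cutoff_radial rphi) => p ->; rewrite expr0n.
  + by apply: (cutoff_radial rpsi) => p ->; rewrite [0 ^+ _]expr0n mulr0.
  + by apply: (cutoff_radial rchi) => p ->; rewrite [0 ^+ _]expr0n mulr0.
- by move=> p /small e; rewrite /cB e expr0n /= subr0 /pos2 /pos max_l // !expr1n.
- move=> p; have := A0 p; have := B0 p; have := B1 p.
  case: (Bcase p) => [->|[a1 _]].
    by move=> *; rewrite !expr0n /= !mulr0 expr0n; split=> //; rewrite mulr0.
  move: (cA p) (cB p) a1 => a b a1 b1 b0 a0.
  have a2 : a ^+ 2 <= 1 by rewrite expr_le1.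
  have b2 : b ^+ 2 <= 1 by rewrite expr_le1.
  have a20 : 0 <= a ^+ 2 by rewrite exprn_ge0.
  have b20 : 0 <= b ^+ 2 by rewrite exprn_ge0.
  split; rewrite ?mulr_ge0 ?exprn_ge0 //.
  + have -> : a ^+ 4 * b ^+ 3 = (a ^+ 2 * b ^+ 2) * (a ^+ 2 * b) by ring.
    by apply: ler_piMr; rewrite ?mulr_ge0 // mulr_ile1.
  + by rewrite mulr_ile1.
  have -> : (a ^+ 4 * b ^+ 3) ^+ 2 = b ^+ 4 * (a ^+ 2 * b ^+ 2) * (a ^+ 2) ^+ 3 by ring.
  by apply: ler_piMr; rewrite ?mulr_ge0 ?exprn_ge0 // exprn_ile1.
- move=> p; have a0 := A0 p; have b0 := B0 p; have b1 := B1 p.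
  have kE : K = 15 ^+ 3 * (16 / rr ^+ 2) by [].
  have c00 : 0 <= 15 ^+ 3 :> R by rewrite exprn_ge0 ?ler0n.
  move: (15 ^+ 3) c00 n1 n2 n3 kE => c0 c00 n1 n2 n3 kE.
  have q0 : 0 <= (rr ^- 4) ^+ 2 by exact: sqr_ge0.
  split.
  + have -> : cB p ^+ 4 * (K * (cA p ^+ 4 * cB p ^+ 3)) =
      (c0 * cB p ^+ 7 * cA p ^+ 4) * (16 / rr ^+ 2) by rewrite kE; ring.
    apply: (radial_bound rphi); [|by rewrite !mulr_ge0 ?exprn_ge0 ?pos_ge0|
      by case: (Bcase p) => [->|[]]; [right; rewrite expr0n /= mulr0 mul0r|left]].
    rewrite [X in X <= _]exprMn dB2; case: (Bcase p) => [->|[a1 _]].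
      by rewrite !expr0n /= !(mulr0, mul0r).
    move: (cA p) (cB p) a0 b0 b1 a1 => a b a0 b0 b1 a1.
    have -> : (4%:R * b ^+ 3) ^+ 2 * (36 * b * a ^+ 4 * (4 * a * (rr ^- 4) ^+ 2)) =
      48 ^+ 2 * b ^+ 7 * a ^+ 4 * a * (rr ^- 4) ^+ 2 by ring.
    rewrite ler_wpM2r //; apply: (@le_trans _ _ (48 ^+ 2 * b ^+ 7 * a ^+ 4)).
      by apply: ler_piMr => //; rewrite !mulr_ge0 ?exprn_ge0.
    by rewrite !ler_wpM2r ?exprn_ge0.
  + have -> : cA p ^+ 4 * cB p ^+ 3 * (K * (cA p ^+ 2 * cB p ^+ 2)) =
      (c0 * cA p ^+ 6 * cB p ^+ 5) * (16 / rr ^+ 2) by rewrite kE; ring.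
    apply: (radial_bound rpsi); [|by rewrite !mulr_ge0 ?exprn_ge0 ?pos_ge0|
      by case: (Bcase p) => [->|[]]; [right; rewrite !expr0n /= !(mulr0, mul0r) addr0|left]].
    case: (Bcase p) => [->|[a1 _]].
      by rewrite !expr0n /= !(mulr0, mul0r) addr0 expr0n.
    apply: (@le_trans _ _ (2 * (4%:R * cA p ^+ 3 * dA p * cB p ^+ 3) ^+ 2 +
        2 * (cA p ^+ 4 * (3%:R * cB p ^+ 2 * dB p)) ^+ 2)).
      rewrite -subr_ge0; have := sqr_ge0 (4%:R * cA p ^+ 3 * dA p * cB p ^+ 3
        - cA p ^+ 4 * (3%:R * cB p ^+ 2 * dB p)); congr (0 <= _); ring.
    have -> : (4%:R * cA p ^+ 3 * dA p * cB p ^+ 3) ^+ 2 =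
      (4%:R * cA p ^+ 3 * cB p ^+ 3) ^+ 2 * dA p ^+ 2 by ring.
    have -> : (cA p ^+ 4 * (3%:R * cB p ^+ 2 * dB p)) ^+ 2 =
      (3%:R * cA p ^+ 4 * cB p ^+ 2) ^+ 2 * dB p ^+ 2 by ring.
    rewrite dA2 dB2; move: (cA p) (cB p) a0 b0 b1 a1 => a b a0 b0 b1 a1.
    have -> : 2 * ((4%:R * a ^+ 3 * b ^+ 3) ^+ 2 * (4 * a * (rr ^- 4) ^+ 2)) +
      2 * ((3%:R * a ^+ 4 * b ^+ 2) ^+ 2 * (36 * b * a ^+ 4 * (4 * a * (rr ^- 4) ^+ 2))) =
      (128 * (a * b) + 2 * 36 ^+ 2 * a ^+ 7) * (a ^+ 6 * b ^+ 5) * (rr ^- 4) ^+ 2 by ring.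
    rewrite ler_wpM2r // -[c0 * _ * _]mulrA ler_wpM2r ?mulr_ge0 ?exprn_ge0 //.
    have ab : a * b <= 1 by rewrite mulr_ile1.
    have a7 : a ^+ 7 <= 1 by rewrite exprn_ile1.
    apply: le_trans n2; apply: lerD; first by apply: ler_piMr; rewrite ?ler0n.
    by apply: ler_piMr; rewrite // mulr_ge0 ?exprn_ge0 ?ler0n.
  have -> : cA p ^+ 2 * cB p ^+ 2 * K =
    (c0 * cA p ^+ 2 * cB p ^+ 2) * (16 / rr ^+ 2) by rewrite kE; ring.
  apply: (radial_bound rchi); [|by rewrite !mulr_ge0 ?exprn_ge0 ?pos_ge0|
      by case: (Bcase p) => [->|[]]; [right; rewrite !expr0n /= !(mulr0, mul0r) addr0|left]].
  case: (Bcase p) => [->|[a1 _]].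
    by rewrite !expr0n /= !(mulr0, mul0r) addr0 expr0n.
  apply: (@le_trans _ _ (2 * (2%:R * cA p ^+ 1 * dA p * cB p ^+ 2) ^+ 2 +
      2 * (cA p ^+ 2 * (2%:R * cB p ^+ 1 * dB p)) ^+ 2)).
    rewrite -subr_ge0; have := sqr_ge0 (2%:R * cA p ^+ 1 * dA p * cB p ^+ 2
      - cA p ^+ 2 * (2%:R * cB p ^+ 1 * dB p)); congr (0 <= _); ring.
  have -> : (2%:R * cA p ^+ 1 * dA p * cB p ^+ 2) ^+ 2 =
    (2%:R * cA p * cB p ^+ 2) ^+ 2 * dA p ^+ 2 by ring.
  have -> : (cA p ^+ 2 * (2%:R * cB p ^+ 1 * dB p)) ^+ 2 =
    (2%:R * cA p ^+ 2 * cB p) ^+ 2 * dB p ^+ 2 by ring.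
  rewrite dA2 dB2; move: (cA p) (cB p) a0 b0 b1 a1 => a b a0 b0 b1 a1.
  have -> : 2 * ((2%:R * a * b ^+ 2) ^+ 2 * (4 * a * (rr ^- 4) ^+ 2)) +
    2 * ((2%:R * a ^+ 2 * b) ^+ 2 * (36 * b * a ^+ 4 * (4 * a * (rr ^- 4) ^+ 2))) =
    (32 * (a * b ^+ 2) + 2 * 24 ^+ 2 * (a ^+ 7 * b)) * (a ^+ 2 * b ^+ 2) * (rr ^- 4) ^+ 2 by ring.
  rewrite ler_wpM2r // -[c0 * _ * _]mulrA ler_wpM2r ?mulr_ge0 ?exprn_ge0 //.
  have ab : a * b ^+ 2 <= 1 by rewrite mulr_ile1 ?exprn_ile1 ?exprn_ge0.
  have a7 : a ^+ 7 * b <= 1 by rewrite mulr_ile1 ?exprn_ile1 ?exprn_ge0.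
  apply: le_trans n3; apply: lerD; first by apply: ler_piMr; rewrite ?ler0n.
  by apply: ler_piMr; rewrite // mulr_ge0 ?exprn_ge0 ?ler0n.
by move=> p /small ->; rewrite expr0n mul0r.
Qed.

End Radius.
End Cutoffs.

(** * Vanishing of the Jerison-Lee tensors *)

(** The linear arithmetic of [master_ineq] on plain reals: the [J] stand for divergences, the [i]
    for pairings with the gradients of the cutoffs. *)
Lemma weighted_sum (R : realType) (i0 i1 i2 i3 J0 J1 J2 J3 wr x0 y1 y2 a1 a2 N f L Q phi psi chi
    K kn C : R) :
  i0 = wr * x0 -> i1 = wr * (N * y1) -> i2 = wr * (f * y2) -> J1 = wr * a1 -> J2 = wr * a2 ->
  wr * Q * phi <= J0 * phi ->
  C * K ^+ 2 * kn * (chi * N) <= C * K ^+ 2 * kn * (- (J3 * chi + i3) + K / 2) ->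
  wr * (C * K ^+ 2 * (chi * N)) <= kn * (C * K ^+ 2 * (chi * N)) ->
  wr * (20 * K ^+ 3 * chi) <= kn * (20 * K ^+ 3) ->
  wr * (L * phi * Q) <= wr * ((phi * Q + x0) - 85 * K * (psi * a2 + f * y2)
    + 210 * K * (psi * a1 + N * y1) + C * K ^+ 2 * (chi * N) + 20 * K ^+ 3 * chi) ->
  L * phi * (wr * Q) <= (J0 * phi + i0) + - (85 * K) * (J2 * psi + i2)
    + 210 * K * (J1 * psi + i1) + - (C * K ^+ 2 * kn) * (J3 * chi + i3)
    + (C / 2 + 20) * (K ^+ 3 * kn).
Proof. by move=> -> -> -> -> -> *; lra. Qed.

Lemma parts_le (R : realType) (a b t P d B r : R) : 0 <= a -> 0 <= b -> 0 <= t -> 0 <= P ->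
  0 <= d -> 0 <= B -> P + 1 + (a + b + t + d) + B < r ->
  [/\ P + 1 <= r, a + b + t + d <= r & B <= r].
Proof. by split; lra. Qed.

Lemma window_le (R : realType) (a b t d r r2 : R) : 0 <= a -> 0 <= b -> 0 <= t -> 0 < r ->
  a + b + t + d <= r -> r <= r2 -> [/\ a + d <= 2 * r, b + d <= 2 * r & t + d <= 2 * r2].
Proof. by split; lra. Qed.

Lemma quarter_le (R : realType) (a b : R) : a / 2 <= b -> a / 8 <= 1 / 4 * 1 * b.
Proof. by lra. Qed.

Lemma quarter_contra (R : realType) (L g x : R) : 0 < L -> L <= g -> g <= L / 4 + x ->
  x <= L / 4 -> False.
Proof. by lra. Qed.

(** * The pointwise inequality and its consequence *)

Section Pointwise.
Variables (R : realType) (n : nat) (f E2 w : sm R n).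
Notation H := (Hn R n).
Notation c := (heis R n).
Hypotheses (sol : jl_sol c f E2) (cjf : cj f = f) (cjE2 : cj E2 = E2) (cjw : cj w = w).
Hypothesis wZ : forall a, Z c a w = (2%:R * n%:R - 2%:R) * w * Z c a f.
Hypothesis wZb : forall a, Zb c a w = (2%:R * n%:R - 2%:R) * w * Zb c a f.

Let cD := @sm_cjD R n.
Let cM := @sm_cjM R n.
Let c1 := sm_cj1 R n.
Let cI : cj (I c) = - I c := cj_ii R n.
Let cZ := @cj_Z R n.
Let cZb := @cj_Zb R n.
Let cT (x : sm R n) : cj (T c x) = T c (cj x) := cj_cder et x.

Lemma cj_im0 (F : sm R n) p : cj F = F -> im_ F p = 0.
Proof. by move=> /(congr1 (fun G => im_ G p)); rewrite im_cj; lra. Qed.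

Definition pv p a : cpx R := pr (Z c a f) p.
Definition vD p a : cpx R := pr (Dv c f a) p.
Definition vE p a : cpx R := pr (Ev c f E2 a) p.
Definition vG p a : cpx R := pr (Gv c f E2 a) p.
Definition f0 p : R := re_ (T c f) p.
Definition e2 p : R := re_ E2 p.
Definition nn p : R := ip (pv p) (pv p).
Definition T2 p : R := \sum_a (ip (fun b => pr (Dt c f a b) p) (fun b => pr (Dt c f a b) p)
  + ip (fun b => pr (Et c f E2 a b) p) (fun b => pr (Et c f E2 a b) p)).
(** The expansion of |G|^2 + |G + D|^2 + |G - E|^2. *)
Definition QQ p : R := 3 * ip (vG p) (vG p) + 2 * ip (vG p) (vD p) + ip (vD p) (vD p)
  - 2 * ip (vG p) (vE p) + ip (vE p) (vE p).

Lemma im_f0 p : im_ (T c f) p = 0.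
Proof. by apply: cj_im0; rewrite cT cjf. Qed.

Lemma im_e2 p : im_ E2 p = 0. Proof. exact: cj_im0. Qed.
Lemma im_w p : im_ w p = 0. Proof. exact: cj_im0. Qed.

Lemma re_nrm2 p : re_ (nrm2 c f) p = nn p.
Proof.
rewrite /nn /pv -re_dot_cj; congr (re_ _ p); apply: eq_bigr => a _.
by rewrite cZ cjf.
Qed.

Lemma im_nrm2 p : im_ (nrm2 c f) p = 0.
Proof. by apply: cj_im0; exact: (cj_nrm2 cD cM cZ cZb cjf). Qed.

Lemma re_ss p : re_ (ss c f E2) p = nn p + e2 p.
Proof. by rewrite /ss reD re_nrm2. Qed.

Lemma im_ss p : im_ (ss c f E2) p = 0.
Proof. by rewrite /ss imD im_nrm2 im_e2 addr0. Qed.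

Lemma re_nat (k : nat) p : re_ (k%:R : sm R n) p = k%:R.
Proof.
elim: k => [|k IH]; first by [].
by rewrite !mulrS reD IH.
Qed.

Lemma im_nat (k : nat) p : im_ (k%:R : sm R n) p = 0.
Proof.
elim: k => [|k IH]; first by [].
by rewrite !mulrS imD IH addr0.
Qed.

Lemma ii_cR : I c = ii R n. Proof. by []. Qed.

Lemma gg_re p : re_ (gg c f E2) p = nn p + e2 p /\ im_ (gg c f E2) p = - f0 p.
Proof.
rewrite /gg ii_cR reD imD reN imN reM imM re_ss im_ss im_f0 re_ii im_ii -/(f0 p).
by split; ring.
Qed.

Lemma gb_re p : re_ (gg (swap c) f E2) p = nn p + e2 p /\ im_ (gg (swap c) f E2) p = f0 p.
Proof.
have -> : gg (swap c) f E2 = ss c f E2 - (- ii R n * T c f) by rewrite /gg ss_swap.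
rewrite reD imD !reN !imN reM imM reN imN re_ss im_ss im_f0 re_ii im_ii -/(f0 p).
by split; ring.
Qed.

Lemma re_dotr (x y y' : 'I_n -> sm R n) p : (forall a, cj (y a) = y' a) ->
  re_ (dot x y') p = ip (fun a => pr (x a) p) (fun a => pr (y a) p).
Proof.
by move=> e; rewrite -re_dot_cj; congr (re_ _ p); apply: eq_bigr => a _; rewrite e.
Qed.

Lemma re_dotl (x y y' : 'I_n -> sm R n) p : (forall a, cj (y a) = y' a) ->
  re_ (dot y' x) p = ip (fun a => pr (x a) p) (fun a => pr (y a) p).
Proof. by rewrite dotC; exact: re_dotr. Qed.

Let eD := cj_Dv cD cM c1 cZ cZb cjf.
Let eE := cj_Ev cD cM c1 cI cZ cZb cT cjf cjE2.
Let eG := cj_Gv cD cM cI cZ cZb cT cjf cjE2.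
Let eJ := cj_JLfield cD cM c1 cI cZ cZb cT cjf cjE2 cjw.
Let eDt := cj_Dt cD cM c1 cZ cjf.
Let eEt := cj_Et cD cM c1 cI cZ cZb cT cjf cjE2.

(** [JLsquares] without the square of the 3-tensor. As an element of [sm] it gives the continuity of
    the integrand in [jerison_lee_vanish]. *)
Definition core : sm R n :=
  E2 * (\sum_a \sum_b Dt c f a b * Dt (swap c) f a b
             + \sum_a \sum_b Et c f E2 a b * Et (swap c) f E2 a b)
  + 3%:R * dot (Gv c f E2) (Gv (swap c) f E2)
  + (dot (Gv c f E2) (Dv (swap c) f) + dot (Dv c f) (Gv (swap c) f E2))
  + dot (Dv c f) (Dv (swap c) f)
  - (dot (Gv c f E2) (Ev (swap c) f E2) + dot (Ev c f E2) (Gv (swap c) f E2))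
  + dot (Ev c f E2) (Ev (swap c) f E2).

Lemma re_core p : re_ core p = e2 p * T2 p + QQ p.
Proof.
have gg := re_dotr (Gv c f E2) p eG; have gd := re_dotr (Gv c f E2) p eD.
have dg := re_dotr (Dv c f) p eG; have dd := re_dotr (Dv c f) p eD.
have ge := re_dotr (Gv c f E2) p eE; have eg := re_dotr (Ev c f E2) p eG.
have ee := re_dotr (Ev c f E2) p eE.
have tD : re_ (\sum_a \sum_b Dt c f a b * Dt (swap c) f a b) p =
    \sum_a ip (fun b => pr (Dt c f a b) p) (fun b => pr (Dt c f a b) p).
  by rewrite re_sum; apply: eq_bigr => a _; exact: (re_dotr _ _ (eDt a)).
have tE : re_ (\sum_a \sum_b Et c f E2 a b * Et (swap c) f E2 a b) p =
    \sum_a ip (fun b => pr (Et c f E2 a b) p) (fun b => pr (Et c f E2 a b) p).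
  by rewrite re_sum; apply: eq_bigr => a _; exact: (re_dotr _ _ (eEt a)).
rewrite /core 6!reD reN reD.
rewrite [re_ (E2 * _) p]reM im_e2 mul0r subr0 reD tD tE [re_ (3%:R * _) p]reM.
rewrite re_nat im_nat mul0r subr0 gg gd dg dd ge eg ee -big_split /= -/(T2 p).
rewrite -/(vG p) -/(vD p) -/(vE p) /QQ (ipC (vD p) (vG p)) (ipC (vE p) (vG p)).
rewrite /e2; ring.
Qed.

Lemma re_JLsquares p : e2 p * T2 p + QQ p <= re_ (JLsquares f E2 c) p.
Proof.
rewrite -re_core; set S := \sum_a \sum_b \sum_d (Dt c f a b * Zb c d f + Et c f E2 a d * Z c b f)
    * (Dt (swap c) f a b * Z c d f + Et (swap c) f E2 a d * Zb c b f).
have -> : JLsquares f E2 c = core + S.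
  by rewrite JLsquares_tensor -/S /core; move: S => S; rewrite -!addrA; congr (_ + _);
     rewrite addrC -!addrA.
have : 0 <= re_ S p.
  rewrite /S re_sum; apply: sumr_ge0 => a _; rewrite re_sum; apply: sumr_ge0 => b _.
  rewrite re_sum; apply: sumr_ge0 => d _.
  have -> : Dt (swap c) f a b * Z c d f + Et (swap c) f E2 a d * Zb c b f =
      cj (Dt c f a b * Zb c d f + Et c f E2 a d * Z c b f).
    by rewrite cD !cM eDt eEt cZ cZb cjf.
  by rewrite reM re_cj im_cj mulrN opprK addr_ge0 // -expr2 sqr_ge0.
by rewrite reD lerDl.
Qed.

Lemma re_div_JL p : 0 <= re_ w p -> re_ w p * (e2 p * T2 p + QQ p) <=
  re_ (\sum_a Zb c a (JLfield f E2 w c a)) p.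
Proof.
move=> w0; have := congr1 (fun F => re_ F p) (jerison_lee sol wZ wZb).
have -> : \sum_a Z c a (JLfield f E2 w (swap c) a) = cj (\sum_a Zb c a (JLfield f E2 w c a)).
  by rewrite (cj_sum cD); apply: eq_bigr => a _; rewrite cZb eJ.
rewrite [LHS]reD re_cj reM [re_ (_ * w) p]reM [im_ (_ * w) p]imM re_nat im_nat im_w.
rewrite !(mul0r, mulr0) addr0 !subr0 mul0r subr0 => e.
have H := ler_wpM2l w0 (re_JLsquares p).
by move: H e; set X := re_ (\sum_a _) p; set y := re_ (JLsquares _ _ _) p; lra.
Qed.

Lemma re_div_grad4 p : re_ (\sum_a Zb c a (w * nrm2 c f * Z c a f)) p =
  re_ w p * ((n%:R - 1) * nn p ^+ 2 + ip (vD p) (pv p) + ip (vE p) (pv p)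
    - (n%:R + 1) * e2 p * nn p).
Proof.
rewrite (div_grad4 sol wZb) reM im_w mul0r subr0; congr (_ * _).
have dp : re_ (dot (Dv (swap c) f) (Z c ^~ f)) p = ip (vD p) (pv p).
  by rewrite (re_dotl _ _ eD) ipC.
have ep : re_ (dot (Ev (swap c) f E2) (Z c ^~ f)) p = ip (vE p) (pv p).
  by rewrite (re_dotl _ _ eE) ipC.
have [gg1 _] := gb_re p; have [gg2 _] := gg_re p.
have := im_e2 p; have := im_nrm2 p; have := re_nrm2 p; rewrite /e2 in gg1 gg2 *.
move: gg1 gg2 dp ep; move: (dot _ _) (dot _ _) (gg (swap c) f E2) (gg c f E2) (nrm2 c f).
move: E2 => e d1 d2 g1 g2 N gg1 gg2 dp ep nr ni im0.
rewrite !(re_nat, im_nat, reM, imM, reD, imD, reN, imN) dp ep gg1 gg2 nr ni im0; ring.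
Qed.

Lemma re_div_gradT p : re_ (\sum_a Zb c a (w * (I c * T c f) * Z c a f)) p =
  re_ w p * ((nn p + e2 p) * nn p - ip (vG p) (pv p) - n%:R * f0 p ^+ 2).
Proof.
rewrite (div_gradT sol wZb) reM im_w mul0r subr0; congr (_ * _).
have gp : re_ (dot (Gv (swap c) f E2) (Z c ^~ f)) p = ip (vG p) (pv p).
  by rewrite (re_dotl _ _ eG) ipC.
have [gg1 gg3] := gb_re p; have [gg4 gg2] := gg_re p.
have := im_f0 p; have := im_nrm2 p; have := re_nrm2 p; have := re_ii p; have := im_ii p.
rewrite ii_cR /f0 in gg1 gg2 gg3 gg4 *.
move: gg1 gg2 gg3 gg4 gp; move: (dot _ _) (gg (swap c) f E2) (gg c f E2) (nrm2 c f) (T c f) (ii R n).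
move=> d1 g1 g2 N t i gg1 gg2 gg3 gg4 gp i1 i2 nr ni t0.
rewrite !(re_nat, im_nat, reM, imM, reD, imD, reN, imN) gp gg1 gg2 gg3 gg4 nr ni i1 i2 t0; ring.
Qed.

Lemma re_div_grad p : re_ (\sum_a Zb c a (Z c a f)) p = - n%:R * (nn p + e2 p).
Proof.
rewrite (jl_eq sol) reM reN imN re_nat im_nat.
by rewrite -/(gg c f E2) (gg_re p).1; ring.
Qed.

Lemma QQ_ge p : ip (vG p) (vG p) + ip (vD p) (vD p) + ip (vE p) (vE p) <= 5 * QQ p.
Proof.
(* 25/4 of each square matches the cross terms and uses 25/2 of the 14 |G|^2 available in the
   difference of the two sides. *)
have h1 := ip_ge0 (fun a => cadd (cscale (4 / 5) (vD p a)) (vG p a)).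
have h2 := ip_ge0 (fun a => cadd (cscale (- (4 / 5)) (vE p a)) (vG p a)).
have h3 := ip_ge0 (vG p).
rewrite !ip_expand in h1 h2; rewrite /QQ (ipC (vG p) (vD p)) (ipC (vG p) (vE p)).
move: h1 h2 h3; move: (ip _ _) (ip _ _) (ip _ _) (ip _ _) (ip _ _) => x1 x2 x3 x4 x5.
lra.
Qed.

Definition V1 a := w * nrm2 c f * Z c a f.
Definition V2 a := w * (I c * T c f) * Z c a f.
Definition V3 a := Z c a f.

Lemma re_div_V1 p : re_ (\sum_a Zb c a (V1 a)) p =
  re_ w p * ((n%:R - 1) * nn p ^+ 2 + ip (vD p) (pv p) + ip (vE p) (pv p)
    - (n%:R + 1) * e2 p * nn p).
Proof. exact: re_div_grad4. Qed.

Lemma re_div_V2 p : re_ (\sum_a Zb c a (V2 a)) p =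
  re_ w p * ((nn p + e2 p) * nn p - ip (vG p) (pv p) - n%:R * f0 p ^+ 2).
Proof. exact: re_div_gradT. Qed.

Lemma pr_nat (k : nat) p : pr (k%:R : sm R n) p = (k%:R, 0).
Proof. by rewrite /pr re_nat im_nat. Qed.

Lemma pr_N (F : sm R n) p : pr (- F) p = cneg (pr F p).
Proof. by rewrite /pr reN imN. Qed.

Lemma pr_JLfield p a : pr (JLfield f E2 w c a) p = cscale (re_ w p)
  (cadd (cadd (cmul (nn p + e2 p, 2 * f0 p) (vE p a))
              (cmul (nn p + e2 p, - (2 * f0 p)) (vD p a)))
        (cmul (0, - (3 * f0 p)) (vG p a))).
Proof.
have pw : pr w p = (re_ w p, 0) by rewrite /pr im_w.
have ps : pr (ss c f E2) p = (nn p + e2 p, 0) by rewrite /pr re_ss im_ss.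
have pt : pr (T c f) p = (f0 p, 0) by rewrite /pr im_f0.
have pi : pr (I c) p = (0, 1) by rewrite ii_cR /pr re_ii im_ii.
move: ps pt pi pw; rewrite /JLfield /vE /vD /vG.
move: (Ev c f E2 a) (Dv c f a) (Gv c f E2 a) (ss c f E2) (T c f) (I c).
move: (re_ w p) (nn p) (e2 p) (f0 p) => wr N e t E D G S t' i ps pt pi pw.
rewrite pr_M pw pr_D pr_D pr_N !pr_M !pr_nat !pr_D pr_N !pr_M !pr_nat ps pt pi.
move: (pr E p) (pr D p) (pr G p) => [e1 e2'] [d1 d2] [g1 g2].
by rewrite /cscale /cadd /cmul /cneg /=; congr (_, _); ring.
Qed.

Lemma ip_V0 p g : ip (fun a => pr (JLfield f E2 w c a) p) g = re_ w p *
  (ip (vE p) (fun a => cmul (cconj (nn p + e2 p, 2 * f0 p)) (g a))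
   + ip (vD p) (fun a => cmul (cconj (nn p + e2 p, - (2 * f0 p))) (g a))
   + ip (vG p) (fun a => cmul (cconj (0, - (3 * f0 p))) (g a))).
Proof.
rewrite -!ip_cmul -!ipDl -ipZl /ip.
by apply: eq_bigr => a _; rewrite pr_JLfield.
Qed.

Lemma ip_V1 p g : ip (fun a => pr (V1 a) p) g = re_ w p * (nn p * ip (pv p) g).
Proof.
rewrite /ip !mulr_sumr; apply: eq_bigr => a _.
rewrite /V1 /pv pr_M; move: (pr (Z c a f) p) => z.
rewrite /pr reM imM re_nrm2 im_nrm2 im_w /=; ring.
Qed.

Lemma ip_V2 p g : ip (fun a => pr (V2 a) p) g =
  re_ w p * (f0 p * ip (fun a => cmul (0, 1) (pv p a)) g).
Proof.
rewrite /ip !mulr_sumr; apply: eq_bigr => a _.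
rewrite /V2 /pv pr_M; move: (pr (Z c a f) p) => z.
rewrite /pr !(reM, imM) ii_cR re_ii im_ii im_f0 im_w -/(f0 p) /=; ring.
Qed.

Lemma T2_ge0 p : 0 <= T2 p.
Proof. by apply: sumr_ge0 => a _; rewrite addr_ge0 ?ip_ge0. Qed.

Lemma nn_ge0 p : 0 <= nn p. Proof. exact: ip_ge0. Qed.

Lemma QQ_ge0 p : 0 <= QQ p.
Proof.
have := QQ_ge p; have := ip_ge0 (vG p); have := ip_ge0 (vD p); have := ip_ge0 (vE p).
lra.
Qed.

Section Estimate.
Variables (p : H) (phi psi chi K eps einv : R) (gphi gpsi gchi : 'I_n -> cpx R).
Hypotheses (n2 : (2 <= n)%N) (phi0 : 0 <= phi) (psi0 : 0 <= psi) (psichi : psi <= chi)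
  (chi1 : chi <= 1) (psi2 : psi ^+ 2 <= phi * chi) (K0 : 0 < K)
  (eps0 : 0 < eps) (epsV : einv = eps^-1) (eps1 : 525 * eps <= 1 / 2)
  (hphi : ip gphi gphi <= phi * (K * psi)) (hpsi : ip gpsi gpsi <= psi * (K * chi))
  (hchi : ip gchi gchi <= chi * K)
  (w0 : 0 <= re_ w p) (e20 : 0 <= e2 p) (e2K : chi != 0 -> e2 p <= K)
  (wK : chi != 0 -> re_ w p <= K ^+ n.-1).

Let chi0 : 0 <= chi. Proof. exact: le_trans psichi. Qed.
Let N0 := nn_ge0 p.

Lemma bound_cmul (x : 'I_n -> cpx R) d :
  2 * `|ip x (fun a => cmul (cconj d) (gphi a))| <=
  1 / 10 * phi * ip x x + 10 * ((d.1 ^+ 2 + d.2 ^+ 2) * (K * psi)).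
Proof.
have m0 : 0 <= (d.1 ^+ 2 + d.2 ^+ 2) * (K * psi).
  by rewrite mulr_ge0 ?addr_ge0 ?sqr_ge0 // mulr_ge0 // ltW.
have e0 : 0 < 1 / 10 :> R by lra.
have H : ip (fun a => cmul (cconj d) (gphi a)) (fun a => cmul (cconj d) (gphi a)) <=
    phi * ((d.1 ^+ 2 + d.2 ^+ 2) * (K * psi)).
  rewrite nn_cmul /= sqrrN mulrCA ler_wpM2l ?addr_ge0 ?sqr_ge0 //.
apply: (le_trans (ip_bound x phi0 m0 e0 H)); rewrite lerD2l.
by rewrite div1r invrK mulrC.
Qed.

(** psi^2 <= phi chi is used here: the tensor keeps the cutoff phi, with a small factor eps, while
    |df|^2 receives chi. *)
Lemma bound_lin (x : 'I_n -> cpx R) :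
  2 * `|K * psi * ip x (pv p)| <= eps * phi * ip x x + K ^+ 2 * chi * nn p * einv.
Proof.
have m0 : 0 <= K ^+ 2 * chi * nn p.
  by apply: mulr_ge0; [apply: mulr_ge0; [exact: sqr_ge0|exact: chi0]|exact: N0].
have H : ip (fun a => cscale (K * psi) (pv p a)) (fun a => cscale (K * psi) (pv p a)) <=
    phi * (K ^+ 2 * chi * nn p).
  rewrite ipZl ipC ipZl -/(nn p).
  have -> : K * psi * (K * psi * nn p) = psi ^+ 2 * (K ^+ 2 * nn p) by ring.
  have -> : phi * (K ^+ 2 * chi * nn p) = phi * chi * (K ^+ 2 * nn p) by ring.
  by rewrite ler_wpM2r // mulr_ge0 ?sqr_ge0.
by have := ip_bound x phi0 m0 eps0 H; rewrite ipC ipZl ipC epsV.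
Qed.

(** Coefficient of K^2 chi |df|^2 in [estimate]: (85 + 2 * 210) / 2 <= 253 from the products of df
    with the tensors, and 210 n + 500 for the terms in e^(2f) |df|^2 and the gradient of psi. *)
Definition bigC : R := 253 * einv + 300 + 210 * n%:R + 200.

(* The multiples 85 K of the V2-identity and 210 K of the V1-identity dominate the terms in f0^2 and
   |df|^4 left by the cutoff; what they contribute in D, E, G is at most 210 eps (5/2) QQ. *)
Lemma estimate :
  1 / 4 * phi * (e2 p * T2 p + QQ p) <=
  (phi * (e2 p * T2 p + QQ p)
    + (ip (vE p) (fun a => cmul (cconj (nn p + e2 p, 2 * f0 p)) (gphi a))
     + ip (vD p) (fun a => cmul (cconj (nn p + e2 p, - (2 * f0 p))) (gphi a))
     + ip (vG p) (fun a => cmul (cconj (0, - (3 * f0 p))) (gphi a))))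
  - 85 * K * (psi * ((nn p + e2 p) * nn p - ip (vG p) (pv p) - n%:R * f0 p ^+ 2)
     + f0 p * ip (fun a => cmul (0, 1) (pv p a)) gpsi)
  + 210 * K * (psi * ((n%:R - 1) * nn p ^+ 2 + ip (vD p) (pv p) + ip (vE p) (pv p)
      - (n%:R + 1) * e2 p * nn p) + nn p * ip (pv p) gpsi)
  + bigC * K ^+ 2 * (chi * nn p) + 20 * K ^+ 3 * chi.
Proof.
rewrite /bigC; have bE := bound_cmul (vE p) (nn p + e2 p, 2 * f0 p).
have bD := bound_cmul (vD p) (nn p + e2 p, - (2 * f0 p)).
have bG := bound_cmul (vG p) (0, - (3 * f0 p)).
have lG := bound_lin (vG p); have lD := bound_lin (vD p); have lE := bound_lin (vE p).
have b1 : 2 * (nn p * `|ip (pv p) gpsi|) <= psi * nn p ^+ 2 + K * chi * nn p.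
  have Kc : 0 <= K * chi by rewrite mulr_ge0 // ltW.
  have := ip_bound (pv p) psi0 Kc ltr01 hpsi; rewrite -/(nn p) mul1r divr1 => h.
  have -> : 2 * (nn p * `|ip (pv p) gpsi|) = 2 * `|ip (pv p) gpsi| * nn p by ring.
  have -> : psi * nn p ^+ 2 + K * chi * nn p = (psi * nn p + K * chi) * nn p by ring.
  exact: ler_wpM2r.
have b2 : 2 * `|f0 p * ip (fun a => cmul (0, 1) (pv p a)) gpsi| <=
    2 * psi * f0 p ^+ 2 + nn p * (K * chi) / 2.
  apply: amgm_cutoff => //; first by rewrite mulr_ge0 ?N0 // mulr_ge0 ?chi0 // ltW.
  apply: (le_trans (ip_CS _ _)).
  rewrite nn_cmul /= expr0n expr1n add0r mul1r mulrCA; exact: ler_wpM2l.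
have Qge := QQ_ge p; have Q0 := QQ_ge0 p; have T0 := T2_ge0 p.
have eN : psi * e2 p * nn p <= K * chi * nn p.
  apply: ler_wpM2r => //; have [c0|c0] := eqVneq chi 0.
    have -> : psi = 0 by apply/eqP; rewrite eq_le psi0 -c0 psichi.
    by rewrite c0 mul0r mulr0.
  by rewrite mulrC ler_pM ?e2K.
have ee : psi * e2 p ^+ 2 <= K ^+ 2 * chi.
  have [c0|c0] := eqVneq chi 0.
    have -> : psi = 0 by apply/eqP; rewrite eq_le psi0 -c0 psichi.
    by rewrite c0 mul0r mulr0.
  by rewrite mulrC ler_pM ?exprn_ge0 // lerXn2r ?nnegrE ?e2K // ltW.
have phiQ : eps * phi * (ip (vG p) (vG p) + ip (vD p) (vD p) + ip (vE p) (vE p)) <=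
   eps * phi * (5 * QQ p) by rewrite ler_wpM2l // mulr_ge0 // ltW.
have phiQ' : phi * (ip (vG p) (vG p) + ip (vD p) (vD p) + ip (vE p) (vE p)) <=
   phi * (5 * QQ p) by rewrite ler_wpM2l.
have epsQ : 525 * eps * (phi * QQ p) <= 1 / 2 * (phi * QQ p).
  by rewrite ler_wpM2r // mulr_ge0.
have [gG gD gE] : [/\ 0 <= eps * phi * ip (vG p) (vG p),
  0 <= eps * phi * ip (vD p) (vD p) & 0 <= eps * phi * ip (vE p) (vE p)].
  by split; rewrite mulr_ge0 ?ip_ge0 // mulr_ge0 // ltW.
have eT : 0 <= phi * (e2 p * T2 p) by rewrite mulr_ge0 // mulr_ge0.
have K0' := ltW K0; have n2' : 2 <= n%:R :> R by rewrite (ler_nat R 2 n).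
have einv0 : 0 <= einv by rewrite epsV invr_ge0 ltW.
have Kpsi : 0 <= K * psi by rewrite mulr_ge0.
have kb1 := ler_wpM2l K0' b1; have kb2 := ler_wpM2l K0' b2.
have keN := ler_wpM2l K0' eN; have kee := ler_wpM2l K0' ee.
have kn0 : 0 <= n%:R * K by rewrite mulr_ge0.
have nkeN := ler_wpM2l kn0 eN.
(* This square bounds 10 (|df|^2 + e^(2f))^2 by 20 |df|^4 + 20 e^(4f). For n = 2 the coefficients of
   K psi |df|^4 balance as 20 + 85 + 105 = 210, those of K psi f_0^2 as (40 + 45) + 85 = 2 * 85;
   [A1] and [A3] cover larger n. QQ loses 1/4 to [bound_cmul] and 1/2 to [bound_lin], which leaves
   1/4. *)
have sq : 0 <= K * psi * (nn p - e2 p) ^+ 2 by rewrite mulr_ge0 ?sqr_ge0.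
have A1 : 0 <= (n%:R - 2) * (K * psi * nn p ^+ 2).
  by rewrite mulr_ge0 ?subr_ge0 // mulr_ge0 ?sqr_ge0.
have A3 : 0 <= (n%:R - 2) * (K * psi * f0 p ^+ 2).
  by rewrite mulr_ge0 ?subr_ge0 // mulr_ge0 ?sqr_ge0.
have A3' : 0 <= K * psi * f0 p ^+ 2 by rewrite mulr_ge0 ?sqr_ge0.
have B0 : 0 <= K ^+ 2 * chi * nn p * einv.
  by apply: mulr_ge0 => //; apply: mulr_ge0 => //; apply: mulr_ge0 => //; exact: sqr_ge0.
have B1 : 0 <= K ^+ 2 * chi * nn p.
  by apply: mulr_ge0 => //; apply: mulr_ge0 => //; exact: sqr_ge0.
have nE x : - `|x| <= x :> R by rewrite lerNl -normrN ler_norm.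
have nE' x : x <= `|x| :> R by exact: ler_norm.
have := nE (ip (vE p) (fun a => cmul (cconj (nn p + e2 p, 2 * f0 p)) (gphi a))).
have := nE (ip (vD p) (fun a => cmul (cconj (nn p + e2 p, - (2 * f0 p))) (gphi a))).
have := nE (ip (vG p) (fun a => cmul (cconj (0, - (3 * f0 p))) (gphi a))).
have := nE' (K * psi * ip (vG p) (pv p)); have := nE (K * psi * ip (vG p) (pv p)).
have := nE (K * psi * ip (vD p) (pv p)); have := nE (K * psi * ip (vE p) (pv p)).
have := ler_wpM2l K0' (nE' (f0 p * ip (fun a => cmul (0, 1) (pv p a)) gpsi)).
have := ler_wpM2l (mulr_ge0 K0' N0) (nE (ip (pv p) gpsi)).
rewrite /= in bE bD bG.
move: bE bD bG lG lD lE kb1 kb2 phiQ phiQ' epsQ gG gD gE eT kee keN nkeN sq A1 A3 A3' B0 B1.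
clear b1 b2 eN ee Qge Q0 T0 kn0 Kpsi einv0 n2' K0' nE nE'.
move: (ip (vG p) (vG p)) (ip (vD p) (vD p)) (ip (vE p) (vE p)) => G D E.
move: (ip (vE p) (fun _ => _)) (ip (vD p) (fun _ => _)) (ip (vG p) (fun _ => _)) => xE xD xG.
move: (ip (vG p) (pv p)) (ip (vD p) (pv p)) (ip (vE p) (pv p)) => q d e'.
move: (ip (fun _ => _) gpsi) (ip (pv p) gpsi) (nn p) (e2 p) (f0 p) (QQ p) (T2 p) => y2 y1 N e ft Q T'.
move: (n%:R) => m.
move: (`|xE|) (`|xD|) (`|xG|) (`|K * psi * q|) (`|K * psi * d|) (`|K * psi * e'|) (`|ft * y2|) (`|y1|).
move=> aE aD aG aq ad ae ay2 ay1.
intros; lra.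
Qed.

(** The divergence gives n chi (|df|^2 + e^(2f)) with n >= 2; Young's inequality for the gradient of
    chi takes chi |df|^2 / 2 and K / 2. *)
Lemma estimate_grad : chi * nn p <=
  - (re_ (\sum_a Zb c a (V3 a)) p * chi + ip (fun a => pr (V3 a) p) gchi) + K / 2.
Proof.
rewrite /V3 re_div_grad.
have -> : ip (fun a => pr (Z c a f) p) gchi = ip (pv p) gchi by [].
have := ip_bound (pv p) chi0 (ltW K0) ltr01 hchi; rewrite -/(nn p) mul1r divr1.
have n2' : 2 <= n%:R :> R by rewrite (ler_nat R 2 n).
have h1 : 0 <= (n%:R - 2) * (chi * nn p) by rewrite mulr_ge0 ?subr_ge0 // mulr_ge0.
have h2 : 0 <= n%:R * (chi * e2 p) by rewrite mulr_ge0 // mulr_ge0.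
have h3 : 0 <= chi * nn p by rewrite mulr_ge0.
move: (ler_norm (ip (pv p) gchi)); move: (ip (pv p) gchi) => y2; move: (`|y2|) => y1 *.
lra.
Qed.

(** [estimate] times the weight w. Where chi is nonzero w <= K^(n-1), so the unweighted divergence
    of f_a can absorb what remains of chi |df|^2. *)
Lemma master_ineq :
  1 / 4 * phi * (re_ w p * (e2 p * T2 p + QQ p)) <=
  (re_ (\sum_a Zb c a (JLfield f E2 w c a)) p * phi
    + ip (fun a => pr (JLfield f E2 w c a) p) gphi)
  + - (85 * K) * (re_ (\sum_a Zb c a (V2 a)) p * psi + ip (fun a => pr (V2 a) p) gpsi)
  + 210 * K * (re_ (\sum_a Zb c a (V1 a)) p * psi + ip (fun a => pr (V1 a) p) gpsi)
  + - (bigC * K ^+ 2 * K ^+ n.-1) *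
      (re_ (\sum_a Zb c a (V3 a)) p * chi + ip (fun a => pr (V3 a) p) gchi)
  + (bigC / 2 + 20) * (K ^+ 3 * K ^+ n.-1).
Proof.
have C0 : 0 <= bigC.
  have : 0 <= einv by rewrite epsV invr_ge0 ltW.
  have : 0 <= n%:R :> R by exact: ler0n.
  by rewrite /bigC; lra.
have K0' := ltW K0.
have JL := ler_wpM2r phi0 (re_div_JL w0).
have := ler_wpM2l w0 estimate.
have g3 := estimate_grad.
have wchi x : 0 <= x -> re_ w p * (x * chi) <= K ^+ n.-1 * (x * chi).
  move=> x0; have [->|c0] := eqVneq chi 0; first by rewrite mulr0 !mulr0.
  by rewrite ler_wpM2r ?wK // mulr_ge0.
have h1 : re_ w p * (bigC * K ^+ 2 * (chi * nn p)) <= K ^+ n.-1 * (bigC * K ^+ 2 * (chi * nn p)).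
  have -> : bigC * K ^+ 2 * (chi * nn p) = (bigC * K ^+ 2 * nn p) * chi by ring.
  apply: wchi; apply: mulr_ge0 => //; apply: mulr_ge0 => //; exact: sqr_ge0.
have h2 : re_ w p * (20 * K ^+ 3 * chi) <= K ^+ n.-1 * (20 * K ^+ 3).
  apply: (le_trans (wchi _ _)); first by rewrite mulr_ge0 ?exprn_ge0.
  by rewrite ler_wpM2l ?exprn_ge0 // ler_piMr // mulr_ge0 ?exprn_ge0.
have M0 : 0 <= bigC * K ^+ 2 * K ^+ n.-1 by rewrite !mulr_ge0 ?exprn_ge0.
have g4 := ler_wpM2l M0 g3.
move=> H; exact: (weighted_sum (ip_V0 p gphi) (ip_V1 p gpsi) (ip_V2 p gpsi) (re_div_V1 p)
  (re_div_V2 p) JL g4 h1 h2 H).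
Qed.

End Estimate.

Lemma small_factor (m : nat) : exists2 eps : R, 0 < eps & m%:R * eps <= 1 / 2.
Proof.
exists ((1 / 2) / m.+1%:R); first by rewrite divr_gt0 ?divr_gt0.
by rewrite mulrCA ler_piMr ?divr_ge0 // ler_pdivrMr // mul1r ler_nat.
Qed.

Lemma nbhs_cube (p0 : H) (A : set H) : nbhs p0 A -> exists2 d : R, 0 < d &
  forall p, (forall j, `|hx p 0 j - hx p0 0 j| <= d) ->
    (forall j, `|hy p 0 j - hy p0 0 j| <= d) -> `|ht p - ht p0| <= d -> A p.
Proof.
move=> /nbhs_ballP[d' /= d0 H]; exists (d' / 2); first by rewrite divr_gt0.
have dd : d' / 2 < d' by rewrite ltr_pdivrMr // ltr_pMr // ltr1n.
move=> p hx hy ht; apply: H; split; first split.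
- by split=> // i j; rewrite ord1 /ball /= distrC (le_lt_trans (hx j)).
- by split=> // i j; rewrite ord1 /ball /= distrC (le_lt_trans (hy j)).
- by rewrite /ball /= distrC (le_lt_trans ht).
Qed.

(** Were the nonnegative continuous integrand positive at p0, its grid sums would stay above a fixed
    L for all large r, while the divergences tend to 0 with the mesh and leave an error B / r^2. *)
Lemma jerison_lee_vanish (C1 : R) : (2 <= n)%N -> 0 <= C1 ->
  (forall p, 0 <= e2 p) -> (forall p, re_ w p = e2 p ^+ n.-1) ->
  (forall (r : nat) p, (0 < r)%N -> r%:R ^+ 4 <= Pn p -> e2 p <= C1 / r%:R ^+ 2) ->
  forall p, re_ w p * (e2 p * T2 p + QQ p) = 0.
Proof.
move=> n2 C10 e20 wE dec p0.
have w0 p : 0 <= re_ w p by rewrite wE exprn_ge0.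
pose F0 p := re_ w p * (e2 p * T2 p + QQ p).
have F00 p : 0 <= F0 p.
  by rewrite mulr_ge0 // addr_ge0 ?mulr_ge0 ?T2_ge0 ?QQ_ge0.
have cF0 : continuous F0.
  have -> : F0 = fun p => re_ w p * re_ core p by apply/funext => p; rewrite re_core.
  exact: (@CkM R n 0 _ _ (smooth_re w 0%N) (smooth_re core 0%N)).
apply/eqP; rewrite eq_le F00 andbT leNgt; apply/negP; rewrite -/(F0 p0) => Fp.
have [d d0 Hd] : exists2 d : R, 0 < d & forall p, (forall j, `|hx p 0 j - hx p0 0 j| <= d) ->
    (forall j, `|hy p 0 j - hy p0 0 j| <= d) -> `|ht p - ht p0| <= d ->
    F0 p0 / 2 <= F0 p /\ Pn p <= Pn p0 + 1.
  apply: nbhs_cube; apply: filterI.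
    have F2 : F0 p0 / 2 < F0 p0 by rewrite ltr_pdivrMr // ltr_pMr // ltr1n.
    by have := cF0 p0 => /cvgr_gt/(_ _ F2); apply: filterS => p /ltW.
  have cP : continuous (@Pn R n) by apply: smooth_continuous; exact: smooth_Pn.
  have P1 : Pn p0 < Pn p0 + 1 by rewrite ltrDl.
  by have := cP p0 => /cvgr_lt/(_ _ P1); apply: filterS => p /ltW.
(* 1/4 comes from [master_ineq] and 1/2 from continuity near p0. *)
pose g0 := F0 p0 / 8; have g00 : 0 < g0 by rewrite divr_gt0.
pose L := g0 * d ^+ n.*2.+1; have L0 : 0 < L by rewrite mulr_gt0 // exprn_gt0.
have [eps eps0 eps1] := small_factor 525.
pose einv := eps^-1.
pose C := bigC einv.
have C0 : 0 <= C.
  have h1 : 0 <= einv by rewrite invr_ge0 ltW.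
  have h2 : 0 <= n%:R :> R by exact: ler0n.
  by rewrite /C /bigC; lra.
(* One constant for both roles of K: the gradients of the cutoffs and the bound of e^(2f). *)
pose kap : R := 15 ^+ 3 * 16 + C1.
have kap0 : 0 < kap by rewrite ltr_wpDr // mulr_gt0 ?exprn_gt0 ?ltr0n.
pose B := (C / 2 + 20) * kap ^+ n.+2 * 5 ^+ n.*2.+1.
have B0 : 0 <= B.
  have h : 0 <= C / 2 + 20 by lra.
  by rewrite /B mulr_ge0 ?exprn_ge0 ?ler0n // mulr_ge0 // exprn_ge0 // ltW.
(* The three groups make phi equal to 1 near p0, keep the cube around p0 in the box, and push the
   error below L / 4. *)
pose X := (Pn p0 + 1) + (\sum_j `|hx p0 0 j| + \sum_j `|hy p0 0 j| + `|ht p0| + d) + B / (L / 4).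
have [s1 s2] : 0 <= \sum_j `|hx p0 0 j| /\ 0 <= \sum_j `|hy p0 0 j|.
  by split; apply: sumr_ge0.
have Pp := Pn_ge0 p0; have t0 := normr_ge0 (ht p0).
have BL : 0 <= B / (L / 4) by rewrite divr_ge0 // divr_ge0 // ltW.
have X0 : 0 <= X by rewrite /X; lra.
pose r := (Num.truncn X).+1.
have r0 : (0 < r)%N by [].
have rX : X < r%:R by have /truncn_itv/andP[] := X0.
have [rP rS rB] : [/\ Pn p0 + 1 <= r%:R,
    \sum_j `|hx p0 0 j| + \sum_j `|hy p0 0 j| + `|ht p0| + d <= r%:R &
    B / (L / 4) <= r%:R].
  exact: (parts_le s1 s2 t0 Pp (ltW d0) BL rX).
have rr0 : 0 < r%:R :> R by rewrite ltr0n.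
have r1 : 1 <= r%:R :> R by rewrite ler1n.
have rk k : r%:R <= r%:R ^+ k.+1 :> R by rewrite exprS ler_peMr ?exprn_ege1 // ltW.
have [phi [psi [chi [[cphi cpsi cchi] phi1 cut grd chi0]]]] := cutoff_facts R n r0.
pose K := kap / r%:R ^+ 2.
have K0 : 0 < K by rewrite divr_gt0 ?exprn_gt0.
have KK : 15 ^+ 3 * (16 / r%:R ^+ 2) <= K.
  by rewrite mulrA /K ler_wpM2r ?invr_ge0 ?exprn_ge0 ?ler0n // /kap lerDl.
have C1K : C1 / r%:R ^+ 2 <= K.
  rewrite /K ler_wpM2r ?invr_ge0 ?exprn_ge0 ?ler0n // /kap lerDr.
  by rewrite mulr_ge0 ?exprn_ge0 ?ler0n.
have e2K p : chi p != 0 -> e2 p <= K.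
  move=> c0; apply: le_trans C1K; apply: dec => //.
  by rewrite leNgt; apply: contra_neqN c0 => /ltW; exact: chi0.
have wK p : chi p != 0 -> re_ w p <= K ^+ n.-1.
  by move=> c0; rewrite wE lerXn2r ?nnegrE ?e2K // ltW.
pose Df V (ct : H -> R) p := re_ (\sum_a Zb c a (V a)) p * ct p + ip (fun a => pr (V a) p) (gr ct p).
have master p : 1 / 4 * phi p * F0 p <= Df (JLfield f E2 w c) phi p
    + - (85 * K) * Df V2 psi p + 210 * K * Df V1 psi p
    + - (C * K ^+ 2 * K ^+ n.-1) * Df V3 chi p + (C / 2 + 20) * (K ^+ 3 * K ^+ n.-1).
  have [ph0 ps0 pc c1' p2] := cut p; have [b1 b2 b3] := grd p.
  apply: (@master_ineq p (phi p) (psi p) (chi p) K eps einv) => //.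
  - by apply: (le_trans b1); rewrite ler_wpM2l // ler_wpM2r.
  - by apply: (le_trans b2); rewrite ler_wpM2l // ler_wpM2r // (le_trans ps0).
  - by apply: (le_trans b3); rewrite ler_wpM2l // (le_trans ps0).
  - exact: e2K.
  - exact: wK.
have van := gvanD (gvanD (gvanD (gvan_div r0 (JLfield f E2 w c) cphi)
    (gvanZ (- (85 * K)) (gvan_div r0 V2 cpsi))) (gvanZ (210 * K) (gvan_div r0 V1 cpsi)))
    (gvanZ (- (C * K ^+ 2 * K ^+ n.-1)) (gvan_div r0 V3 cchi)).
have L40 : 0 < L / 4 by rewrite divr_gt0.
have [N1 HN1] := van _ L40.
have phi0 p : 0 <= phi p by have [] := cut p.
have [N2 HN2] : exists N0 : nat, forall N, (N0 < N)%N ->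
    g0 * d ^+ n.*2.+1 <= gsum r N (fun p => 1 / 4 * phi p * F0 p).
  apply: (@gsum_lower R n r r0 p0 d g0) => //; first exact: ltW.
  - by move=> p; rewrite mulr_ge0 // mulr_ge0.
  - move=> p hx hy ht; have [h1 h2] := Hd p hx hy ht.
    rewrite phi1; first exact: (quarter_le h1).
    exact: (le_trans h2 (le_trans rP (rk 3%N))).
  - move=> j; have : `|hx p0 0 j| <= \sum_j `|hx p0 0 j|.
      by rewrite (bigD1 j) //= lerDl sumr_ge0.
    by move=> h; case: (window_le s1 s2 t0 rr0 rS (rk 1%N)) => X1 X2 _; exact: (le_trans (lerD h (lexx d))).
  - move=> j; have : `|hy p0 0 j| <= \sum_j `|hy p0 0 j|.
      by rewrite (bigD1 j) //= lerDl sumr_ge0.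
    by move=> h; case: (window_le s1 s2 t0 rr0 rS (rk 1%N)) => X1 X2 _; exact: (le_trans (lerD h (lexx d))).
  - by case: (window_le s1 s2 t0 rr0 rS (rk 1%N)).
pose N := (maxn N1 N2).+1.
have := HN2 N (leq_maxr _ _); rewrite -/L => low.
have N0 : (0 < N)%N by [].
have up : gsum r N (fun p => 1 / 4 * phi p * F0 p) <= L / 4 +
   (C / 2 + 20) * (K ^+ 3 * K ^+ n.-1) * (5 ^+ n.*2.+1 * r%:R ^+ n.*2.+2).
  apply: (le_trans (ler_gsum r0 N0 (fun p _ => master p))); rewrite gsumD; apply: lerD.
    exact: (le_trans (ler_norm _) (HN1 N (leq_maxl _ _))).
  have C20 : 0 <= C / 2 + 20 by lra.
  apply: gsum_const => //; exact: (mulr_ge0 C20 (mulr_ge0 (exprn_ge0 _ (ltW K0)) (exprn_ge0 _ (ltW K0)))).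
have last : (C / 2 + 20) * (K ^+ 3 * K ^+ n.-1) * (5 ^+ n.*2.+1 * r%:R ^+ n.*2.+2) <= L / 4.
  (* K^(n+2) has r^(2n+4) in the denominator: the volume r^(2n+2) cancels and r^-2 is left. *)
  have -> : K ^+ 3 * K ^+ n.-1 = kap ^+ n.+2 / r%:R ^+ n.*2.+2 / r%:R ^+ 2.
    rewrite -exprD (_ : (3 + n.-1 = n.+2)%N); last by case: (n) n2.
    rewrite /K expr_div_n -exprM -mulrA -invfM -exprD; congr (_ / _ ^+ _).
    by rewrite mul2n !doubleS addn2.
  have r20 : r%:R ^+ n.*2.+2 != 0 :> R by rewrite expf_neq0 // gt_eqF.
  have -> : (C / 2 + 20) * (kap ^+ n.+2 / r%:R ^+ n.*2.+2 / r%:R ^+ 2) *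
     (5 ^+ n.*2.+1 * r%:R ^+ n.*2.+2) = B / r%:R ^+ 2.
    rewrite /B; move: (r%:R ^+ n.*2.+2) r20 (kap ^+ _) (5 ^+ _) => a a0 b e.
    by field; rewrite a0 gt_eqF.
  rewrite ler_pdivrMr ?exprn_gt0 // mulrC -ler_pdivrMr //.
  exact: (le_trans rB (rk 1%N)).
exact: (quarter_contra L0 low up last).
Qed.

End Pointwise.

(** * Integration of the rigidity equations *)

Section Constants.
Variables (R : realType) (n : nat).
Notation H := (Hn R n).
Notation c := (heis R n).

Lemma derive_eq0_const (f : H -> R) : smooth f -> (forall a p, 'D_(ex a) f p = 0) ->
  (forall a p, 'D_(ey a) f p = 0) -> (forall p, 'D_et f p = 0) -> forall p, f p = f 0.
Proof.
move=> sf fx fy ft p; have df q := smooth_differentiable q sf.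
have D0 v q : 'D_v f q = 0.
  have -> : v = \sum_a hx v 0 a *: (ex a : H) + \sum_a hy v 0 a *: (ey a : H) + ht v *: (et : H).
    have sE (J : finType) (F : J -> H) : \sum_j F j =
        (\sum_j (F j).1.1, \sum_j (F j).1.2, \sum_j (F j).2).
      rewrite [LHS]surjective_pairing [(\sum_j F j).1]surjective_pairing.
      by rewrite !(raddf_sum fst, raddf_sum snd).
    rewrite !sE; case: v => [[x y] t]; rewrite /hx /hy /ht /=.
    congr (_, _, _).
    - transitivity (\sum_a x 0 a *: \row_j (j == a)%:R + \sum_a y 0 a *: 0 + t *: (0 : 'rV[R]_n)) => //.
      rewrite scaler0 addr0 [X in _ = _ + X]big1 ?addr0 => [|a _]; last by rewrite scaler0.
      rewrite [LHS]row_sum_delta; apply: eq_bigr => a _; congr (_ *: _).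
      by apply/rowP => j; rewrite !mxE eqxx.
    - transitivity (\sum_a x 0 a *: 0 + \sum_a y 0 a *: \row_j (j == a)%:R + t *: (0 : 'rV[R]_n)) => //.
      rewrite scaler0 addr0 [X in _ = X + _]big1 ?add0r => [|a _]; last by rewrite scaler0.
      rewrite [LHS]row_sum_delta; apply: eq_bigr => a _; congr (_ *: _).
      by apply/rowP => j; rewrite !mxE eqxx.
    - transitivity (\sum_a x 0 a * 0 + \sum_a y 0 a * 0 + t * 1) => //.
      by rewrite mulr1 !big1 ?add0r // => a _; rewrite mulr0.
  have lin := deriveE _ (df q).
  rewrite lin !linearD !linear_sum /= big1 => [|a _].
    rewrite big1 => [|a _]; first by rewrite linearZ_LR -lin ft scaler0 !addr0.
    by rewrite linearZ_LR -lin fy scaler0.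
  by rewrite linearZ_LR -lin fx scaler0.
have [t _] := mvt_line 0 p ltr01 df; rewrite D0 mulr0 add0r scale1r => /eqP.
by rewrite subr_eq0 => /eqP.
Qed.

Lemma sm_cancel2 (F : sm R n) : 2%:R * F = 0 -> F = 0.
Proof.
move=> e; apply: val_inj; apply/funext => p.
have /eqP := congr1 (fun X => smval X p) e; rewrite smvalM smval_nat smval0 mulf_eq0.
by rewrite pnatr_eq0 => /eqP.
Qed.

(** A single index a suffices to recover the t-derivative from the commutator of Z_a and Zb_a; the x
    and y derivatives then follow by addition and subtraction. *)
Lemma sm_const (F : sm R n) : (0 < n)%N -> (forall a, Z c a F = 0) ->
  (forall a, Zb c a F = 0) -> exists z, F = cst_ n z.
Proof.
move=> n0 ZF ZbF; have hc := heis_axioms R n.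
have TF : cder et F = 0.
  have e : 0 = 2%:R * ii R n * cder et F.
    have := cZbZ hc (Ordinal n0) (Ordinal n0) F.
    by rewrite ZF ZbF (der0 (cZ hc _)) (der0 (cZb hc _)) eqxx add0r mul1r.
  apply: sm_cancel2; rewrite -[RHS](mulr0 (- ii R n)) e -[LHS]mul1r -[1]opprK -(ii2 R n).
  move: (ii R n) (cder et F) => i X; ring.
have XYF a : cder (ex a) F - ii R n * cder (ey a) F = 0 /\
             cder (ex a) F + ii R n * cder (ey a) F = 0.
  have := ZF a; have := ZbF a; rewrite /= TF !mulr0 addr0 subr0.
  have := hh2 R n; move: (hh R n) (cder _ _ - _) (cder _ _ + _) => h x y hh e1 e2.
  by rewrite -[x]mul1r -[y]mul1r -hh !mulrDl e1 e2 addr0.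
have XF a : cder (ex a) F = 0.
  have [e1 e2] := XYF a; apply: sm_cancel2; rewrite -[RHS]addr0 -{1}e1 -e2; ring.
have YF a : cder (ey a) F = 0.
  have [_] := XYF a; rewrite XF add0r => e.
  rewrite -[LHS]mul1r -[1]opprK -(ii2 R n) mulNr -mulrA e; ring.
have re0 := derive_eq0_const (smooth_re F) (fun a p => congr1 (fun G => re_ G p) (XF a))
  (fun a p => congr1 (fun G => re_ G p) (YF a)) (fun p => congr1 (fun G => re_ G p) TF).
have im0 := derive_eq0_const (smooth_im F) (fun a p => congr1 (fun G => im_ G p) (XF a))
  (fun a p => congr1 (fun G => im_ G p) (YF a)) (fun p => congr1 (fun G => im_ G p) TF).
by exists (Complex (re_ F 0) (im_ F 0)); apply: sm_ext => p; rewrite ?re0 ?im0.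
Qed.

Lemma Z_zz a b : Z c b (zz R a) = (a == b)%:R.
Proof.
rewrite /= X_zz Y_zz T_zz mulr0 addr0 mulrA (ii2 R n) mulN1r opprK mulrDr -mulrDl.
by rewrite (hh2 R n) mul1r.
Qed.

Lemma Zb_zz a b : Zb c b (zz R a) = 0.
Proof. by rewrite /= X_zz Y_zz T_zz mulr0 subr0 mulrA (ii2 R n) mulN1r subrr mulr0. Qed.

Lemma Z_zzb a b : Z c b (zzb R a) = 0.
Proof. by rewrite /= X_zzb Y_zzb T_zzb mulr0 addr0 mulrN mulrA (ii2 R n) mulN1r !opprK subrr mulr0. Qed.

Lemma Zb_zzb a b : Zb c b (zzb R a) = (a == b)%:R.
Proof.
rewrite /= X_zzb Y_zzb T_zzb mulr0 subr0 mulrN mulrA (ii2 R n) mulN1r opprK mulrDr -mulrDl.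
by rewrite (hh2 R n) mul1r.
Qed.

Lemma Z_tt b : Z c b (tt R n) = ii R n * zzb R b.
Proof. by rewrite /= X_tt Y_tt T_tt mulr0 subrr mulr0 add0r mulr1. Qed.

Lemma Zb_tt b : Zb c b (tt R n) = - (ii R n * zz R b).
Proof. by rewrite /= X_tt Y_tt T_tt mulr0 addr0 mulr0 add0r mulr1. Qed.

Lemma Z_cst b z : Z c b (cst_ n z) = 0.
Proof. by rewrite /= !cder_cst !mulr0 subrr mulr0 addr0. Qed.

Lemma Zb_cst b z : Zb c b (cst_ n z) = 0.
Proof. by rewrite /= !cder_cst !mulr0 addr0 mulr0 subr0. Qed.

(** |z|^2 - i t is a particular solution. Its Z_a-derivative is 2 zbar_a, so Z_a h - 2 zbar_a is a
    constant nu_a, and subtracting nu.z as well leaves a constant. *)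
Lemma cr_quadratic (h : sm R n) : (0 < n)%N -> (forall a, Zb c a h = 0) ->
  (forall a b, Z c b (Z c a h) = 0) ->
  (forall a b, Zb c b (Z c a h) = 2%:R * (a == b)%:R) ->
  exists nu z, h = \sum_a zz R a * zzb R a - ii R n * tt R n
    + (\sum_a cst_ n (nu a) * zz R a) + cst_ n z.
Proof.
move=> n0 Zbh ZZh ZbZh; have hc := heis_axioms R n.
have nuP a : exists z, Z c a h - 2%:R * zzb R a = cst_ n z.
  apply: (sm_const n0) => b.
    by rewrite (derB (cZ hc b)) ZZh (derMn (cZ hc b)) Z_zzb mulr0 subr0.
  by rewrite (derB (cZb hc b)) ZbZh (derMn (cZb hc b)) Zb_zzb subrr.
have [nu nuE] := choice nuP; exists nu.
set q := \sum_a zz R a * zzb R a - _; set l := \sum_a cst_ n (nu a) * _.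
have Zq a : Z c a q = 2%:R * zzb R a.
  rewrite /q (derB (cZ hc a)) (der_sum (cZ hc a)) (derM (cZ hc a)) (cZI hc) Z_tt mul0r add0r.
  have -> : ii R n * (ii R n * zzb R a) = - zzb R a by rewrite mulrA (ii2 R n) mulN1r.
  under eq_bigr => b _ do rewrite (derM (cZ hc a)) Z_zz Z_zzb mulr0 addr0 eq_sym.
  rewrite sum_delta; move: (zzb R a) => x; ring.
have Zbq a : Zb c a q = 0.
  rewrite /q (derB (cZb hc a)) (der_sum (cZb hc a)) (derM (cZb hc a)) (cZbI hc) Zb_tt mul0r add0r.
  have -> : ii R n * (- (ii R n * zz R a)) = zz R a.
    by rewrite mulrN mulrA (ii2 R n) mulN1r opprK.
  under eq_bigr => b _ do rewrite (derM (cZb hc a)) Zb_zz Zb_zzb mul0r add0r eq_sym mulrC.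
  by rewrite sum_delta subrr.
have Zl a : Z c a l = cst_ n (nu a).
  rewrite /l (der_sum (cZ hc a)).
  under eq_bigr => b _ do rewrite (derM (cZ hc a)) Z_cst Z_zz mul0r add0r eq_sym mulrC.
  by rewrite sum_delta.
have Zbl a : Zb c a l = 0.
  rewrite /l (der_sum (cZb hc a)) big1 // => b _.
  by rewrite (derM (cZb hc a)) Zb_cst Zb_zz mul0r mulr0 addr0.
have [z zE] : exists z, h - (q + l) = cst_ n z.
  apply: (sm_const n0) => a.
    rewrite (derB (cZ hc a)) (derD (cZ hc a)) Zq Zl -nuE; move: (Z c a h) (zzb R a) => x y; ring.
  by rewrite (derB (cZb hc a)) (derD (cZb hc a)) Zbq Zbl Zbh addr0 subr0.
by exists z; rewrite -zE addrC subrK.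
Qed.

End Constants.

Lemma inverse_re_gt0 (R : realType) (a b x y : R) : a * x - b * y = 1 -> a * y + b * x = 0 ->
  0 < x -> 0 < a.
Proof.
move=> h1 h2 x0; have e : a * (x ^+ 2 + y ^+ 2) = x.
  transitivity (x * (a * x - b * y) + y * (a * y + b * x)); first by ring.
  by rewrite h1 h2; ring.
have s0 : 0 < x ^+ 2 + y ^+ 2 by rewrite ltr_pwDl ?exprn_gt0 ?sqr_ge0.
by rewrite -(pmulr_lgt0 _ s0) e.
Qed.

Section Bubble.
Variables (R : realType) (n : nat) (f E2 : sm R n).
Notation H := (Hn R n).
Notation c := (heis R n).
Hypotheses (n0 : (0 < n)%N) (sol : jl_sol c f E2) (cjf : cj f = f) (cjE2 : cj E2 = E2).

Lemma sm_inverse (g : sm R n) : (forall p, 0 < re_ g p) -> exists h, h * g = 1.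
Proof.
move=> g0; pose d p := re_ g p * re_ g p + im_ g p * im_ g p.
have sd : smooth d by apply: smoothD; apply: smoothM; exact: smooth_re || exact: smooth_im.
have d0 p : d p != 0 by rewrite gt_eqF // ltr_pwDl ?mulr_gt0 // -expr2 sqr_ge0.
exists (cj g * real (smoothV sd d0)); apply: sm_ext => p.
  rewrite !(reM, imM) re_cj im_cj.
  have -> : re_ (1 : sm R n) p = (d p)^-1 * d p by rewrite mulVf.
  have -> : re_ (real (smoothV sd d0)) p = (d p)^-1 by [].
  have -> : im_ (real (smoothV sd d0)) p = 0 by [].
  by rewrite [X in _ = _ * X]/d; move: ((d p)^-1) (re_ g p) (im_ g p) => *; ring.
rewrite !(reM, imM) re_cj im_cj.
have -> : im_ (1 : sm R n) p = 0 by [].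
have -> : im_ (real (smoothV sd d0)) p = 0 by [].
by move: (re_ (real _) p) (re_ g p) (im_ g p) => *; ring.
Qed.

Hypothesis e20 : forall p, 0 < e2 E2 p.
Hypotheses (Dt0 : forall a b, Dt c f a b = 0) (Et0 : forall a b, Et c f E2 a b = 0).
Hypothesis Gv0 : forall a, Gv c f E2 a = 0.

Lemma rigid_bubble : exists (lam : cpx R) (mu : 'I_n -> cpx R) (k : R),
  lam.2 > cnorm2 mu / 4 /\ forall p, let W := cabs (cadd (cadd (cadd (creal (ht p))
     (cmul cI (creal (zsq p)))) (zdot p mu)) lam) in 0 < W /\ e2 E2 p * W ^+ 2 = k.
Proof.
have cD := @sm_cjD R n; have cM := @sm_cjM R n; have c1 := sm_cj1 R n.
have cI' : cj (I c) = - I c := cj_ii R n.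
have cZ' := @cj_Z R n; have cZb' := @cj_Zb R n.
have cT' (x : sm R n) : cj (T c x) = T c (cj x) := cj_cder et x.
have c00 := cj0 cD.
have gpos p : 0 < re_ (gg c f E2) p.
  by rewrite (gg_re cjf cjE2 p).1 ltr_wpDl // nn_ge0.
have [h hg] := sm_inverse gpos.
have hbg : cj h * gg (swap c) f E2 = 1.
  by rewrite -(cj_gg cD cM cI' cZ' cZb' cT' cjf cjE2) -cM hg c1.
have Dt0' a b : Dt (swap c) f a b = 0.
  by rewrite -(cj_Dt cD cM c1 cZ' cjf) Dt0.
have Et0' a b : Et (swap c) f E2 a b = 0 by rewrite (Et_herm sol) Et0.
have Gv0' a : Gv (swap c) f E2 a = 0.
  by rewrite -(cj_Gv cD cM cI' cZ' cZb' cT' cjf cjE2) Gv0.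
have sol' := jl_swap sol.
have hg' : h * gg (swap (swap c)) f E2 = 1 by rewrite swapK.
have Zbh a : Zb c a h = 0 := Z_inv_ggb sol' Dt0' Et0' Gv0' hg' a.
have [nu [z hE]] := cr_quadratic n0 Zbh (ZZ_inv_gg sol Dt0 Et0 Gv0 hg)
  (fun a b => ZbZ_inv_gg sol Dt0 Et0 Gv0 hg a (Zbh b)).
have [k kE] := sm_const n0 (Z_energy sol Dt0 Et0 Gv0 hg hbg)
  (fun a => etrans (congr1 (fun x => Zb c a (E2 * x)) (mulrC _ _))
     (Z_energy sol' Dt0' Et0' Gv0' hbg hg' a)).
have hpos p : 0 < re_ h p.
  have := congr1 (fun x => re_ x p) hg; have := congr1 (fun x => im_ x p) hg.
  rewrite imM reM; move=> h1 h2; exact: (inverse_re_gt0 h2 h1 (gpos p)).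
(* [mu] and [lam] are i nu and i z, because the denominator of the bubble is i h. *)
pose mu a : cpx R := (- complex.Im (nu a), complex.Re (nu a)).
pose lam : cpx R := (- complex.Im z, complex.Re z).
have WE p : cadd (cadd (cadd (creal (ht p)) (cmul cI (creal (zsq p)))) (zdot p mu)) lam =
    (- im_ h p, re_ h p).
  rewrite [in RHS]hE !(reD, imD, re_sum, im_sum) reN imN reM imM re_ii im_ii.
  rewrite /cadd /creal /cmul /cI /zdot /csum /lam /zsq /=.
  have -> : re_ (tt R n) p = ht p by [].
  have -> : im_ (tt R n) p = 0 by [].
  have -> : re_ (cst_ n z) p = complex.Re z by [].
  have -> : im_ (cst_ n z) p = complex.Im z by [].
  have s1 : \sum_a re_ (zz R a * zzb R a) p = \sum_a (hx p 0 a ^+ 2 + hy p 0 a ^+ 2).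
    apply: eq_bigr => a _; rewrite reM re_zz im_zz re_zzb im_zzb.
    by move: (hx p 0 a) (hy p 0 a) => x y; ring.
  have s2 : \sum_a im_ (zz R a * zzb R a) p = 0.
    rewrite big1 // => a _; rewrite imM re_zz im_zz re_zzb im_zzb.
    by move: (hx p 0 a) (hy p 0 a) => x y; ring.
  have s3 : \sum_a re_ (cst_ n (nu a) * zz R a) p =
      \sum_a (hx p 0 a * (mu a).2 + hy p 0 a * (mu a).1).
    apply: eq_bigr => a _; rewrite reM re_zz im_zz /mu /re_ /im_ /=.
    by move: (hx p 0 a) (hy p 0 a) => x y; ring.
  have s4 : \sum_a im_ (cst_ n (nu a) * zz R a) p =
      - \sum_a (hx p 0 a * (mu a).1 - hy p 0 a * (mu a).2).
    rewrite -sumrN; apply: eq_bigr => a _; rewrite imM re_zz im_zz /mu /re_ /im_ /=.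
    by move: (hx p 0 a) (hy p 0 a) => x y; ring.
  rewrite s1 s2 s3 s4; clear; move: (\sum_a _) (\sum_a _) (\sum_a _) => A B C.
  by congr (_, _); ring.
exists lam, mu, (complex.Re k); split.
  (* The minimum point in z of Re h, where its value is Im(lambda) - |mu|^2 / 4. Positivity of Re h
     there is the condition on lambda. *)
  pose p0 : H := (\row_a (- (mu a).2 / 2), \row_a (- (mu a).1 / 2), 0).
  have := hpos p0; have /(congr1 snd) /= <- := WE p0.
  rewrite /zsq /cnorm2 !mul0r add0r mul1r.
  have -> : \sum_a (hx p0 0 a ^+ 2 + hy p0 0 a ^+ 2) = \sum_a ((mu a).1 ^+ 2 + (mu a).2 ^+ 2) / 4.
    by apply: eq_bigr => a _; rewrite /hx /hy /= !mxE; field.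
  have -> : \sum_i (hx p0 0 i * complex.Re (nu i) + hy p0 0 i * - complex.Im (nu i)) =
      - \sum_a ((mu a).1 ^+ 2 + (mu a).2 ^+ 2) / 2.
    by rewrite -sumrN; apply: eq_bigr => a _; rewrite /hx /hy /= !mxE /mu /=; field.
  rewrite -!mulr_suml; move: (\sum_a _) (complex.Re z) => S w; lra.
move=> p; rewrite WE /cabs /= sqrrN.
have s0 : 0 < im_ h p ^+ 2 + re_ h p ^+ 2 by rewrite ltr_wpDl ?exprn_gt0 ?sqr_ge0.
split; first by rewrite sqrtr_gt0.
rewrite sqr_sqrtr ?(ltW s0) //; have := congr1 (fun x => re_ x p) kE.
rewrite !(reM, imM) re_cj im_cj (im_e2 cjE2) mul0r subr0 -/(e2 E2 p) => e.
rewrite -[RHS]e; move: (e2 E2 p) (re_ h p) (im_ h p) => *; ring.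
Qed.

End Bubble.

(** (Q - 2) / 2 = n turns the decay into (e r)^n <= C. As C <= (1 + C)^n, the number 1 + C replaces
    an n-th root of C. *)
Lemma decay_bound (R : realType) (n r : nat) (C e P : R) : (0 < n)%N -> (0 < r)%N -> 0 < C ->
  0 < e -> r%:R ^+ 4 <= P ->
  e ^+ n <= C / (1 + powR (powR P (1 / 4)) ((Qdim n - 2) / 2)) ->
  e ^+ 2 <= (1 + C) ^+ 2 / r%:R ^+ 2.
Proof.
move=> n0 r0 C0 e0 rP; have -> : (Qdim n - 2) / 2 = n%:R :> R.
  by rewrite /Qdim natrD natrM addrK mulrC mulKf ?pnatr_eq0.
have rr : 0 < r%:R :> R by rewrite ltr0n.
rewrite powR_mulrn ?powR_ge0 // => le.
have q : r%:R <= powR P (1 / 4).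
  have {1}-> : r%:R = powR (r%:R ^+ 4) (1 / 4) :> R.
    by rewrite -powR_mulrn ?(ltW rr) // -powRrM div1r divff ?pnatr_eq0 // powRr1 // ltW.
  by rewrite ge0_ler_powR ?nnegrE ?divr_ge0 ?exprn_ge0 ?(ltW rr) // (le_trans _ rP) ?exprn_ge0 ?(ltW rr).
have rn0 : 0 < r%:R ^+ n :> R by rewrite exprn_gt0.
have qn : r%:R ^+ n <= powR P (1 / 4) ^+ n by rewrite lerXn2r ?nnegrE ?powR_ge0 ?ler0n.
have le2 : e ^+ n <= C / r%:R ^+ n.
  apply: (le_trans le); rewrite ler_pM2l // lef_pV2 ?posrE //.
    by rewrite (le_trans qn) // lerDr.
  by rewrite ltr_pwDl // exprn_ge0 // powR_ge0.
have : (e * r%:R) ^+ n <= (1 + C) ^+ n.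
  rewrite exprMn; apply: (@le_trans _ _ C); first by rewrite -ler_pdivlMr.
  apply: (@le_trans _ _ (1 + C)); first by rewrite lerDr.
  by rewrite ler_eXnr // lerDl ltW.
rewrite ler_pXn2r ?nnegrE ?mulr_ge0 ?(ltW e0) ?(ltW rr) ?addr_ge0 ?(ltW C0) // => le3.
by rewrite ler_pdivlMr ?exprn_gt0 // -exprMn lerXn2r ?nnegrE ?mulr_ge0 ?(ltW e0) ?(ltW rr) ?addr_ge0 ?(ltW C0).
Qed.

Theorem theorem1p2 (R : realType) (n : nat) (u : Hn R n -> R) :
  (2 <= n)%N ->
  smooth u ->
  (forall xi, 0 < u xi) ->
  (forall xi, cneg (subLap u xi) =
     creal (2 * (n%:R) ^+ 2 * powR (u xi) ((Qdim n + 2) / (Qdim n - 2)))) ->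
  (exists C : R, 0 < C /\
     forall xi, u xi <= C / (1 + powR (hnorm xi) ((Qdim n - 2) / 2))) ->
  exists (lam : cpx R) (mu : 'I_n -> cpx R) (C' : R),
    lam.2 > cnorm2 mu / 4 /\ 0 < C' /\
    forall xi, u xi = JLbubble C' lam mu xi.
Proof.
move=> n2 su u0 ueq [C [C0 dec]].
have n0 : (0 < n)%N by exact: leq_trans n2.
have sol := jl_sol_u n0 su u0 ueq.
have cjf : cj (Fs su u0) = Fs su u0 := cj_real _.
have cjE k : cj (EX su u0 k) = EX su u0 k := cj_real _.
have coef : (2 * n.-1)%:R = 2%:R * n%:R - 2%:R :> sm R n.
  by rewrite -subn1 mulnBr muln1 natrB ?natrM // leq_pmulr.
have wZ a : Z (heis R n) a (EX su u0 (2 * n.-1)) =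
    (2%:R * n%:R - 2%:R) * EX su u0 (2 * n.-1) * Z (heis R n) a (Fs su u0).
  by rewrite -coef; exact: Z_EX.
have wZb a : Zb (heis R n) a (EX su u0 (2 * n.-1)) =
    (2%:R * n%:R - 2%:R) * EX su u0 (2 * n.-1) * Zb (heis R n) a (Fs su u0).
  by rewrite -coef; exact: Zb_EX.
pose e p := expR (logu u p).
have e0 p : 0 < e p by exact: expR_gt0.
have eX k p : re_ (EX su u0 k) p = e p ^+ k by rewrite /re_ /= expRM_natl.
have ue p : u p = e p ^+ n by rewrite -expRM_natl EX_u.
have e2E p : e2 (EX su u0 2) p = e p ^+ 2 := eX 2%N p.
have vanish p : re_ (EX su u0 (2 * n.-1)) p * (e2 (EX su u0 2) p *
    T2 (Fs su u0) (EX su u0 2) p + QQ (Fs su u0) (EX su u0 2) p) = 0.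
  apply: (jerison_lee_vanish sol cjf (cjE 2%N) (cjE (2 * n.-1)%N) wZ wZb
    (C1 := (1 + C) ^+ 2)) => //; first exact: sqr_ge0.
  - by move=> q; rewrite e2E sqr_ge0.
  - by move=> q; rewrite eX e2E -exprM.
  - move=> r q r0 rP; rewrite e2E.
    by apply: (decay_bound n0 r0 C0 (e0 q) rP); rewrite -ue; exact: dec.
have T2QQ p : T2 (Fs su u0) (EX su u0 2) p = 0 /\ QQ (Fs su u0) (EX su u0 2) p = 0.
  have e2p : 0 < e2 (EX su u0 2) p by rewrite e2E exprn_gt0.
  have wp : 0 < re_ (EX su u0 (2 * n.-1)) p by rewrite eX exprn_gt0.
  have T0 := T2_ge0 (Fs su u0) (EX su u0 2) p.
  have Q0 := QQ_ge0 (Fs su u0) (EX su u0 2) p.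
  have /eqP := vanish p; rewrite mulf_eq0 gt_eqF //= paddr_eq0 ?mulr_ge0 ?(ltW e2p) //.
  by rewrite mulf_eq0 gt_eqF //= => /andP[/eqP -> /eqP ->].
have sm0 (F : sm R n) : (forall p, pr F p = (0, 0)) -> F = 0.
  by move=> F0; apply: sm_ext => p; have [] := F0 p.
(* G vanishes because QQ is positive definite; D and E vanish as full tensors through [T2]. *)
have Gv0 a : Gv (heis R n) (Fs su u0) (EX su u0 2) a = 0.
  apply: sm0 => p; apply: (@nn_eq0 R n (vG (Fs su u0) (EX su u0 2) p)).
  have := QQ_ge (Fs su u0) (EX su u0 2) p; rewrite (T2QQ p).2 mulr0.
  have := ip_ge0 (vD (Fs su u0) p); have := ip_ge0 (vE (Fs su u0) (EX su u0 2) p).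
  by move: (ip _ _) (ip _ _) (ip _ _) => *; lra.
have DE0 a p : ip (fun b => pr (Dt (heis R n) (Fs su u0) a b) p)
       (fun b => pr (Dt (heis R n) (Fs su u0) a b) p) <= 0 /\
     ip (fun b => pr (Et (heis R n) (Fs su u0) (EX su u0 2) a b) p)
       (fun b => pr (Et (heis R n) (Fs su u0) (EX su u0 2) a b) p) <= 0.
  have := (T2QQ p).1; rewrite /T2 => /eqP; rewrite psumr_eq0 => [|b _]; last first.
    by rewrite addr_ge0 ?ip_ge0.
  move=> /allP /(_ a); rewrite mem_index_enum => /(_ isT) /=.
  by rewrite paddr_eq0 ?ip_ge0 // => /andP[/eqP -> /eqP ->].
have Dt0 a b : Dt (heis R n) (Fs su u0) a b = 0.
  apply: sm0 => p.
  exact: (@nn_eq0 R n (fun b => pr (Dt (heis R n) (Fs su u0) a b) p) (DE0 a p).1 b).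
have Et0 a b : Et (heis R n) (Fs su u0) (EX su u0 2) a b = 0.
  apply: sm0 => p.
  exact: (@nn_eq0 R n (fun b => pr (Et (heis R n) (Fs su u0) (EX su u0 2) a b) p) (DE0 a p).2 b).
have e20 p : 0 < e2 (EX su u0 2) p by rewrite e2E exprn_gt0.
have [lam [mu [k [lam0 W]]]] := rigid_bubble n0 sol cjf (cjE 2%N) e20 Dt0 Et0 Gv0.
(* e^(2f) W^2 = k gives e^f W = sqrt k, and u is the n-th power of e^f. *)
exists lam, mu, (Num.sqrt k ^+ n); split=> //.
have kE p : Num.sqrt k = e p * cabs (cadd (cadd (cadd (creal (ht p))
    (cmul cI (creal (zsq p)))) (zdot p mu)) lam).
  have [W0 <-] := W p; rewrite e2E -exprMn sqrtr_sqr ger0_norm //.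
  by rewrite mulr_ge0 ?(ltW W0) ?(ltW (e0 p)).
split=> [|p]; first by rewrite exprn_gt0 // (kE 0) mulr_gt0 //; have [] := W 0.
rewrite ue /JLbubble (kE p) exprMn mulfK //.
by rewrite expf_neq0 // gt_eqF //; have [] := W p.
Qed.
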